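(* Let $M$ and $N$ be smooth compact connected surfaces. If $\mathrm{Free}^\infty(M,\mathbb{R}^5)\neq\varnothing$ and $\mathrm{Free}^\infty(N,\mathbb{R}^5)\neq\varnothing$, then $\mathrm{Free}^\infty(M\#N,\mathbb{R}^5)\neq\varnothing$, where $M\#N$ denotes the connected sum of $M$ and $N$.
   Context: For a smooth surface ($2$-dimensional manifold) $M$, a map $f\in C^2(M,\mathbb{R}^5)$ is called free if, in local coordinates $(x,y)$ on $M$, the five vectors $\partial_x f,\ \partial_y f,\ \partial_{xx}f,\ \partial_{xy}f,\ \partial_{yy}f$ of $\mathbb{R}^5$ are linearly independent at every point. This condition does not depend on the choice of local coordinates on $M$, and every free map is an immersion. $\mathrm{Free}^\infty(M,\mathbb{R}^5)$ denotes the set of all free $C^\infty$ immersions of $M$ into $\mathbb{R}^5$. *)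

(* Defs.v *)
From HB Require Import structures.
From mathcomp Require Import all_boot all_order all_algebra.
From mathcomp Require Import all_classical all_reals all_analysis.

Set Implicit Arguments.
Unset Strict Implicit.
Unset Printing Implicit Defensive.

Import Order.TTheory GRing.Theory Num.Theory.
Import numFieldNormedType.Exports.

Local Open Scope classical_set_scope.
Local Open Scope ring_scope.

Definition partial (R : realType) (V : normedModType R) (i : 'I_2)
  (f : 'rV[R]_2 -> V) : 'rV[R]_2 -> V := 'D_(delta_mx 0 i) f.

(* Only meaningful for an open U: then a partial derivative at a point of U
   does not see the values of the total function f outside U. *)
Fixpoint Ck_on (R : realType) (V : normedModType R) (k : nat)
  (U : set 'rV[R]_2) (f : 'rV[R]_2 -> V) : Prop :=
  match k with
  | 0 => {in U, continuous f}
  | k'.+1 => forall i : 'I_2,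
      (forall p, U p -> derivable f p (delta_mx 0 i)) /\ Ck_on k' U (partial i f)
  end.

Definition smooth_on (R : realType) (V : normedModType R)
  (U : set 'rV[R]_2) (f : 'rV[R]_2 -> V) : Prop := forall k, Ck_on k U f.

(* cmap and param are total functions; cmap is only relevant on cdom and
   param on the image of cdom, where the two are mutually inverse
   homeomorphisms. *)
Record chart (R : realType) (M : topologicalType) := Chart {
  cdom : set M ;
  cmap : M -> 'rV[R]_2 ;
  param : 'rV[R]_2 -> M ;
  cdom_open : open cdom ;
  ccod_open : open (cmap @` cdom) ;
  cmapK : {in cdom, cancel cmap param} ;
  cmap_continuous : {in cdom, continuous cmap} ;
  param_continuous : {in cmap @` cdom, continuous param} }.

Definition ccod (R : realType) (M : topologicalType) (c : chart R M)
  : set 'rV[R]_2 := cmap c @` cdom c.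

Definition transition_smooth (R : realType) (M : topologicalType)
  (c d : chart R M) : Prop :=
  smooth_on (cmap c @` (cdom c `&` cdom d)) (cmap d \o param c).

Definition compatible (R : realType) (M : topologicalType)
  (c d : chart R M) : Prop := transition_smooth c d /\ transition_smooth d c.

(* Smooth surfaces without boundary; the smooth structure is a maximal atlas,
   so that atlas is the set of all local coordinates. *)
Record surface (R : realType) := Surface {
  points :> topologicalType ;
  points_hausdorff : hausdorff_space points ;
  points_second_countable : @second_countable points ;
  atlas : set (chart R points) ;
  atlas_cover : forall x, exists2 c, atlas c & cdom c x ;
  atlas_compatible : forall c d, atlas c -> atlas d -> compatible c d ;
  atlas_maximal :
    forall c, (forall d, atlas d -> compatible c d) -> atlas c }.

(* Smoothness on an open U of a map defined on all of M (arbitrarily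
   outside U). *)
Definition smooth_map_on (R : realType) (M N : surface R) (U : set M)
  (f : M -> N) : Prop :=
  {in U, continuous f} /\
  forall (c : chart R M) (d : chart R N), atlas c -> atlas d ->
    smooth_on (cmap c @` (U `&` cdom c `&` f @^-1` cdom d))
              (cmap d \o f \o param c).

Definition open_embedding_on (R : realType) (M N : surface R) (U : set M)
  (f : M -> N) : Prop :=
  [/\ open U, open (f @` U), smooth_map_on U f &
      exists2 g : N -> M, {in U, cancel f g} & smooth_map_on (f @` U) g].

(* The norm of 'rV[R]_2 in the library is the sup norm, hence an explicit
   Euclidean one. *)
Definition enorm (R : realType) (v : 'rV[R]_2) : R :=
  Num.sqrt (\sum_(i < 2) v 0 i ^+ 2).

(* param c restricts to a smooth embedding of the closed unit disc; every
   smooth embedding of the closed disc arises so, since it extends to a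
   diffeomorphism from an open neighbourhood of the disc onto an open subset
   of M. *)
Definition disc_chart (R : realType) (M : surface R) (c : chart R M) : Prop :=
  atlas c /\ [set v | enorm v <= 1] `<=` ccod c.

(* P is a connected sum of M and N, in the form of Kervaire and Milnor: for
   some smoothly embedded discs h1 := param c and h2 := param d, P is the
   quotient of the disjoint union of M minus h1 0 and N minus h2 0 in which
   h1 (t u) is identified with h2 ((1 - t) u) for all 0 < t < 1 and all unit
   vectors u. The maps i and j are the two canonical maps into this quotient,
   which determine P up to diffeomorphism. *)
Definition connected_sum (R : realType) (M N P : surface R) : Prop :=
  exists (c : chart R M) (d : chart R N) (i : M -> P) (j : N -> P),
    let M' := ~` [set param c 0] in
    let N' := ~` [set param d 0] in
    [/\ disc_chart c /\ disc_chart d,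
        open_embedding_on M' i,
        open_embedding_on N' j,
        i @` M' `|` j @` N' = [set: P] &
        forall x y, M' x -> N' y ->
          (i x = j y <->
           exists (t : R) (u : 'rV[R]_2),
             [/\ 0 < t < 1, enorm u = 1,
                 x = param c (t *: u) & y = param d ((1 - t) *: u)])].

Definition Ck_map (R : realType) (M : surface R) (V : normedModType R)
  (k : nat) (f : M -> V) : Prop :=
  forall c, atlas c -> Ck_on k (ccod c) (f \o param c).

Definition free_map (R : realType) (M : surface R) (f : M -> 'rV[R]_5) : Prop :=
  Ck_map 2 f /\
  forall (c : chart R M) (p : 'rV[R]_2), atlas c -> ccod c p ->
    let g := f \o param c in
    let dx := @partial R 'rV[R]_5 0 in
    let dy := @partial R 'rV[R]_5 1 in
    free [:: dx g p; dy g p; dx (dx g) p; dx (dy g) p; dy (dy g) p].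

(* A free map is in particular an immersion, by independence of its first two
   partial derivatives. *)
Definition Free_infty (R : realType) (M : surface R) : set (M -> 'rV[R]_5) :=
  [set f | (forall k, Ck_map k f) /\ free_map f].

Arguments Free_infty {R} M.

(* Main.v *)
Require Import Defs.
From HB Require Import structures.
From mathcomp Require Import all_boot all_order all_algebra.
From mathcomp Require Import all_classical all_reals all_analysis.
From mathcomp Require Import ring lra.

Set Implicit Arguments.
Unset Strict Implicit.
Unset Printing Implicit Defensive.

Import Order.TTheory GRing.Theory Num.Theory.
Import numFieldNormedType.Exports.

Local Open Scope classical_set_scope.
Local Open Scope ring_scope.

(** A free map f of M and a free map g of N are modified inside one coordinate
    disc each, until they fit together on the connected sum. Freeness is invariant
    under affine maps of R^5, so it is enough that they fit up to such maps.

    Around the centre of its disc, a free map is, after an affine map of R^5,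
    equal to V + o(|q|^2), where V q = (x, y, x^2 + y^2, x^2 - y^2, 2xy): the
    five derivatives that freeness makes independent form the matrix to be
    inverted ([normal_form]). Zooming in by a factor k, with weights 1/k on the
    linear and 1/k^2 on the quadratic coordinates, fixes V and makes the
    remainder as small in C^2 as desired ([flat2_small], [jet_le_dilation]).
    On bounded sets freeness of V survives C^2-small errors, with an explicit
    tolerance ([free_veronese_perturb]).

    The two discs are joined by one explicit tube, [neck], a free map of the
    punctured plane that is equivariant under rotations. With |q| = k e^s and
    polar angle t it is
      (k (2 cosh s - 1) e^(it), k^2 (2 cosh 2s - 10 cosh s),
       2 k^2 sinh 2s e^(2it)),
    where R^5 = C + R + C. It has the two properties that make it useful. It
    tends to V in C^2 on the shell 1 <= |q| <= 2 when k tends to 0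
    ([neck_near_veronese]); so a cutoff on that shell blends it with the zoomed
    map without loss of freeness ([end_piece]). And it is symmetric under
    s |-> -s, that is under inversion in the circle of radius k, up to a linear
    reflection of R^5 ([neck_inversion]); so the end pieces of f and of g can be
    attached to the two ends of the same tube ([bridge]). That the tube is free
    is a computation in the coordinates (s, t): Fourier analysis in t splits
    the system of the five derivatives into a two by two and a three by three
    block, whose determinants have constant sign ([free_neck]).

    The outcome of [bridge] is a free map H of the punctured unit disc which is
    an affine image of f in the disc coordinates near the boundary circle and,
    near the puncture, an affine image of g after the swap
    t u |-> (1 - t) u that identifies the punctured discs in the connected sum.
    Replacing f and g, composed with these affine maps, by H and by H o swap in
    the discs therefore gives two free maps of the punctured surfaces
    ([smooth_free_patch]) that agree on the identified points, hence one free
    map of the connected sum ([smooth_free_map_at_embedding]).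

    Freeness at p is used in its dual form: a linear form l on R^5 such that
    all first and second derivatives of l o f vanish at p is zero. The vanishing
    of the two-jet of a scalar function does not depend on the coordinates
    ([flat2_comp]), so in this form neither does freeness. *)

(** * Mean value theorem in a direction *)

Section DirectionalMVT.
Variable R : realType.

Lemma is_derive_line (V : normedModType R) (f : V -> R) (p v : V) (s : R) :
  derivable f (p + s *: v) v ->
  is_derive s (1 : R) (fun t : R => f (p + t *: v)) ('D_v f (p + s *: v)).
Proof.
move=> df.
have E : (fun h : R => h^-1 *: (((fun t : R => f (p + t *: v)) \o shift s) (h *: (1:R))
           - f (p + s *: v))) =
         (fun h : R => h^-1 *: ((f \o shift (p + s *: v)) (h *: v)
           - f (p + s *: v))).
  apply/funext => h /=; congr (_ *: (f _ - _)).
  by rewrite [h *: 1]mulr1 scalerDl addrCA.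
by apply: DeriveDef; [rewrite /derivable E|rewrite /derive E].
Qed.

Lemma MVT_dir (V : normedModType R) (f : V -> R) (p v : V) (h : R) :
  (forall s : R, `|s| <= `|h| -> derivable f (p + s *: v) v) ->
  exists2 s, `|s| <= `|h| &
    f (p + h *: v) - f p = h * 'D_v f (p + s *: v).
Proof.
move=> df.
pose g (t : R) := f (p + t *: v).
have dg (s : R) : `|s| <= `|h| -> is_derive s (1 : R) g ('D_v f (p + s *: v)).
  by move=> /df; exact: is_derive_line.
have g0 : g 0 = f p by rewrite /g scale0r addr0.
have cg (a b : R) : (forall s : R, s \in `[a, b] -> `|s| <= `|h|) ->
    {within `[a, b], continuous g}.
  move=> ab; apply: derivable_within_continuous => s /ab /dg [].
  by [].
have [h0|h0] := leP 0 h.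
- have I (s : R) : s \in `[0, h] -> `|s| <= `|h|.
    by rewrite in_itv/= => /andP[s0 sh]; rewrite !ger0_norm.
  have dg' (s : R) : s \in `]0, h[ -> is_derive s (1 : R) g ('D_v f (p + s *: v)).
    by move=> sI; apply: dg; apply: I; exact: subset_itv_oo_cc.
  have [s sI E] := MVT_segment h0 dg' (cg _ _ I).
  by exists s; [exact: I|rewrite -g0 E subr0 mulrC].
- have I (s : R) : s \in `[h, 0] -> `|s| <= `|h|.
    by rewrite in_itv/= => /andP[s0 sh]; rewrite !ler0_norm ?lerN2// ltW.
  have dg' (s : R) : s \in `]h, 0[ -> is_derive s (1 : R) g ('D_v f (p + s *: v)).
    by move=> sI; apply: dg; apply: I; exact: subset_itv_oo_cc.
  have [s sI E] := MVT_segment (ltW h0) dg' (cg _ _ I).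
  exists s; first exact: I.
  by rewrite -g0 -[LHS]opprB E sub0r mulrN opprK mulrC.
Qed.

End DirectionalMVT.

(** * Germs of functions of class C^k in the plane *)

Lemma ler_norm_lincomb (R : realType) (a b A B N e : R) :
  `|a| <= N -> `|b| <= N -> `|A| <= e / 2 -> `|B| <= e / 2 ->
  `|a * A + b * B| <= e * N.
Proof.
move=> aN bN Ae Be; apply: (le_trans (ler_normD _ _)).
rewrite (splitr e) mulrDl !normrM ![_ / 2 * _]mulrC.
by apply: lerD; apply: ler_pM.
Qed.

Lemma differentiable_of_linear_approx (R : realType) (V W : normedModType R)
    (f : V -> W) (df : {linear V -> W}) x :
  continuous df ->
  (forall e, 0 < e -> \forall h \near (0 : V),
    `|f (h + x) - (f x + df h)| <= e * `|h|) ->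
  differentiable f x /\ 'd f x = df :> (V -> W).
Proof.
move=> cdf H.
have lo : f \o shift x = cst (f x) + df +o_ 0 id.
  by apply/eqaddoP => e /H.
have E := diff_unique cdf lo.
by split => //; apply/diff_locallyP; rewrite E.
Qed.

Section SmoothGerms.
Variable R : realType.
Implicit Types (f g u : 'rV[R]_2 -> R) (p q : 'rV[R]_2) (k : nat) (i j : 'I_2).

Notation e_ i := (delta_mx 0 i : 'rV[R]_2).

(** Being of class C^k near p. Only the point is recorded, no neighbourhood, so
    that the rules of calculus come without side conditions on domains. *)
Fixpoint Ck_at k f p : Prop :=
  match k with
  | 0 => \forall q \near p, {for q, continuous f}
  | k'.+1 => forall i,
      (\forall q \near p, derivable f q (e_ i)) /\ Ck_at k' (partial i f) p
  end.

Definition smooth_at f p := forall k, Ck_at k f p.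

Lemma Ck_at_near k f p : Ck_at k f p -> \forall q \near p, Ck_at k f q.
Proof.
elim: k f => [|k IH] f /=; first exact: near_join.
move=> fp; near=> q => i; move: i; near: q.
apply: filter_forall => i; have [/near_join d /IH s] := fp i.
by near=> q; split; near: q.
Unshelve. all: by end_near. Qed.

Lemma near_eq_partial f g p i : (\forall q \near p, f q = g q) ->
  \forall q \near p, partial i f q = partial i g q.
Proof.
move/near_join => fg; near=> q; apply: near_eq_derive.
exact: (near fg q).
Unshelve. all: by end_near. Qed.

Lemma near_eq_continuous_for f g p : (\forall q \near p, f q = g q) ->
  {for p, continuous f} -> {for p, continuous g}.
Proof.
move=> fg cf; have e : f p = g p := nbhs_singleton fg.
suff : g @ p --> f p by rewrite e.
by apply: cvg_trans cf; apply: (@near_eq_cvg _ _ (nbhs p)).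
Qed.

Lemma Ck_at_eq k f g p : (\forall q \near p, f q = g q) ->
  Ck_at k f p -> Ck_at k g p.
Proof.
elim: k f g => [|k IH] f g fg /=.
  move/near_join: fg => fg fp.
  near=> q; apply: (@near_eq_continuous_for f); first exact: (near fg q).
  exact: (near fp q).
move=> fp i; have [d s] := fp i; split; last first.
  exact: IH (near_eq_partial i fg) s.
move/near_join: fg => fg.
near=> q; apply: (@near_eq_derivable _ _ _ f); first exact: (near fg q).
exact: (near d q).
Unshelve. all: by end_near. Qed.

Lemma smooth_at_eq f g p : (\forall q \near p, f q = g q) ->
  smooth_at f p -> smooth_at g p.
Proof. by move=> fg fp k; exact: Ck_at_eq (fp k). Qed.

Lemma smooth_at_partial f p i : smooth_at f p -> smooth_at (partial i f) p.
Proof. by move=> fp k; have [] := fp k.+1 i. Qed.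

Lemma rV2_ord j : {j = 0} + {j = 1}.
Proof.
by case: j => [[|[|//]] hj]; [left|right]; exact: val_inj.
Qed.

Lemma rV2E (v : 'rV[R]_2) : v = v 0 0 *: e_ 0 + v 0 1 *: e_ 1.
Proof.
apply/rowP => i; rewrite !mxE eqxx /=.
case: i => [[|[|//]] hi] /=.
  by rewrite (_ : Ordinal hi = 0) ?mulr1 ?mulr0 ?addr0//; exact: val_inj.
by rewrite (_ : Ordinal hi = 1) ?mulr1 ?mulr0 ?add0r//; exact: val_inj.
Qed.

Lemma rV2_norm_lt (v : 'rV[R]_2) (d : R) :
  `|v 0 0| < d -> `|v 0 1| < d -> `|v| < d.
Proof.
move=> v0 v1; have d0 : 0 < d by exact: le_lt_trans v0.
rewrite {1}/Num.norm/= mx_normrE; apply/bigmax_ltP; split => //= -[a b] _.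
rewrite /= (ord1 a); case: b => [[|[|//]] hb].
  by rewrite (_ : Ordinal hb = 0)//; exact: val_inj.
by rewrite (_ : Ordinal hb = 1)//; exact: val_inj.
Qed.

Lemma rV2_coord_le (v : 'rV[R]_2) i : `|v 0 i| <= `|v|.
Proof.
rewrite {2}/Num.norm/= mx_normrE.
exact: (@le_bigmax _ _ _ 0 (fun ij : 'I_1 * 'I_2 => `|v ij.1 ij.2|) (0, i)).
Qed.

Lemma rV2_nearE p (P : set 'rV[R]_2) : (\forall q \near p, P q) ->
  exists2 d : R, 0 < d &
    forall s t : R, `|s| < d -> `|t| < d -> P (p + s *: e_ 0 + t *: e_ 1).
Proof.
move=> /nbhs_ballP[d /= d0 dP]; exists d => // s t sd td.
apply: dP; rewrite -ball_normE /= -opprB normrN addrC -addrA addKr.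
by apply: rV2_norm_lt; rewrite !mxE !eqxx/= ?mulr1 ?mulr0 ?addr0 ?add0r.
Qed.

Definition grad_lin f p (h : 'rV[R]_2) : R :=
  h 0 0 * partial 0 f p + h 0 1 * partial 1 f p.

Lemma grad_lin_is_linear f p : linear (grad_lin f p).
Proof. by move=> a u v; rewrite /grad_lin !mxE /GRing.scale/=; ring. Qed.

HB.instance Definition _ f p :=
  GRing.isLinear.Build R 'rV[R]_2 R *%R (grad_lin f p) (grad_lin_is_linear f p).

(** The increment of f along h is split into a horizontal and a vertical one; the
    mean value theorem expresses each by a partial derivative at a nearby point,
    and continuity at p bounds the error. *)
Lemma C1_differentiable f p : Ck_at 1 f p ->
  differentiable f p /\ 'd f p = grad_lin f p :> (_ -> _).
Proof.
move=> fp.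
have [d0 c0] := fp 0; have [d1 c1] := fp 1.
have cl : continuous (grad_lin f p).
  move=> h; apply: (@continuousD _ _ _ (fun h : 'rV[R]_2 => h 0 0 * _)
    (fun h : 'rV[R]_2 => h 0 1 * _)); apply: continuousM;
    by [exact: coord_continuous|exact: cst_continuous].
apply: (@differentiable_of_linear_approx R 'rV[R]_2 R) => // e e0.
have {}c0 : \forall q \near p, `|partial 0 f p - partial 0 f q| <= e / 2.
  move/nbhs_singleton : c0 => /cvgrPdist_le; apply; exact: divr_gt0.
have {}c1 : \forall q \near p, `|partial 1 f p - partial 1 f q| <= e / 2.
  move/nbhs_singleton : c1 => /cvgrPdist_le; apply; exact: divr_gt0.
have /rV2_nearE[d dpos dP] : \forall q \near p,
    [/\ derivable f q (e_ 0), derivable f q (e_ 1),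
        `|partial 0 f p - partial 0 f q| <= e / 2 &
        `|partial 1 f p - partial 1 f q| <= e / 2].
  near=> q; split; [exact: (near d0 q)|exact: (near d1 q)|
    exact: (near c0 q)|exact: (near c1 q)].
apply/nbhs_ballP; exists d => //= h.
rewrite -ball_normE /= sub0r normrN => hd.
have h0 := le_lt_trans (rV2_coord_le h 0) hd.
have h1 := le_lt_trans (rV2_coord_le h 1) hd.
have [s sh E0] : exists2 s, `|s| <= `|h 0 0| &
    f (p + h 0 0 *: e_ 0) - f p = h 0 0 * partial 0 f (p + s *: e_ 0).
  apply: MVT_dir => s sh.
  have [|D _ _ _] := dP s 0 (le_lt_trans sh h0); first by rewrite normr0.
  by rewrite scale0r addr0 in D; exact: D.
have [t th E1] : exists2 t, `|t| <= `|h 0 1| &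
    f (p + h 0 0 *: e_ 0 + h 0 1 *: e_ 1) - f (p + h 0 0 *: e_ 0) =
    h 0 1 * partial 1 f (p + h 0 0 *: e_ 0 + t *: e_ 1).
  apply: MVT_dir => t th.
  by have [] := dP (h 0 0) t h0 (le_lt_trans th h1).
have [_ _ P0 _] := dP s 0 (le_lt_trans sh h0) ltac:(by rewrite normr0).
have [_ _ _ P1] := dP (h 0 0) t h0 (le_lt_trans th h1).
rewrite scale0r addr0 in P0.
have Eh : h + p = p + h 0 0 *: e_ 0 + h 0 1 *: e_ 1.
  by rewrite [LHS]addrC [X in _ + X]rV2E addrA.
have -> : f (h + p) - (f p + grad_lin f p h) =
    h 0 0 * (partial 0 f (p + s *: e_ 0) - partial 0 f p) +
    h 0 1 * (partial 1 f (p + h 0 0 *: e_ 0 + t *: e_ 1) - partial 1 f p).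
  rewrite /grad_lin !mulrBr -E0 -E1 -Eh.
  move: (f (h + p)) (f p) (f _) (partial 0 f p) (partial 1 f p) => a b c d' e'.
  by ring.
apply: ler_norm_lincomb.
- exact: rV2_coord_le.
- exact: rV2_coord_le.
- by rewrite distrC; exact: P0.
- by rewrite distrC; exact: P1.
Unshelve. all: by end_near. Qed.

Lemma Ck_at_continuous k f p : Ck_at k f p -> {for p, continuous f}.
Proof.
elim: k f p => [|k IH] f p; first exact: nbhs_singleton.
move=> fp; apply: differentiable_continuous; apply: (C1_differentiable _).1.
move=> i; have [d /Ck_at_near s] := fp i; split => //=.
by near=> q; apply: IH; exact: (near s q).
Unshelve. all: by end_near. Qed.

Lemma Ck_at_le k l f p : (k <= l)%N -> Ck_at l f p -> Ck_at k f p.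
Proof.
elim: k l f => [|k IH] [|l] f // kl fp.
  move/Ck_at_near: fp => fp; near=> q.
  by apply: Ck_at_continuous; exact: (near fp q).
by move=> i; have [d s] := fp i; split => //; exact: IH s.
Unshelve. all: by end_near. Qed.

Lemma Ck_at_pred k f p : Ck_at k.+1 f p -> Ck_at k f p.
Proof. exact: Ck_at_le. Qed.

Lemma Ck_at_partial k f p i : Ck_at k.+1 f p -> Ck_at k (partial i f) p.
Proof. by move=> /(_ i)[]. Qed.

Lemma Ck_at_derivable k f p i : Ck_at k.+1 f p ->
  \forall q \near p, derivable f q (e_ i).
Proof. by move=> /(_ i)[]. Qed.

Lemma Ck_at_cst k (a : R) p : Ck_at k (cst a) p.
Proof.
elim: k a => [|k IH] a /=.
  by near=> q; exact: cst_continuous.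
move=> i; split; first by near=> q; exact: derivable_cst.
apply: Ck_at_eq (IH 0); near=> q.
by rewrite /partial derive_cst.
Unshelve. all: by end_near. Qed.

Lemma Ck_atD k f g p : Ck_at k f p -> Ck_at k g p ->
  Ck_at k (fun q => f q + g q) p.
Proof.
elim: k f g => [|k IH] f g fp gp.
  near=> q; apply: continuousD; [exact: (near fp q)|exact: (near gp q)].
move=> i; have df := Ck_at_derivable i fp; have dg := Ck_at_derivable i gp.
split.
  near=> q; apply: derivableD; [exact: (near df q)|exact: (near dg q)].
apply: Ck_at_eq (IH _ _ (Ck_at_partial i fp) (Ck_at_partial i gp)).
near=> q; rewrite /partial -deriveD//; [exact: (near df q)|exact: (near dg q)].
Unshelve. all: by end_near. Qed.

Lemma Ck_atM k f g p : Ck_at k f p -> Ck_at k g p ->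
  Ck_at k (fun q => f q * g q) p.
Proof.
elim: k f g => [|k IH] f g fp gp.
  near=> q; apply: continuousM; [exact: (near fp q)|exact: (near gp q)].
move=> i; have df := Ck_at_derivable i fp; have dg := Ck_at_derivable i gp.
split.
  near=> q; apply: derivableM; [exact: (near df q)|exact: (near dg q)].
apply: (@Ck_at_eq _
  (fun q => f q * partial i g q + g q * partial i f q)); last first.
  by apply: Ck_atD; apply: IH; [exact: Ck_at_pred|exact: Ck_at_partial
    |exact: Ck_at_pred|exact: Ck_at_partial].
near=> q; rewrite /partial [RHS]deriveM//; [exact: (near df q)|exact: (near dg q)].
Unshelve. all: by end_near. Qed.

Lemma is_derive_coord p i (v : 'rV[R]_2) :
  is_derive p v (fun q : 'rV[R]_2 => q 0 i) (v 0 i).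
Proof.
have d : derivable (id : 'rV[R]_2 -> 'rV[R]_2) p v by exact: derivable_id.
apply: DeriveDef; first exact: ((derivable_mxP _ _ _).1 d).
have := derive_mx d; rewrite derive_id => /(congr1 (fun M : 'rV[R]_2 => M 0 i)).
by rewrite mxE.
Qed.

Lemma Ck_at_coord k p i : Ck_at k (fun q : 'rV[R]_2 => q 0 i) p.
Proof.
case: k => [|k].
  by near=> q; exact: coord_continuous.
move=> j; split; first by near=> q; have [] := is_derive_coord q i (e_ j).
apply: Ck_at_eq (Ck_at_cst k (e_ j 0 i) p).
by near=> q; rewrite /partial (derive_val (is_derive := is_derive_coord q i (e_ j))).
Unshelve. all: by end_near. Qed.

End SmoothGerms.

(** * Chain rules *)

Lemma row_continuousP (R : realType) (S : topologicalType) n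
    (T : S -> 'rV[R]_n) (p : S) :
  {for p, continuous T} <-> forall j, {for p, continuous (fun q => T q 0 j)}.
Proof.
split=> [cT j|cT].
  exact: (continuous_comp cT (@coord_continuous _ _ _ 0 j (T p))).
apply/cvgrPdist_le => e e0.
have H j : \forall q \near p, `|T p 0 j - T q 0 j| <= e.
  by have /cvgrPdist_le := cT j; apply.
have {}H : \forall q \near p, forall j, `|T p 0 j - T q 0 j| <= e.
  exact: (@filter_forall S 'I_n (fun j q => `|T p 0 j - T q 0 j| <= e)).
near=> q; have Hq := near H q.
rewrite {1}/Num.norm/= mx_normrE; apply/bigmax_leP; split=> [|[a b] _]; first exact: ltW.
by rewrite /= (ord1 a) !mxE; exact: Hq.
Unshelve. all: by end_near. Qed.

Section ChainRules.
Variable R : realType.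
Implicit Types (f g u : 'rV[R]_2 -> R) (p q : 'rV[R]_2) (k : nat) (i j : 'I_2).
Implicit Types (T : 'rV[R]_2 -> 'rV[R]_2).

Notation e_ i := (delta_mx 0 i : 'rV[R]_2).

(** On the line through p in direction v this is the chain rule of one variable;
    nothing is assumed of w away from that line. *)
Lemma is_derive_comp1 (V : normedModType R) (phi : R -> R) (w : V -> R) (p v : V)
    (c d : R) :
  is_derive (w p) (1 : R) phi c -> is_derive p v w d ->
  is_derive p v (phi \o w) (c * d).
Proof.
move=> dphi dw.
pose l (t : R) := w (p + t *: v).
have l0 : l 0 = w p by rewrite /l scale0r addr0.
have dl : is_derive (0 : R) (1 : R) l d.
  have := @is_derive_line R V w p v 0; rewrite scale0r addr0 => H.
  have [w1 w2] := dw; rewrite -w2; exact: H.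
have dpl : is_derive (0 : R) (1 : R) (phi \o l) (c * d).
  have [d1 e1] := dl; rewrite -l0 in dphi; have [d2 e2] := dphi.
  apply: DeriveDef.
    apply/derivable1_diffP; apply: differentiable_comp; apply/derivable1_diffP.
      exact: d1.
    exact: d2.
  by rewrite -derive1E (derive1_comp d1 d2) !derive1E e1 e2.
have E : (fun h : R => h^-1 *: (((phi \o l) \o shift (0 : R)) (h *: (1 : R))
           - (phi \o l) 0)) =
         (fun h : R => h^-1 *: (((phi \o w) \o shift p) (h *: v)
           - (phi \o w) p)).
  apply/funext => h; rewrite /= l0 /l addr0 [h *: 1]mulr1.
  by rewrite [h *: v + p]addrC.
have [d1 d2] := dpl.
by apply: DeriveDef; [rewrite /derivable -E|rewrite /derive -E].
Qed.

Definition smooth_map_at T p := forall j, smooth_at (fun q => T q 0 j) p.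

Lemma diff_coordinates T p :
  (forall j, Ck_at 1 (fun q => T q 0 j) p) -> differentiable T p.
Proof.
move=> dT.
have -> : T = fun q => (T q 0 0) *: e_ 0 + (T q 0 1) *: e_ 1.
  by apply/funext => q; exact: rV2E.
by apply: differentiableD; apply: differentiableZl;
  exact: (C1_differentiable (dT _)).1.
Qed.

Lemma chain_rule u T p i :
  (forall j, Ck_at 1 (fun q => T q 0 j) p) -> Ck_at 1 u (T p) ->
  is_derive p (e_ i) (u \o T)
    (partial 0 u (T p) * partial i (fun q => T q 0 0) p +
     partial 1 u (T p) * partial i (fun q => T q 0 1) p).
Proof.
move=> sT su; have dT := diff_coordinates sT.
have [du Eu] := C1_differentiable su.
have duT := differentiable_comp dT du.
apply: DeriveDef; first exact: diff_derivable.
rewrite deriveE// diff_comp//= Eu -deriveE// derive_mx; last first.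
  exact: diff_derivable.
by rewrite /grad_lin !mxE /partial; congr (_ + _); exact: mulrC.
Qed.

Lemma smooth_map_continuous T p : (forall j, Ck_at 0 (fun q => T q 0 j) p) ->
  {for p, continuous T}.
Proof. by move=> cT; apply/row_continuousP => j; exact: Ck_at_continuous. Qed.

(** The partial derivatives of the composite are polynomials in partial
    derivatives of u, composed with T, and of T; hence induction on k. *)
Lemma Ck_at_comp k u T p : (forall j, Ck_at k (fun q => T q 0 j) p) ->
  Ck_at k u (T p) -> Ck_at k (u \o T) p.
Proof.
elim: k u => [|k IH] u sT su.
  have cT : {for p, continuous T} by exact: smooth_map_continuous.
  have {}su : \forall q \near p, {for T q, continuous u} := cT _ su.
  have c0 := near_join (sT 0); have c1 := near_join (sT 1).
  near=> q; apply: continuous_comp; last exact: (near su q).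
  apply: smooth_map_continuous => j; case: (rV2_ord j) => ->.
    exact: (near c0 q).
  exact: (near c1 q).
have sT1 j : Ck_at 1 (fun q => T q 0 j) p by exact: Ck_at_le (sT j).
have su1 : Ck_at 1 u (T p) by exact: Ck_at_le su.
have cT : {for p, continuous T}.
  by apply: smooth_map_continuous => j; exact: Ck_at_le (sT j).
have nu : \forall q \near p, Ck_at 1 u (T q) := cT _ (Ck_at_near su1).
have n0 := Ck_at_near (sT1 0); have n1 := Ck_at_near (sT1 1).
have nchain : \forall q \near p, forall i, is_derive q (e_ i) (u \o T)
    (partial 0 u (T q) * partial i (fun q => T q 0 0) q +
     partial 1 u (T q) * partial i (fun q => T q 0 1) q).
  near=> q => i; apply: chain_rule; last exact: (near nu q).
  by move=> j; case: (rV2_ord j) => ->; [exact: (near n0 q)|exact: (near n1 q)].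
move=> i; split.
  by apply: filterS nchain => q /(_ i)[].
have sTk j : Ck_at k (fun q => T q 0 j) p by exact: Ck_at_pred.
have H : Ck_at k (fun q => (partial 0 u \o T) q * partial i (fun q => T q 0 0) q +
    (partial 1 u \o T) q * partial i (fun q => T q 0 1) q) p.
  by apply: Ck_atD; apply: Ck_atM;
   [apply: IH => //| |apply: IH => //| ]; exact: Ck_at_partial.
apply: Ck_at_eq H; apply: filterS nchain => q /(_ i)[_].
by rewrite /partial => ->.
Unshelve. all: by end_near. Qed.

End ChainRules.

(** * Smoothness of the elementary functions *)

Section SmoothPrimitives.
Variable R : realType.
Implicit Types (f g u v : 'rV[R]_2 -> R) (p q : 'rV[R]_2) (k : nat) (i j : 'I_2).

Notation e_ i := (delta_mx 0 i : 'rV[R]_2).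

Lemma smooth_cst (a : R) p : smooth_at (fun=> a) p.
Proof. by move=> k; exact: Ck_at_cst. Qed.

Lemma smooth_coord p i : smooth_at (fun q : 'rV[R]_2 => q 0 i) p.
Proof. by move=> k; exact: Ck_at_coord. Qed.

Lemma smoothD u v p : smooth_at u p -> smooth_at v p ->
  smooth_at (fun q => u q + v q) p.
Proof. by move=> su sv k; exact: Ck_atD. Qed.

Lemma smoothM u v p : smooth_at u p -> smooth_at v p ->
  smooth_at (fun q => u q * v q) p.
Proof. by move=> su sv k; exact: Ck_atM. Qed.

Lemma smoothN u p : smooth_at u p -> smooth_at (fun q => - u q) p.
Proof.
move=> su; rewrite (_ : (fun q => - u q) = fun q => (-1) * u q); last first.
  by apply/funext => q; rewrite mulN1r.
by apply: smoothM => //; exact: smooth_cst.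
Qed.

Lemma smoothB u v p : smooth_at u p -> smooth_at v p ->
  smooth_at (fun q => u q - v q) p.
Proof. by move=> su sv; apply: smoothD => //; exact: smoothN. Qed.

Lemma smoothX u p n : smooth_at u p -> smooth_at (fun q => u q ^+ n) p.
Proof.
move=> su; elim: n => [|n IH].
  under [fun _ => _]eq_fun do rewrite expr0; exact: smooth_cst.
under [fun _ => _]eq_fun do rewrite exprS; exact: smoothM.
Qed.

Lemma smooth_sum (n : nat) (F : 'I_n -> 'rV[R]_2 -> R) p :
  (forall a, smooth_at (F a) p) -> smooth_at (fun q => \sum_(a < n) F a q) p.
Proof.
elim: n F => [|n IH] F sF.
  by under [fun _ => _]eq_fun do rewrite big_ord0; exact: smooth_cst.
under [fun _ => _]eq_fun do rewrite big_ord_recr.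
by apply: smoothD => //; exact: IH.
Qed.

Lemma smooth_comp u (T : 'rV[R]_2 -> 'rV[R]_2) p :
  smooth_map_at T p -> smooth_at u (T p) -> smooth_at (u \o T) p.
Proof. by move=> sT su k; apply: Ck_at_comp => // j; exact: sT. Qed.

Lemma smooth_derivable u p i : smooth_at u p -> derivable u p (e_ i).
Proof. by move=> /(_ 1 i)[/nbhs_singleton]. Qed.

Lemma smooth_continuous u p : smooth_at u p -> {for p, continuous u}.
Proof. by move=> /(_ 0) /Ck_at_continuous. Qed.

Lemma smooth_near_Ck k u p : smooth_at u p -> \forall q \near p, Ck_at k u q.
Proof. by move=> /(_ k) /Ck_at_near. Qed.

(** Composition with a function phi of one variable. The last hypothesis is the
    induction hypothesis that becomes available when phi' is an expression in
    phi, as for the inverse, the square root, exp, and the pair cos, sin. *)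
Lemma Ck_at_comp1 k (phi phi' : R -> R) u p : Ck_at k u p ->
  (\forall q \near p, is_derive (u q) (1 : R) phi (phi' (u q))) ->
  (forall l, (l < k)%N -> Ck_at l (phi' \o u) p) -> Ck_at k (phi \o u) p.
Proof.
case: k => [|k] su dphi IH.
  near=> q; apply: continuous_comp; first exact: (near su q).
  apply: differentiable_continuous; apply/derivable1_diffP.
  by have [] : is_derive (u q) (1 : R) phi (phi' (u q)) by exact: (near dphi q).
have D i : \forall q \near p,
    is_derive q (e_ i) (phi \o u) (phi' (u q) * partial i u q).
  have du := Ck_at_derivable i su.
  near=> q; apply: is_derive_comp1; first exact: (near dphi q).
  by apply: derivableP; exact: (near du q).
move=> i; split.
  by apply: filterS (D i) => q [].
have H : Ck_at k (fun q => (phi' \o u) q * partial i u q) p.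
  by apply: Ck_atM; [exact: IH|exact: Ck_at_partial].
apply: Ck_at_eq H; apply: filterS (D i) => q [_].
by rewrite /partial => ->.
Unshelve. all: by end_near. Qed.

Lemma Ck_atV k u p : Ck_at k u p -> u p != 0 ->
  Ck_at k (fun q => (u q)^-1) p.
Proof.
move=> su u0.
have dphi : \forall q \near p, is_derive (u q) (1 : R) (@GRing.inv R)
    (- ((u q)^-1 * (u q)^-1)).
  have : \forall q \near p, u q != 0.
    exact: (@cvgr_neq0 _ _ _ (nbhs p) _ u (u p) (Ck_at_continuous su) u0).
  apply: filterS => q uq0.
  have [d e] : is_derive (u q) (1 : R) (fun y => (id y)^-1) (- id (u q) ^- 2 *: (1 : R)).
    apply: DeriveDef; first exact: derivableV.
    by rewrite deriveV// derive_id.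
  by apply: DeriveDef => //; rewrite e /= [_ *: _]mulr1 expr2 invfM.
elim/ltn_ind: k su => k IH su.
apply: (@Ck_at_comp1 k _ (fun x => - (x^-1 * x^-1)) _ _ su) => // l lk.
have Hl := IH _ lk (Ck_at_le (ltnW lk) su).
have := Ck_atM (Ck_at_cst l (-1) p) (Ck_atM Hl Hl).
by apply: Ck_at_eq; near=> q; rewrite /= mulN1r.
Unshelve. all: by end_near. Qed.

Lemma smoothV u p : smooth_at u p -> u p != 0 ->
  smooth_at (fun q => (u q)^-1) p.
Proof. by move=> su u0 k; exact: Ck_atV. Qed.

Lemma smooth_sqrt u p : smooth_at u p -> 0 < u p ->
  smooth_at (fun q => Num.sqrt (u q)) p.
Proof.
move=> su u0; pose phi' (x : R) := (2 * Num.sqrt x)^-1.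
have dphi : \forall x \near u p, is_derive x (1 : R) Num.sqrt (phi' x).
  near=> x; apply: is_derive1_sqrt.
  by near: x; exact: lt_nbhsr.
have {}dphi : \forall q \near p, is_derive (u q) (1 : R) Num.sqrt (phi' (u q)).
  exact: (smooth_continuous su) dphi.
move=> k; elim/ltn_ind: k => k IH; apply: (Ck_at_comp1 (su k) dphi) => l lk.
have {lk}Hs := IH _ lk.
suff : Ck_at l (GRing.inv \o (fun q => 2 * Num.sqrt (u q))) p by [].
have s0 : 2 * Num.sqrt (u p) != 0.
  by rewrite mulf_neq0// gt_eqF// sqrtr_gt0.
exact: Ck_atV (Ck_atM (Ck_at_cst l 2 p) Hs) s0.
Unshelve. all: by end_near. Qed.

Lemma smooth_expR u p : smooth_at u p -> smooth_at (fun q => expR (u q)) p.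
Proof.
move=> su k; elim/ltn_ind: k => k IH.
apply: (@Ck_at_comp1 k _ expR _ _ (su k)) => [|l lk]; last exact: IH.
by near=> q; exact: is_derive_expR.
Unshelve. all: by end_near. Qed.

Lemma Ck_at_cos_sin k u p : smooth_at u p ->
  Ck_at k (fun q => cos (u q)) p /\ Ck_at k (fun q => sin (u q)) p.
Proof.
move=> su; elim/ltn_ind: k => k IH; split.
- apply: (@Ck_at_comp1 k _ (fun x => - sin x) _ _ (su k)) => [|l lk].
    by near=> q; exact: is_derive_cos.
  have := Ck_atM (Ck_at_cst l (-1) p) (IH _ lk).2.
  by apply: Ck_at_eq; near=> q; rewrite /= mulN1r.
- apply: (@Ck_at_comp1 k _ cos _ _ (su k)) => [|l lk]; last exact: (IH _ lk).1.
  by near=> q; exact: is_derive_sin.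
Unshelve. all: by end_near. Qed.

Lemma smooth_cos u p : smooth_at u p -> smooth_at (fun q => cos (u q)) p.
Proof. by move=> su k; exact: (Ck_at_cos_sin k su).1. Qed.

Lemma smooth_sin u p : smooth_at u p -> smooth_at (fun q => sin (u q)) p.
Proof. by move=> su k; exact: (Ck_at_cos_sin k su).2. Qed.
End SmoothPrimitives.

(** * A smooth step function *)

Section Cutoff.
Variable R : realType.
Implicit Types (x y : R) (n k : nat).

(** Powers of 1/x multiply exp (-1/x) because the family so obtained is closed
    under derivation: the derivative of the n-th member is a combination of
    members n+1 and n+2. *)
Definition flat_exp n (x : R) : R :=
  if 0 < x then x ^- n * expR (- x^-1) else 0.

Lemma flat_exp_ge0 n x : 0 <= flat_exp n x.
Proof.
rewrite /flat_exp; case: ifPn => // x0.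
by rewrite mulr_ge0 ?expR_ge0// invr_ge0 exprn_ge0// ltW.
Qed.

Lemma flat_exp_gt0 n x : 0 < x -> 0 < flat_exp n x.
Proof. by move=> x0; rewrite /flat_exp x0 mulr_gt0 ?expR_gt0// invr_gt0 exprn_gt0. Qed.

Lemma flat_exp_le0 n x : x <= 0 -> flat_exp n x = 0.
Proof. by rewrite /flat_exp leNgt => /negbTE ->. Qed.

(** The quadratic bound gives derivability, with derivative 0, at the origin. It
    holds because y^(n+2) / (n+2)! <= exp y for y = 1/x. *)
Lemma flat_exp_le n x : `|flat_exp n x| <= n.+2`!%:R * `|x| ^+ 2.
Proof.
rewrite ger0_norm ?flat_exp_ge0// /flat_exp; case: ifPn => x0; last first.
  by rewrite mulr_ge0// exprn_ge0.
rewrite (gtr0_norm x0) expRN.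
have f0 : (0 : R) < n.+2`!%:R by rewrite ltr0n fact_gt0.
have : x^-1 ^+ n.+2 / n.+2`!%:R <= expR x^-1.
  by apply: le_trans (expR_ge1Dxn n.+1 _); [rewrite lerDr|rewrite invr_ge0 ltW].
have e0 := expR_gt0 x^-1.
rewrite ler_pdivrMr// => H.
rewrite ler_pdivrMr// mulrAC.
have -> : x ^- n = x^-1 ^+ n.+2 * x ^+ 2.
  by rewrite -addn2 exprD exprVn -mulrA -exprMn mulVf ?gt_eqF// expr1n mulr1.
apply: ler_wpM2r; first by rewrite exprn_ge0// ltW.
by rewrite [leRHS]mulrC.
Qed.

Lemma is_derive_flat_exp n x :
  is_derive x (1 : R) (flat_exp n)
    (- n%:R * flat_exp n.+1 x + flat_exp n.+2 x).
Proof.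
have [x0|x0|x0] := ltgtP 0 x.
- have H : is_derive x (1 : R) (fun y => y ^- n * expR (- y^-1))
      (- n%:R * flat_exp n.+1 x + flat_exp n.+2 x).
    have xn0 : x != 0 by rewrite gt_eqF.
    have dV : is_derive x (1 : R) (fun y : R => y^-1) (- x ^- 2).
      have [d e] : is_derive x (1 : R) (fun y => (id y)^-1) (- id x ^- 2 *: (1 : R)).
        by apply: DeriveDef; [exact: derivableV|rewrite deriveV// derive_id].
      by apply: DeriveDef => //; rewrite e [_ *: _]mulr1.
    have dE : is_derive x (1 : R) (expR \o (fun y : R => - y^-1))
        (expR (- x^-1) * (x ^- 2)).
      apply: is_derive_comp1.
      by rewrite -[X in is_derive _ _ _ X]opprK; exact: is_deriveN.
    have dX : is_derive x (1 : R) ((fun y : R => y^-1) ^+ n)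
       ((n%:R * x^-1 ^+ n.-1) *: (- x ^- 2)) by exact: is_deriveX.
    have := is_deriveM dX dE.
    rewrite (_ : (_ * _) = (fun y : R => y ^- n * expR (- y^-1))); last first.
      by apply/funext => y; rewrite mulrfctE exprfctE /= exprVn.
    move=> H; apply: (is_derive_eq H).
    rewrite /flat_exp x0 /= exprfctE /GRing.scale /= !exprVn.
    case: n {dX H} => [|n].
      by rewrite !mul0r mulr0 addr0 oppr0 mul0r add0r expr0 invr1 mul1r mulrC.
    rewrite /= -!exprVn !exprS.
    by ring.
  apply: near_eq_is_derive H; near=> y.
  by rewrite /flat_exp ifT//; near: y; exact: lt_nbhsr.
- have H : is_derive x (1 : R) (fun=> 0 : R) 0 by exact: is_derive_cst.
  rewrite !flat_exp_le0 ?ltW// mulr0 addr0.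
  apply: near_eq_is_derive H; near=> y.
  by rewrite flat_exp_le0// ltW//; near: y; exact: lt_nbhsl.
- rewrite -x0 !flat_exp_le0// mulr0 addr0.
  have H : h^-1 *: (flat_exp n (h *: (1 : R) + 0) - flat_exp n 0) @[h --> 0^'] --> (0 : R).
    apply/cvgrPdist_le => e e0.
    have f0 : (0 : R) < n.+2`!%:R by rewrite ltr0n fact_gt0.
    near=> h.
    rewrite addr0 [h *: 1]mulr1 [flat_exp n 0]flat_exp_le0// subr0 sub0r normrN.
    have h0 : h != 0 by near: h; exact: nbhs_dnbhs_neq.
    rewrite normrZ normfV ler_pdivrMl ?normr_gt0//.
    apply: le_trans (flat_exp_le n h) _.
    rewrite expr2 mulrCA; apply: ler_wpM2l => //.
    rewrite -ler_pdivlMl//; near: h; apply: dnbhs0_le.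
    by rewrite mulr_gt0// invr_gt0.
  apply: DeriveDef; first by apply/cvg_ex; exists 0.
  exact: cvg_lim H.
Unshelve. all: by end_near. Qed.

Lemma Ck_at_flat_exp n k (u : 'rV[R]_2 -> R) p : smooth_at u p ->
  Ck_at k (flat_exp n \o u) p.
Proof.
move=> su; elim/ltn_ind: k n => k IH n.
apply: (@Ck_at_comp1 _ k _ (fun x => - n%:R * flat_exp n.+1 x + flat_exp n.+2 x)
  _ _ (su k)) => [|l lk].
  by near=> q; exact: is_derive_flat_exp.
exact: Ck_atD (Ck_atM (Ck_at_cst l (- n%:R) p) (IH l lk n.+1)) (IH l lk n.+2).
Unshelve. all: by end_near. Qed.

Lemma flat_exp_sum_gt0 x : 0 < flat_exp 0 x + flat_exp 0 (1 - x).
Proof.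
have [x0|x0] := ltP 0 x.
  by rewrite ltr_pwDl ?flat_exp_ge0 ?flat_exp_gt0.
by rewrite ltr_wpDl ?flat_exp_ge0 ?flat_exp_gt0// subr_gt0 (le_lt_trans x0).
Qed.

Definition step (x : R) : R := flat_exp 0 x / (flat_exp 0 x + flat_exp 0 (1 - x)).

Lemma step_ge0 x : 0 <= step x.
Proof. by rewrite divr_ge0 ?flat_exp_ge0// ltW// flat_exp_sum_gt0. Qed.

Lemma step_le1 x : step x <= 1.
Proof.
by rewrite ler_pdivrMr ?flat_exp_sum_gt0// mul1r lerDl flat_exp_ge0.
Qed.

Lemma step_le0 x : x <= 0 -> step x = 0.
Proof. by move=> x0; rewrite /step (flat_exp_le0 _ x0) mul0r. Qed.

Lemma step_ge1 x : 1 <= x -> step x = 1.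
Proof.
move=> x1; have := flat_exp_sum_gt0 x.
rewrite /step [flat_exp _ (1 - x)]flat_exp_le0 ?subr_le0// addr0 => H.
by rewrite divff// gt_eqF.
Qed.

Lemma smooth_step (u : 'rV[R]_2 -> R) p : smooth_at u p ->
  smooth_at (fun q => step (u q)) p.
Proof.
move=> su.
have s0 : smooth_at (fun q => flat_exp 0 (u q)) p by move=> k; exact: Ck_at_flat_exp.
have s1 : smooth_at (fun q => flat_exp 0 (1 - u q)) p.
  by move=> k; apply: Ck_at_flat_exp; apply: smoothB => //; exact: smooth_cst.
apply: smoothM => //; apply: smoothV; first exact: smoothD.
by rewrite gt_eqF// flat_exp_sum_gt0.
Qed.

(** The derivative vanishes on both sides of [0, 1] and is nonnegative, which is
    what the monotonicity of the radial stretch below needs. *)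
Lemma is_derive_step x : exists c,
  [/\ 0 <= c, x <= 0 \/ 1 <= x -> c = 0 & is_derive x (1 : R) step c].
Proof.
pose e (y : R) := flat_exp 0 y; pose e' (y : R) := flat_exp 2 y.
have de y : is_derive y (1 : R) e (e' y).
  by apply: (is_derive_eq (is_derive_flat_exp 0 y)); rewrite oppr0 mul0r add0r.
have de1 : is_derive x (1 : R) (e \o (fun y : R => 1 - y)) (e' (1 - x) * -1).
  apply: is_derive_comp1.
  have : is_derive x (1 : R) (cst (1 : R) - (id : R -> R)) (0 - 1).
    exact: is_deriveB.
  by move=> H; apply: (is_derive_eq H); rewrite sub0r.
pose D := e \+ (e \o (fun y : R => 1 - y)).
have D0 y : 0 < D y by exact: flat_exp_sum_gt0.
have dD : is_derive x (1 : R) D (e' x + e' (1 - x) * -1) by exact: is_deriveD.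
have [dd1 dd2] := dD.
have dV : is_derive x (1 : R) (fun y => (D y)^-1) (- D x ^- 2 *: (e' x + e' (1 - x) * -1)).
  apply: DeriveDef; first by apply: derivableV => //; rewrite gt_eqF.
  by rewrite deriveV ?gt_eqF// dd2.
have dS := is_deriveM (de x) dV.
exists ((e' x * e (1 - x) + e x * e' (1 - x)) / D x ^+ 2); split.
- apply: divr_ge0; last by rewrite exprn_ge0// ltW.
  by apply: addr_ge0; apply: mulr_ge0; exact: flat_exp_ge0.
- case=> x01.
    by rewrite /e /e' !(flat_exp_le0 _ x01) !mul0r addr0 mul0r.
  have x10 : 1 - x <= 0 by rewrite subr_le0.
  by rewrite /e /e' !(flat_exp_le0 _ x10) !mulr0 addr0 mul0r.
apply: (is_derive_eq dS); rewrite /GRing.scale/=.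
have Dx : D x = e x + e (1 - x) by [].
have := D0 x; rewrite Dx; move: (e x) (e' x) (e (1 - x)) (e' (1 - x)) => a b c d ac.
by field; rewrite gt_eqF.
Qed.

End Cutoff.

(** * Second derivatives and changes of coordinates *)

Section SecondOrder.
Variable R : realType.
Implicit Types (f g u : 'rV[R]_2 -> R) (p q : 'rV[R]_2) (k : nat) (i j : 'I_2).
Implicit Types (T : 'rV[R]_2 -> 'rV[R]_2).

Notation e_ i := (delta_mx 0 i : 'rV[R]_2).

Lemma is_derive_translate u (c q v : 'rV[R]_2) : derivable u (q + c) v ->
  is_derive q v (fun r => u (r + c)) ('D_v u (q + c)).
Proof.
move=> du.
have E : (fun h : R => h^-1 *: (((fun r => u (r + c)) \o shift q) (h *: v)
           - u (q + c))) =
         (fun h : R => h^-1 *: ((u \o shift (q + c)) (h *: v) - u (q + c))).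
  by apply/funext => h /=; rewrite addrA.
by apply: DeriveDef; [rewrite /derivable E|rewrite /derive E].
Qed.

(** Two applications of the mean value theorem, to u (q + h e_j) - u q in
    direction i and then to the i-th partial derivative in direction j. *)
Lemma second_difference u p (h : R) i j :
  (forall s t : R, `|s| <= `|h| -> `|t| <= `|h| ->
    derivable u (p + s *: e_ i + t *: e_ j) (e_ i) /\
    derivable (partial i u) (p + s *: e_ i + t *: e_ j) (e_ j)) ->
  exists s t : R, [/\ `|s| <= `|h|, `|t| <= `|h| &
    u (p + h *: e_ i + h *: e_ j) - u (p + h *: e_ i) -
      (u (p + h *: e_ j) - u p) =
    h * (h * partial j (partial i u) (p + s *: e_ i + t *: e_ j))].
Proof.
move=> du.
pose F q := u (q + h *: e_ j) - u q.
have dF (s : R) : `|s| <= `|h| -> is_derive (p + s *: e_ i) (e_ i) F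
    (partial i u (p + s *: e_ i + h *: e_ j) - partial i u (p + s *: e_ i)).
  move=> sh; have [d1 _] := du s h sh (lexx _).
  have [d2 _] : derivable u (p + s *: e_ i) (e_ i) /\ True.
    have [] := du s 0 sh; first by rewrite normr0.
    by rewrite scale0r addr0.
  apply: is_deriveB; first exact: is_derive_translate.
  exact: derivableP.
have [s sh Es] : exists2 s : R, `|s| <= `|h| &
    F (p + h *: e_ i) - F p = h * 'D_(e_ i) F (p + s *: e_ i).
  by apply: MVT_dir => s /dF[].
have [t th Et] : exists2 t : R, `|t| <= `|h| &
    partial i u (p + s *: e_ i + h *: e_ j) - partial i u (p + s *: e_ i) =
    h * 'D_(e_ j) (partial i u) (p + s *: e_ i + t *: e_ j).
  by apply: MVT_dir => t th; have [] := du s t sh th.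
exists s, t; split => //.
by have [_ e] := dF s sh; move: Es; rewrite e Et.
Qed.

(** The second difference is symmetric in the two directions, and
    [second_difference] expresses it by either mixed derivative at points that
    tend to p. *)
Lemma partialC u p i j : smooth_at u p ->
  partial i (partial j u) p = partial j (partial i u) p.
Proof.
suff H : smooth_at u p -> partial 1 (partial 0 u) p = partial 0 (partial 1 u) p.
  move=> su; case: (rV2_ord i) => ->; case: (rV2_ord j) => ->.
  - exact: erefl.
  - exact: esym (H su).
  - exact: H.
  - exact: erefl.
move=> su.
set A := partial 1 (partial 0 u); set B := partial 0 (partial 1 u).
have cA : {for p, continuous A}.
  by apply: smooth_continuous; do 2!apply: smooth_at_partial.
have cB : {for p, continuous B}.
  by apply: smooth_continuous; do 2!apply: smooth_at_partial.
apply/eqP; rewrite -subr_eq0 -normr_le0; apply/ler_addgt0Pr => e e0.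
rewrite add0r.
have nA : \forall q \near p, `|A p - A q| <= e / 2.
  by move/cvgrPdist_le: cA; apply; exact: divr_gt0.
have nB : \forall q \near p, `|B p - B q| <= e / 2.
  by move/cvgrPdist_le: cB; apply; exact: divr_gt0.
have d0 := Ck_at_derivable 0 (su 1); have d1 := Ck_at_derivable 1 (su 1).
have d10 := Ck_at_derivable 1 (smooth_at_partial 0 su 1).
have d01 := Ck_at_derivable 0 (smooth_at_partial 1 su 1).
have /rV2_nearE[d dpos dP] : \forall q \near p,
   ([/\ derivable u q (e_ 0), derivable u q (e_ 1),
       derivable (partial 0 u) q (e_ 1) & derivable (partial 1 u) q (e_ 0)]) /\
   (`|A p - A q| <= e / 2 /\ `|B p - B q| <= e / 2).
  near=> q; split; [split|split].
  - exact: (near d0 q).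
  - exact: (near d1 q).
  - exact: (near d10 q).
  - exact: (near d01 q).
  - exact: (near nA q).
  - exact: (near nB q).
pose h := d / 2.
have h0 : 0 < h by exact: divr_gt0.
have hd (s : R) : `|s| <= `|h| -> `|s| < d.
  move=> /le_lt_trans; apply; rewrite gtr0_norm// /h.
  by rewrite ltr_pdivrMr// ltr_pMr// ltr1n.
have [|s [t [sh th E0]]] := @second_difference u p h 0 1.
  by move=> a b ah bh; have [[]] := dP a b (hd a ah) (hd b bh).
have sw (a b : R) : p + a *: e_ 1 + b *: e_ 0 = p + b *: e_ 0 + a *: e_ 1.
  by rewrite addrAC.
have [|s' [t' [sh' th' E1]]] := @second_difference u p h 1 0.
  by move=> a b ah bh; rewrite sw; have [[]] := dP b a (hd b bh) (hd a ah).
move: E1; rewrite sw [in X in _ = X]sw => E1.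
have E : A (p + s *: e_ 0 + t *: e_ 1) = B (p + t' *: e_ 0 + s' *: e_ 1).
  have cancel (x y a b c d' : R) : a - b - (c - d') = h * (h * x) ->
      a - c - (b - d') = h * (h * y) -> x = y.
    move=> Ex Ey; have hh : h != 0 by rewrite gt_eqF.
    by apply: (mulfI hh); apply: (mulfI hh); rewrite -Ex -Ey; ring.
  exact: cancel E0 E1.
have [_ [PA _]] := dP s t (hd s sh) (hd t th).
have [_ [_ PB]] := dP t' s' (hd t' th') (hd s' sh').
have key (a b x y : R) : x = y -> `|a - x| <= e / 2 -> `|b - y| <= e / 2 ->
    `|a - b| <= e.
  move=> <- ax bx; rewrite (_ : a - b = (a - x) - (b - x)); last by ring.
  rewrite (splitr e).
  by apply: (le_trans (ler_normB _ _)); exact: lerD.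
exact: key E PA PB.
Unshelve. all: by end_near. Qed.

(** Equivalently u - u p vanishes to third order at p, which is why the notion is
    invariant under changes of coordinates although second derivatives alone
    are not. *)
Definition flat2 u p : Prop :=
  (forall i, partial i u p = 0) /\ (forall i j, partial i (partial j u) p = 0).

Lemma partial_comp u T p i : smooth_map_at T p -> smooth_at u (T p) ->
  partial i (u \o T) p =
    partial 0 u (T p) * partial i (fun q => T q 0 0) p +
    partial 1 u (T p) * partial i (fun q => T q 0 1) p.
Proof.
move=> sT su.
by have [_] := @chain_rule _ u T p i (fun j => sT j 1) (su 1).
Qed.

Lemma partialD u v p i : smooth_at u p -> smooth_at v p ->
  partial i (fun q => u q + v q) p = partial i u p + partial i v p.
Proof.
by move=> su sv; rewrite /partial -deriveD//; exact: smooth_derivable.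
Qed.

Lemma partialM u v p i : smooth_at u p -> smooth_at v p ->
  partial i (fun q => u q * v q) p = u p * partial i v p + v p * partial i u p.
Proof.
by move=> su sv; rewrite /partial [LHS]deriveM//; exact: smooth_derivable.
Qed.

Lemma near_partial_comp u T p i : smooth_map_at T p -> smooth_at u (T p) ->
  \forall q \near p, partial i (u \o T) q =
    partial 0 u (T q) * partial i (fun q => T q 0 0) q +
    partial 1 u (T q) * partial i (fun q => T q 0 1) q.
Proof.
move=> sT su.
have cT : {for p, continuous T} by apply: smooth_map_continuous => j; exact: sT.
have nu : \forall q \near p, Ck_at 1 u (T q) := cT _ (smooth_near_Ck 1 su).
have n0 := smooth_near_Ck 1 (sT 0); have n1 := smooth_near_Ck 1 (sT 1).
near=> q.
suff [_] : is_derive q (e_ i) (u \o T)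
    (partial 0 u (T q) * partial i (fun q => T q 0 0) q +
     partial 1 u (T q) * partial i (fun q => T q 0 1) q) by [].
apply: chain_rule; last exact: (near nu q).
by move=> j; case: (rV2_ord j) => ->; [exact: (near n0 q)|exact: (near n1 q)].
Unshelve. all: by end_near. Qed.

Lemma partial2_comp u T p i j : smooth_map_at T p -> smooth_at u (T p) ->
  partial j (partial i (u \o T)) p =
    ((partial 0 (partial 0 u) (T p) * partial j (fun q => T q 0 0) p +
      partial 1 (partial 0 u) (T p) * partial j (fun q => T q 0 1) p)
      * partial i (fun q => T q 0 0) p +
    (partial 0 (partial 1 u) (T p) * partial j (fun q => T q 0 0) p +
      partial 1 (partial 1 u) (T p) * partial j (fun q => T q 0 1) p)
      * partial i (fun q => T q 0 1) p) +
    (partial 0 u (T p) * partial j (partial i (fun q => T q 0 0)) p +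
     partial 1 u (T p) * partial j (partial i (fun q => T q 0 1)) p).
Proof.
move=> sT su.
rewrite (nbhs_singleton (near_eq_partial j (near_partial_comp i sT su))).
have s0 := smooth_at_partial 0 su; have s1 := smooth_at_partial 1 su.
have c0 : smooth_at (partial 0 u \o T) p by exact: smooth_comp.
have c1 : smooth_at (partial 1 u \o T) p by exact: smooth_comp.
have t0 := smooth_at_partial i (sT 0); have t1 := smooth_at_partial i (sT 1).
rewrite (@partialD (fun q => (partial 0 u \o T) q * _) (fun q => (partial 1 u \o T) q * _));
  [|exact: smoothM|exact: smoothM].
rewrite (partialM j c0 t0) (partialM j c1 t1).
have E0 := partial_comp j sT s0; have E1 := partial_comp j sT s1.
have alg (a b x y c d c' d' x' y' : R) : c' = x' -> d' = y' ->
  a * x + c * c' + (b * y + d * d') = (x' * c + y' * d) + (a * x + b * y).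
  by move=> -> ->; ring.
exact: alg E0 E1.
Qed.

(** Every term of the second order chain rule contains a first or a second
    derivative of u at T p. *)
Lemma flat2_comp u T p : smooth_map_at T p -> smooth_at u (T p) ->
  flat2 u (T p) -> flat2 (u \o T) p.
Proof.
move=> sT su [F1 F2]; split=> [i|j i].
  by rewrite (partial_comp i sT su) !F1 !mul0r addr0.
rewrite (partial2_comp i j sT su).
have alg (a b c d x y x0 y0 x1 y1 x2 y2 : R) :
    a = 0 -> b = 0 -> c = 0 -> d = 0 -> x = 0 -> y = 0 ->
  (a * x0 + b * y0) * x1 + (c * x0 + d * y0) * y1 + (x * x2 + y * y2) = 0.
  by move=> -> -> -> -> -> ->; ring.
by apply: alg; [exact: F2|exact: F2|exact: F2|exact: F2|exact: F1|exact: F1].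
Qed.

Lemma cramer2_eq0 (a b c d x y : R) : a * d - b * c != 0 ->
  x * a + y * c = 0 -> x * b + y * d = 0 -> x = 0 /\ y = 0.
Proof.
move=> D E1 E2; split; apply: (mulIf D); rewrite mul0r.
  rewrite (_ : x * _ = (x * a + y * c) * d - (x * b + y * d) * c); last by ring.
  by rewrite E1 E2 !mul0r subr0.
rewrite (_ : y * _ = (x * b + y * d) * a - (x * a + y * c) * b); last by ring.
by rewrite E1 E2 !mul0r subr0.
Qed.

(** The chain rules are linear systems for the derivatives of u with the Jacobian
    matrix of T as coefficients: the first order one gives the gradient, and,
    once the gradient vanishes, the second order one gives the Hessian. This
    spares constructing a local inverse of T. *)
Lemma flat2_comp_inv u T p : smooth_map_at T p -> smooth_at u (T p) ->
  partial 0 (fun q => T q 0 0) p * partial 1 (fun q => T q 0 1) p -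
  partial 1 (fun q => T q 0 0) p * partial 0 (fun q => T q 0 1) p != 0 ->
  flat2 (u \o T) p -> flat2 u (T p).
Proof.
move=> sT su J [F1 F2].
have [a0 b0] : partial 0 u (T p) = 0 /\ partial 1 u (T p) = 0.
  by apply: (cramer2_eq0 J); rewrite -(partial_comp _ sT su); exact: F1.
have F1' i : partial i u (T p) = 0 by case: (rV2_ord i) => ->; assumption.
split=> [|i j]; first exact: F1'.
have H (k : 'I_2) : partial 0 (partial 0 u) (T p) * partial k (fun q => T q 0 0) p +
      partial 1 (partial 0 u) (T p) * partial k (fun q => T q 0 1) p = 0 /\
     partial 0 (partial 1 u) (T p) * partial k (fun q => T q 0 0) p +
      partial 1 (partial 1 u) (T p) * partial k (fun q => T q 0 1) p = 0.
  have alg (a b x2 y2 e x y : R) : x = 0 -> y = 0 -> e = 0 ->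
      e = a + b + (x * x2 + y * y2) -> a + b = 0.
    by move=> -> -> ->; rewrite !mul0r !addr0.
  by apply: (cramer2_eq0 J); apply: alg;
    [exact: (F1' 0)|exact: (F1' 1)|exact: (F2 k 0)|exact: partial2_comp|
     exact: (F1' 0)|exact: (F1' 1)|exact: (F2 k 1)|exact: partial2_comp].
have [H0 H1] := H 0; have [H2 H3] := H 1.
have [h00 h10] := cramer2_eq0 J H0 H2; have [h01 h11] := cramer2_eq0 J H1 H3.
case: (rV2_ord i) => ->; case: (rV2_ord j) => ->.
- exact: h00.
- exact: h01.
- exact: h10.
- exact: h11.
Qed.

Lemma flat2_eq u v p : (\forall q \near p, u q = v q) -> flat2 u p -> flat2 v p.
Proof.
move=> uv [F1 F2]; split=> [i|i j].
  by rewrite -(nbhs_singleton (near_eq_partial i uv)).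
by rewrite -(nbhs_singleton (near_eq_partial i (near_eq_partial j uv))).
Qed.

End SecondOrder.

(** * Free germs *)

Section FreeGerms.
Variable R : realType.
Implicit Types (u : 'rV[R]_2 -> R) (p q : 'rV[R]_2) (i : 'I_2).
Implicit Types (S T : 'rV[R]_2 -> 'rV[R]_2) (f g : 'rV[R]_2 -> 'rV[R]_5).

Notation e_ i := (delta_mx 0 i : 'rV[R]_2).

Definition dotf (l : 'rV[R]_5) f q : R := \sum_(j < 5) l 0 j * f q 0 j.

(** Independence of the five derivatives of f, stated dually: five vectors of R^5
    are independent exactly if no nonzero linear form vanishes on all of them.
    Since l o f is a scalar function, questions on freeness become questions on
    [flat2]. *)
Definition free_at f p : Prop :=
  forall l : 'rV[R]_5, flat2 (dotf l f) p -> l = 0.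

Definition smooth_free_at f p : Prop :=
  (forall j, smooth_at (fun q => f q 0 j) p) /\ free_at f p.

Lemma smooth_dotf l f p : (forall j, smooth_at (fun q => f q 0 j) p) ->
  smooth_at (dotf l f) p.
Proof.
move=> sf; apply: smooth_sum => j; apply: smoothM; first exact: smooth_cst.
exact: sf.
Qed.

Lemma smooth_free_at_eq f g p : (\forall q \near p, f q = g q) ->
  smooth_free_at f p -> smooth_free_at g p.
Proof.
move=> fg [sf ff]; split=> [j|l lg].
  by apply: smooth_at_eq (sf j); apply: filterS fg => q ->.
apply: ff; apply: flat2_eq lg; apply: filterS fg => q.
by rewrite /dotf => ->.
Qed.

(** If l o f o T is flat at p, then so is its composite with the inverse S of T,
    which is l o f near T p. *)
Lemma smooth_free_at_comp f S T p :
  smooth_map_at T p -> smooth_map_at S (T p) -> S (T p) = p ->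
  (\forall q \near T p, T (S q) = q) ->
  smooth_free_at f (T p) -> smooth_free_at (f \o T) p.
Proof.
move=> sT sS STp TS [sf ff]; split=> [j|l lf].
  by have := smooth_comp sT (sf j).
apply: ff.
have sl : smooth_at (dotf l f \o T) p by apply: smooth_comp => //; exact: smooth_dotf.
have H : flat2 ((dotf l f \o T) \o S) (T p).
  have sl' : smooth_at (dotf l f \o T) (S (T p)) by rewrite STp.
  have lf' : flat2 (dotf l f \o T) (S (T p)) by rewrite STp.
  exact: flat2_comp sS sl' lf'.
apply: flat2_eq H; apply: filterS TS => q.
by rewrite /= => ->.
Qed.

Lemma smooth_free_at_comp_jacobian f T p : smooth_map_at T p ->
  partial 0 (fun q => T q 0 0) p * partial 1 (fun q => T q 0 1) p -
  partial 1 (fun q => T q 0 0) p * partial 0 (fun q => T q 0 1) p != 0 ->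
  smooth_free_at f (T p) -> smooth_free_at (f \o T) p.
Proof.
move=> sT J [sf ff]; split=> [j|l lf].
  by have := smooth_comp sT (sf j).
apply: ff; apply: flat2_comp_inv J _ => //; exact: smooth_dotf.
Qed.

Lemma flat2_addcst u (c : R) p : flat2 (fun q => u q + c) p -> smooth_at u p ->
  flat2 u p.
Proof.
move=> F su.
have E i : \forall q \near p, partial i (fun q => u q + c) q = partial i u q.
  have d := Ck_at_derivable i (su 1).
  near=> q; rewrite /partial deriveD; last first.
  - exact: derivable_cst.
  - exact: (near d q).
  by rewrite (derive_cst c) addr0.
case: F => F1 F2; split=> [i|i j].
  by rewrite -(nbhs_singleton (E i)).
by rewrite -(nbhs_singleton (near_eq_partial i (E j))).
Unshelve. all: by end_near. Qed.

(** The form l applied to f A + a is, up to a constant, l A^T applied to f. *)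
Lemma smooth_free_at_affine f (A : 'M[R]_5) (a : 'rV[R]_5) p : A \in unitmx ->
  smooth_free_at f p -> smooth_free_at (fun q => f q *m A + a) p.
Proof.
move=> uA [sf ff]; split=> [j|l].
  under [fun _ => _]eq_fun do rewrite !mxE.
  apply: smoothD; last exact: smooth_cst.
  apply: (@smooth_sum _ _ (fun k q => f q 0 k * A k j)) => k.
  by apply: smoothM; [exact: sf|exact: smooth_cst].
have E : dotf l (fun q => f q *m A + a) =
    fun q => dotf (l *m A^T) f q + \sum_(j < 5) l 0 j * a 0 j.
  apply/funext => q; rewrite /dotf.
  under eq_bigr do rewrite mxE mulrDr.
  rewrite big_split/=; congr (_ + _).
  under [RHS]eq_bigr do rewrite mxE mulr_suml.
  rewrite [RHS]exchange_big/=; apply: eq_bigr => j _.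
  rewrite mxE mulr_sumr; apply: eq_bigr => k _.
  by rewrite !mxE -mulrA; congr (_ * _); exact: mulrC.
rewrite E => /flat2_addcst H.
have lA : l *m A^T = 0 by apply: ff; apply: H; exact: smooth_dotf.
by rewrite -(mulmxK (_ : A^T \in unitmx) l) ?unitmx_tr// lA mul0mx.
Qed.

End FreeGerms.

(** * Exponential-trigonometric sums *)

Section ExpTrig.
Variable R : realType.
Notation e_ i := (delta_mx 0 i : 'rV[R]_2).

(** The function exp (a s) (X cos (b t) + Y sin (b t)) of w = (s, t), where c is
    ((a, b), (X, Y)). Partial derivatives act on the parameters only
    ([exptrig_d]), so two-jets of sums can be computed on lists. *)
Definition exptrig (c : R * R * (R * R)) (w : 'rV[R]_2) : R :=
  expR (c.1.1 * w 0 0) *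
  (c.2.1 * cos (c.1.2 * w 0 1) + c.2.2 * sin (c.1.2 * w 0 1)).

Definition exptrig_sum (L : seq (R * R * (R * R))) (w : 'rV[R]_2) : R :=
  \sum_(c <- L) exptrig c w.

Definition exptrig_d (i : 'I_2) (c : R * R * (R * R)) : R * R * (R * R) :=
  if i == 0 then (c.1, (c.1.1 * c.2.1, c.1.1 * c.2.2))
  else (c.1, (c.1.2 * c.2.2, - c.1.2 * c.2.1)).

Lemma is_derive_exptrig c w i :
  is_derive w (e_ i) (exptrig c) (exptrig (exptrig_d i c) w).
Proof.
case: c => [[a b] [X Y]].
have dc (k : R) j : is_derive w (e_ i) (fun v : 'rV[R]_2 => k * v 0 j) (k * e_ i 0 j).
  apply: (is_derive_eq (@is_deriveZ _ _ _ _ k w (e_ i) _ (is_derive_coord w j (e_ i)))).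
  by [].
have dE := @is_derive_comp1 _ _ expR (fun v : 'rV[R]_2 => a * v 0 0) w (e_ i) _ _
  (is_derive_expR (a * w 0 0)) (dc a 0).
have dC := @is_derive_comp1 _ _ cos (fun v : 'rV[R]_2 => b * v 0 1) w (e_ i) _ _
  (is_derive_cos (b * w 0 1)) (dc b 1).
have dS := @is_derive_comp1 _ _ sin (fun v : 'rV[R]_2 => b * v 0 1) w (e_ i) _ _
  (is_derive_sin (b * w 0 1)) (dc b 1).
have dX := @is_deriveZ _ _ _ _ X _ _ _ dC.
have dY := @is_deriveZ _ _ _ _ Y _ _ _ dS.
have H := is_deriveM dE (is_deriveD dX dY).
apply: (is_derive_eq H).
rewrite /exptrig /exptrig_d /GRing.scale/= !mxE.
have -> : (X \*: (cos \o (fun v : 'rV[R]_2 => b * v 0 1)) +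
    Y \*: (sin \o (fun v : 'rV[R]_2 => b * v 0 1))) w =
    X * cos (b * w 0 1) + Y * sin (b * w 0 1) by [].
by case: (rV2_ord i) => -> /=; move: (expR _) (cos _) (sin _) => E C S; ring.
Qed.

Lemma partial_exptrig_sum L i :
  partial i (exptrig_sum L) = exptrig_sum (map (exptrig_d i) L).
Proof.
apply/funext => w.
suff [_] : is_derive w (e_ i) (exptrig_sum L) (exptrig_sum (map (exptrig_d i) L) w).
  by [].
elim: L => [|c L IH].
  have -> : exptrig_sum [::] = fun=> 0 by apply/funext => v; rewrite /exptrig_sum big_nil.
  by exact: is_derive_cst.
have -> : exptrig_sum (c :: L) = exptrig c + exptrig_sum L.
  by apply/funext => v; rewrite /exptrig_sum big_cons.
rewrite /= {2}/exptrig_sum big_cons.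
exact: is_deriveD (is_derive_exptrig c w i) IH.
Qed.

Lemma exptrig_sum0 L : exptrig_sum L 0 = \sum_(c <- L) c.2.1.
Proof.
apply: eq_bigr => c _; rewrite /exptrig !mxE !mulr0 expR0 cos0 sin0.
by rewrite mul1r mulr1 mulr0 addr0.
Qed.

(** The derivatives along s, t, ss, st and tt, at the origin, where exp and cos
    are 1 and sin is 0. *)
Lemma flat2_exptrig_sum L : flat2 (exptrig_sum L) 0 ->
  [/\ \sum_(c <- L) c.1.1 * c.2.1 = 0,
      \sum_(c <- L) c.1.2 * c.2.2 = 0,
      \sum_(c <- L) c.1.1 * (c.1.1 * c.2.1) = 0,
      \sum_(c <- L) c.1.1 * (c.1.2 * c.2.2) = 0 &
      \sum_(c <- L) c.1.2 * (- c.1.2 * c.2.1) = 0].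
Proof.
case=> F1 F2; split.
- by have := F1 0; rewrite partial_exptrig_sum exptrig_sum0 big_map.
- by have := F1 1; rewrite partial_exptrig_sum exptrig_sum0 big_map.
- by have := F2 0 0; rewrite !partial_exptrig_sum exptrig_sum0 !big_map.
- by have := F2 0 1; rewrite !partial_exptrig_sum exptrig_sum0 !big_map.
- by have := F2 1 1; rewrite !partial_exptrig_sum exptrig_sum0 !big_map.
Qed.

End ExpTrig.

(** * The free tube *)

Section Neck.
Variable R : realType.
Implicit Types (p q v w : 'rV[R]_2) (k : R) (l : 'rV[R]_5).

Lemma enorm_sqr v : enorm v ^+ 2 = v 0 0 ^+ 2 + v 0 1 ^+ 2.
Proof.
rewrite sqr_sqrtr; last by apply: sumr_ge0 => i _; exact: sqr_ge0.
by rewrite big_ord_recl big_ord1; congr (_ + v _ _ ^+ 2); exact: val_inj.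
Qed.

Lemma enorm_ge0 v : 0 <= enorm v.
Proof. exact: sqrtr_ge0. Qed.

Lemma enorm_uniq v (a : R) : 0 <= a -> a ^+ 2 = v 0 0 ^+ 2 + v 0 1 ^+ 2 ->
  enorm v = a.
Proof.
move=> a0 E; apply/eqP; rewrite -(@eqrXn2 _ 2) ?enorm_ge0//.
by rewrite enorm_sqr E.
Qed.

Lemma enormZ (a : R) v : enorm (a *: v) = `|a| * enorm v.
Proof.
apply: enorm_uniq; first by rewrite mulr_ge0 ?enorm_ge0.
by rewrite exprMn enorm_sqr !mxE -normrX ger0_norm ?sqr_ge0//; ring.
Qed.

Lemma enorm0 : enorm (0 : 'rV[R]_2) = 0.
Proof. by apply: enorm_uniq => //; rewrite !mxE expr0n addr0. Qed.

Lemma enorm_gt0 v : (0 < enorm v) = (v != 0).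
Proof.
have [->|v0] := eqVneq v 0; first by rewrite enorm0 ltxx.
rewrite lt_def enorm_ge0 andbT; apply: contra v0 => /eqP e0.
have := enorm_sqr v; rewrite e0 expr0n/= => /esym/eqP.
rewrite paddr_eq0 ?sqr_ge0// !sqrf_eq0 => /andP[/eqP a /eqP b].
by rewrite (rV2E v) a b !scale0r addr0.
Qed.

Lemma smooth_enorm p : p != 0 -> smooth_at (@enorm R) p.
Proof.
move=> p0; apply: smooth_sqrt.
  apply: (@smooth_sum _ _ (fun i q => q 0 i ^+ 2)) => i.
  by apply: smoothX; exact: smooth_coord.
by rewrite -sqrtr_gt0 enorm_gt0.
Qed.

(** R^5 is used as C + R + C, coordinates 0, 1 and 3, 4 forming the two complex
    ones. *)
Definition row5 (a b c d e : R) : 'rV[R]_5 := \row_j nth 0 [:: a; b; c; d; e] j.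

Definition o5 n (h : (n < 5)%N) : 'I_5 := Ordinal h.
Notation i0 := (@o5 0 isT).
Notation i1 := (@o5 1 isT).
Notation i2 := (@o5 2 isT).
Notation i3 := (@o5 3 isT).
Notation i4 := (@o5 4 isT).

Lemma ord5_ind (P : 'I_5 -> Prop) : P i0 -> P i1 -> P i2 -> P i3 -> P i4 ->
  forall j, P j.
Proof.
move=> p0 p1 p2 p3 p4 [[|[|[|[|[|//]]]]] h].
- by rewrite (_ : Ordinal h = i0)//; exact: val_inj.
- by rewrite (_ : Ordinal h = i1)//; exact: val_inj.
- by rewrite (_ : Ordinal h = i2)//; exact: val_inj.
- by rewrite (_ : Ordinal h = i3)//; exact: val_inj.
- by rewrite (_ : Ordinal h = i4)//; exact: val_inj.
Qed.

Lemma big_ord5 (F : 'I_5 -> R) :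
  \sum_(j < 5) F j = F i0 + F i1 + F i2 + F i3 + F i4.
Proof.
rewrite !big_ord_recr big_ord0 /= add0r.
by congr (F _ + F _ + F _ + F _ + F _); exact: val_inj.
Qed.

Lemma dotf_row5 l (a b c d e : 'rV[R]_2 -> R) q :
  dotf l (fun q => row5 (a q) (b q) (c q) (d q) (e q)) q =
  l 0 i0 * a q + l 0 i1 * b q + l 0 i2 * c q + l 0 i3 * d q + l 0 i4 * e q.
Proof. by rewrite /dotf big_ord5 !mxE. Qed.

(** With r = k e^s, r times [neck_b] is k (2 cosh s - 1), [neck_c] is
    k^2 (2 cosh 2s - 10 cosh s), and r^2 times [neck_d] is 2 k^2 sinh 2s. The
    leading terms for large s are those of the model map (r, r^2, r^2). The
    hyperbolic sines and cosines alone would not give a free map: the term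
    -10 cosh s makes the second derivative of [neck_c] negative at s = 0, as the
    sign of the determinant at infinity requires, and the term -1 is a lower
    order correction that keeps this sign at all intermediate s. *)
Definition neck_b k (r : R) : R := 1 + k ^+ 2 / r ^+ 2 - k / r.
Definition neck_c k (r : R) : R :=
  r ^+ 2 + k ^+ 4 / r ^+ 2 - 5 * k * r - 5 * k ^+ 3 / r.
Definition neck_d k (r : R) : R := 1 - k ^+ 4 / r ^+ 4.

Definition neck k q : 'rV[R]_5 :=
  row5 (q 0 0 * neck_b k (enorm q)) (q 0 1 * neck_b k (enorm q))
       (neck_c k (enorm q))
       ((q 0 0 ^+ 2 - q 0 1 ^+ 2) * neck_d k (enorm q))
       (2 * q 0 0 * q 0 1 * neck_d k (enorm q)).

Lemma smooth_row5 (a b c d e : 'rV[R]_2 -> R) p :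
  smooth_at a p -> smooth_at b p -> smooth_at c p -> smooth_at d p ->
  smooth_at e p ->
  forall j, smooth_at (fun q => row5 (a q) (b q) (c q) (d q) (e q) 0 j) p.
Proof.
move=> sa sb sc sd se; elim/ord5_ind;
  by under [fun _ => _]eq_fun do rewrite mxE /=.
Qed.

Lemma smooth_neck k p : p != 0 -> forall j, smooth_at (fun q => neck k q 0 j) p.
Proof.
move=> p0.
have sr := smooth_enorm p0.
have r0 : enorm p != 0 by rewrite gt_eqF// enorm_gt0.
have sV n : smooth_at (fun q => (enorm q ^+ n)^-1) p.
  by apply: smoothV; [exact: smoothX|rewrite expf_neq0].
have sV1 : smooth_at (fun q => (enorm q)^-1) p by exact: smoothV.
have c a := @smooth_cst R a p.
have s0 := @smooth_coord R p 0; have s1 := @smooth_coord R p 1.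
have sb : smooth_at (fun q => neck_b k (enorm q)) p.
  apply: smoothB; last exact: smoothM.
  by apply: smoothD => //; exact: smoothM.
have sd : smooth_at (fun q => neck_d k (enorm q)) p.
  by apply: smoothB => //; exact: smoothM.
have sc : smooth_at (fun q => neck_c k (enorm q)) p.
  apply: smoothB; last exact: smoothM.
  apply: smoothB; last exact: smoothM.
  by apply: smoothD; [exact: smoothX|exact: smoothM].
apply: smooth_row5 => //; do ?[exact: smoothM].
- by apply: smoothM => //; apply: smoothB; exact: smoothX.
- by do 3?[apply: smoothM => //].
Qed.

(** The coordinates (s, t) |-> e^s e^(it) p centred at p instead of at a fixed
    point of the unit circle, so that the two-jet is always taken at the
    origin. *)
Definition polar p w : 'rV[R]_2 :=
  (expR (w 0 0) * (p 0 0 * cos (w 0 1) - p 0 1 * sin (w 0 1))) *: delta_mx 0 0 +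
  (expR (w 0 0) * (p 0 0 * sin (w 0 1) + p 0 1 * cos (w 0 1))) *: delta_mx 0 1.

Lemma polar0 p w :
  polar p w 0 0 = expR (w 0 0) * (p 0 0 * cos (w 0 1) - p 0 1 * sin (w 0 1)).
Proof. by rewrite /polar !mxE /= mulr1 mulr0 addr0. Qed.

Lemma polar1 p w :
  polar p w 0 1 = expR (w 0 0) * (p 0 0 * sin (w 0 1) + p 0 1 * cos (w 0 1)).
Proof. by rewrite /polar !mxE /= mulr1 mulr0 add0r. Qed.

Lemma polar_at0 p : polar p 0 = p.
Proof.
rewrite [RHS]rV2E /polar !mxE expR0 cos0 sin0 !mul1r !mulr1 !mulr0.
by rewrite subr0 add0r.
Qed.

Lemma smooth_polar p w : smooth_map_at (polar p) w.
Proof.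
have s0 := @smooth_coord R w 0; have s1 := @smooth_coord R w 1.
have sE := smooth_expR s0; have sC := smooth_cos s1; have sS := smooth_sin s1.
have c a := @smooth_cst R a w.
move=> j; case: (rV2_ord j) => ->.
  under [fun _ => _]eq_fun do rewrite polar0.
  by apply: smoothM => //; apply: smoothB; exact: smoothM.
under [fun _ => _]eq_fun do rewrite polar1.
by apply: smoothM => //; apply: smoothD; exact: smoothM.
Qed.

Lemma enorm_polar p w : enorm (polar p w) = expR (w 0 0) * enorm p.
Proof.
apply: enorm_uniq; first by rewrite mulr_ge0 ?expR_ge0 ?enorm_ge0.
rewrite exprMn enorm_sqr polar0 polar1.
have := cos2Dsin2 (w 0 1); move: (cos _) (sin _) (expR _) => C S E CS.
transitivity (E ^+ 2 * ((p 0 0 ^+ 2 + p 0 1 ^+ 2) * (C ^+ 2 + S ^+ 2))).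
  by rewrite CS mulr1.
by ring.
Qed.

(** The exponents (a, b) of e^(as) and of the harmonic b in t, for a linear form
    composed with the neck, where m = k / |p|. The parameters P + iP', c and
    Q + iQ' are the components of the form on C + R + C, seen at p; the sine
    parts P', Q' separate from the cosine parts P, c, Q. *)
Definition neck_modes (m P P' c Q Q' : R) : seq (R * R * (R * R)) :=
  [:: (1, 1, (P, P')); (-1, 1, (m ^+ 2 * P, m ^+ 2 * P'));
      (0, 1, (- m * P, - m * P'));
      (2, 0, (c, 0)); (-2, 0, (m ^+ 4 * c, 0));
      (1, 0, (- 5 * m * c, 0)); (-1, 0, (- 5 * m ^+ 3 * c, 0));
      (2, 2, (Q, Q')); (-2, 2, (- m ^+ 4 * Q, - m ^+ 4 * Q'))].

Lemma neck_polar k l p : p != 0 ->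
  dotf l (neck k) \o polar p =
  exptrig_sum (neck_modes (k / enorm p)
    (l 0 i0 * p 0 0 + l 0 i1 * p 0 1) (l 0 i1 * p 0 0 - l 0 i0 * p 0 1)
    (l 0 i2 * enorm p ^+ 2)
    (l 0 i3 * (p 0 0 ^+ 2 - p 0 1 ^+ 2) + l 0 i4 * (2 * p 0 0 * p 0 1))
    (l 0 i4 * (p 0 0 ^+ 2 - p 0 1 ^+ 2) - l 0 i3 * (2 * p 0 0 * p 0 1))).
Proof.
move=> p0; apply/funext => w.
have r0 : enorm p != 0 by rewrite gt_eqF// enorm_gt0.
rewrite [LHS]dotf_row5 enorm_polar polar0 polar1.
rewrite /neck_b /neck_c /neck_d.
rewrite /exptrig_sum /neck_modes !big_cons big_nil /exptrig/=.
have E2 : expR (2 * w 0 0) = expR (w 0 0) ^+ 2 by rewrite expRM_natl.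
have E1 : expR (1 * w 0 0) = expR (w 0 0) by rewrite mul1r.
have EN : expR (-1 * w 0 0) = (expR (w 0 0))^-1 by rewrite mulN1r expRN.
have EN2 : expR (-2 * w 0 0) = (expR (w 0 0))^-1 ^+ 2.
  by rewrite mulNr expRN E2 exprVn.
have E0 : expR (0 * w 0 0) = 1 by rewrite mul0r expR0.
have C1 : cos (1 * w 0 1) = cos (w 0 1) by rewrite mul1r.
have S1 : sin (1 * w 0 1) = sin (w 0 1) by rewrite mul1r.
have C0 : cos (0 * w 0 1) = 1 by rewrite mul0r cos0.
have S0 : sin (0 * w 0 1) = 0 by rewrite mul0r sin0.
have C2 : cos (2 * w 0 1) = cos (w 0 1) ^+ 2 - sin (w 0 1) ^+ 2.
  by rewrite -[2]/(1 + 1) mulrDl !mul1r cosD -!expr2.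
have S2 : sin (2 * w 0 1) = 2 * sin (w 0 1) * cos (w 0 1).
  by rewrite -[2]/(1 + 1) mulrDl !mul1r sinD; ring.
rewrite E2 E1 EN EN2 E0 C1 S1 C0 S0 C2 S2.
have : expR (w 0 0) != 0 by rewrite gt_eqF// expR_gt0.
move: (expR _) (cos _) (sin _) r0 => E C S; move: (enorm p) => r r0 En0.
by field; rewrite En0 r0.
Qed.

(** The determinant of the equations for the sine parts, from the derivatives
    along t and st. *)
Lemma neck_det2 (m : R) : 0 < m ->
  (1 - m + m ^+ 2) * (2 + 2 * m ^+ 4) - (1 - m ^+ 2) * (1 - m ^+ 4) > 0.
Proof.
move=> m0.
rewrite (_ : _ - _ = (1 - m) ^+ 2 + 2 * m ^+ 2 + 2 * m ^+ 4 +
   m ^+ 4 * (1 - m) ^+ 2); last by ring.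
have m2 : 0 < m ^+ 2 by rewrite exprn_gt0.
have m4 : 0 < m ^+ 4 by rewrite exprn_gt0.
have t : 0 <= (1 - m) ^+ 2 by exact: sqr_ge0.
have mt : 0 <= m ^+ 4 * (1 - m) ^+ 2 by rewrite mulr_ge0// ltW.
by lra.
Qed.

(** The determinant of the equations for the cosine parts, from the derivatives
    along s, ss and tt, as a palindromic polynomial in m. *)
Lemma neck_det3 (m : R) : 0 < m ->
  - 8 + 10 * m + 14 * m ^+ 2 - 20 * m ^+ 3 + 46 * m ^+ 4 - 92 * m ^+ 5 +
  46 * m ^+ 6 - 20 * m ^+ 7 + 14 * m ^+ 8 + 10 * m ^+ 9 - 8 * m ^+ 10 < 0.
Proof.
move=> m0; pose t := (1 - m) ^+ 2.
(* Expansion at m = 1, the waist of the tube: in t = (1 - m)^2 and m all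
   coefficients but one have the same sign. *)
rewrite (_ : _ - _ = - (8 * t ^+ 5 + 70 * (t ^+ 4 * m) + 186 * (t ^+ 3 * m ^+ 2)
  + m ^+ 3 * (136 * t ^+ 2 - 52 * (t * m) + 8 * m ^+ 2))); last by rewrite /t; ring.
rewrite oppr_lt0.
have t0 : 0 <= t by exact: sqr_ge0.
have t5 : 0 <= t ^+ 5 by rewrite exprn_ge0.
have t4 : 0 <= t ^+ 4 * m by apply: mulr_ge0; [exact: exprn_ge0|exact: ltW].
have t3 : 0 <= t ^+ 3 * m ^+ 2.
  by apply: mulr_ge0; [exact: exprn_ge0|exact: sqr_ge0].
have q : 0 < m ^+ 3 * (136 * t ^+ 2 - 52 * (t * m) + 8 * m ^+ 2).
  rewrite mulr_gt0 ?exprn_gt0//.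
  (* The exceptional coefficient is absorbed by completing a square. *)
  rewrite (_ : _ + _ = 2 * (t * 8 - m * (13 / 8)) ^+ 2 + 8 * t ^+ 2
     + (8 - 169 / 32) * m ^+ 2); last by field.
  have := sqr_ge0 (t * 8 - m * (13 / 8)); have := sqr_ge0 t.
  have : 0 < m ^+ 2 by rewrite exprn_gt0.
  by lra.
by lra.
Qed.

Lemma cramer3_eq0 (a1 a2 a3 b1 b2 b3 c1 c2 c3 x y z : R) :
  a1 * (b2 * c3 - c2 * b3) - b1 * (a2 * c3 - c2 * a3) + c1 * (a2 * b3 - b2 * a3)
    != 0 ->
  x * a1 + y * b1 + z * c1 = 0 -> x * a2 + y * b2 + z * c2 = 0 ->
  x * a3 + y * b3 + z * c3 = 0 -> [/\ x = 0, y = 0 & z = 0].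
Proof.
set D := (X in X != 0) => D0 E1 E2 E3.
have key (w d1 d2 d3 : R) : D * w = d1 * (x * a1 + y * b1 + z * c1) +
    d2 * (x * a2 + y * b2 + z * c2) + d3 * (x * a3 + y * b3 + z * c3) -> w = 0.
  rewrite E1 E2 E3 !mulr0 !addr0 => H.
  by apply: (mulfI D0); rewrite mulr0.
split.
- by apply: (key _ (b2 * c3 - c2 * b3) (c1 * b3 - b1 * c3) (b1 * c2 - c1 * b2));
    rewrite /D; ring.
- by apply: (key _ (c2 * a3 - a2 * c3) (a1 * c3 - c1 * a3) (c1 * a2 - a1 * c2));
    rewrite /D; ring.
- by apply: (key _ (a2 * b3 - b2 * a3) (b1 * a3 - a1 * b3) (a1 * b2 - b1 * a2));
    rewrite /D; ring.
Qed.

Lemma neck_modes_eq0 (m P P' c Q Q' : R) : 0 < m ->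
  flat2 (exptrig_sum (neck_modes m P P' c Q Q')) 0 ->
  [/\ P = 0, P' = 0, c = 0, Q = 0 & Q' = 0].
Proof.
move=> m0 /flat2_exptrig_sum[].
rewrite /neck_modes !big_cons !big_nil /= => E1 E2 E3 E4 E5.
have D2 := neck_det2 m0; have D3 := neck_det3 m0.
have {}E2 : P' * (1 - m + m ^+ 2) + Q' * (2 * (1 - m ^+ 4)) = 0.
  by rewrite -[RHS]E2; ring.
have {}E4 : P' * (1 - m ^+ 2) + Q' * (2 * (2 + 2 * m ^+ 4)) = 0.
  by rewrite -[RHS]E4; ring.
have [P'0 Q'0] : P' = 0 /\ Q' = 0.
  apply: cramer2_eq0 E2 E4; rewrite gt_eqF//.
  by move: D2; rewrite -subr_gt0 subr0 => D2; nra.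
have {}E1 : P * (1 - m ^+ 2) + c * (2 - 5 * m + 5 * m ^+ 3 - 2 * m ^+ 4)
    + Q * (2 + 2 * m ^+ 4) = 0.
  by rewrite -[RHS]E1; ring.
have {}E3 : P * (1 + m ^+ 2) + c * (4 - 5 * m - 5 * m ^+ 3 + 4 * m ^+ 4)
    + Q * (4 - 4 * m ^+ 4) = 0.
  by rewrite -[RHS]E3; ring.
have {}E5 : P * (1 - m + m ^+ 2) + c * 0 + Q * (4 - 4 * m ^+ 4) = 0.
  by rewrite -[RHS]oppr0 -[X in _ = - X]E5; ring.
have [P0 c0 Q0] : [/\ P = 0, c = 0 & Q = 0].
  apply: cramer3_eq0 E1 E3 E5; rewrite gt_eqF//.
  by move: D3; rewrite -oppr_gt0; congr (0 < _); ring.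
by split.
Qed.

(** If l o neck is flat at p it is flat in the coordinates [polar], and then all
    Fourier components of l vanish; they are obtained from l by rotations and by
    a multiplication by |p|^2. *)
Lemma free_neck k p : 0 < k -> p != 0 -> free_at (neck k) p.
Proof.
move=> k0 p0 l F.
have r0 : 0 < enorm p by rewrite enorm_gt0.
have := @flat2_comp _ (dotf l (neck k)) (polar p) 0 (smooth_polar p 0).
rewrite polar_at0 => /(_ (smooth_dotf l (smooth_neck k p0)) F).
rewrite neck_polar// => /neck_modes_eq0[|]; first exact: divr_gt0.
move=> E0 E1 E2 E3 E4.
have D : p 0 0 ^+ 2 + p 0 1 ^+ 2 != 0.
  by rewrite -enorm_sqr expf_neq0// gt_eqF.
have D' : (p 0 0 ^+ 2 - p 0 1 ^+ 2) ^+ 2 + (2 * p 0 0 * p 0 1) ^+ 2 != 0.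
  rewrite (_ : _ + _ = (p 0 0 ^+ 2 + p 0 1 ^+ 2) ^+ 2); last by ring.
  by rewrite expf_neq0.
have rot (x y a b : R) : a ^+ 2 + b ^+ 2 != 0 ->
    x * a + y * b = 0 -> y * a - x * b = 0 -> x = 0 /\ y = 0.
  move=> ab H1 H2; apply: (@cramer2_eq0 _ a (- b) b a).
  - by rewrite mulNr opprK -!expr2.
  - exact: H1.
  - by rewrite -[RHS]H2; ring.
have [l0 l1] := rot _ _ _ _ D E0 E1.
have [l3 l4] := rot _ _ _ _ D' E3 E4.
have l2 : l 0 i2 = 0.
  by apply: (mulIf (_ : enorm p ^+ 2 != 0)); rewrite ?E2 ?mul0r// expf_neq0// gt_eqF.
by apply/rowP; elim/ord5_ind; rewrite mxE.
Qed.

Lemma smooth_free_neck k p : 0 < k -> p != 0 -> smooth_free_at (neck k) p.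
Proof. by move=> k0 p0; split; [exact: smooth_neck|exact: free_neck]. Qed.

(** In the coordinate s = log (|q| / k) this is s |-> -s. *)
Definition inversion k q : 'rV[R]_2 := (k ^+ 2 / enorm q ^+ 2) *: q.

Definition neck_flip : 'M[R]_5 := diag_mx (row5 1 1 1 (-1) (-1)).

(** The coefficients of the first three coordinates are even functions of s, that
    of the last two is odd. *)
Lemma neck_inversion k q : 0 < k -> q != 0 ->
  neck k (inversion k q) = neck k q *m neck_flip.
Proof.
move=> k0 q0; have r0 : 0 < enorm q by rewrite enorm_gt0.
have kn0 : k != 0 by rewrite gt_eqF.
have rn0 : enorm q != 0 by rewrite gt_eqF.
have E : enorm (inversion k q) = k ^+ 2 / enorm q.
  rewrite enormZ ger0_norm; last by rewrite divr_ge0// exprn_ge0// ltW.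
  by field.
rewrite /neck E /neck_b /neck_c /neck_d; apply/rowP => j.
rewrite mul_mx_diag !mxE; elim/ord5_ind: j => /=; move: (enorm q) rn0 => r rn0;
  by field; rewrite ?rn0 ?kn0.
Qed.

End Neck.

(** * Quantitative control of two-jets *)

Section Jets.
Variable R : realType.
Implicit Types (u v : 'rV[R]_2 -> R) (p q : 'rV[R]_2) (i j : 'I_2).
Implicit Types (f g : 'rV[R]_2 -> 'rV[R]_5) (l : 'rV[R]_5).

Notation e_ i := (delta_mx 0 i : 'rV[R]_2).

(** A coordinatewise derivative, which needs no derivability of the vector valued
    map to be computed. *)
Definition vpartial i f q : 'rV[R]_5 := \row_j partial i (fun r => f r 0 j) q.

Definition smooth5_at f p := forall j : 'I_5, smooth_at (fun q => f q 0 j) p.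

Lemma smooth5_vpartial i f p : smooth5_at f p -> smooth5_at (vpartial i f) p.
Proof.
move=> sf j; under [fun _ => _]eq_fun do rewrite mxE.
exact: smooth_at_partial.
Qed.

Lemma is_derive_dotf l f p i :
  (forall j : 'I_5, derivable (fun q => f q 0 j) p (e_ i)) ->
  is_derive p (e_ i) (dotf l f) (dotf l (vpartial i f) p).
Proof.
move=> df.
have dj (j : 'I_5) : is_derive p (e_ i) (fun q => l 0 j * f q 0 j)
    (l 0 j * partial i (fun q => f q 0 j) p).
  exact: (is_derive_eq (@is_deriveZ _ _ _ _ (l 0 j) p (e_ i) _ (derivableP (df j)))).
have := @is_derive_sum _ _ _ 5 (fun (j : 'I_5) q => l 0 j * f q 0 j) p (e_ i) _ dj.
have -> : \sum_(j < 5) (fun q => l 0 j * f q 0 j) = dotf l f.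
  by apply/funext => q; rewrite fct_sumE.
move=> H; apply: (is_derive_eq H).
by apply: eq_bigr => j _; rewrite mxE.
Qed.

Lemma near_partial_dotf l f p i : smooth5_at f p ->
  \forall q \near p, partial i (dotf l f) q = dotf l (vpartial i f) q.
Proof.
move=> sf.
have d : \forall q \near p, forall j : 'I_5, derivable (fun q => f q 0 j) q (e_ i).
  apply: (@filter_forall _ 'I_5 (fun (j : 'I_5) q => derivable (fun q => f q 0 j) q (e_ i))
    (nbhs p)) => j.
  exact: Ck_at_derivable (sf j 1).
by apply: filterS d => q /(is_derive_dotf l)[_].
Qed.

Lemma partial_dotf l f p i : smooth5_at f p ->
  partial i (dotf l f) p = dotf l (vpartial i f) p.
Proof. by move=> sf; exact: nbhs_singleton (near_partial_dotf l i sf). Qed.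

Lemma partial2_dotf l f p i j : smooth5_at f p ->
  partial j (partial i (dotf l f)) p = dotf l (vpartial j (vpartial i f)) p.
Proof.
move=> sf; rewrite (nbhs_singleton (near_eq_partial j (near_partial_dotf l i sf))).
by rewrite partial_dotf//; exact: smooth5_vpartial.
Qed.

Definition jet_le u (M : R) p : Prop :=
  [/\ `|u p| <= M, forall i, `|partial i u p| <= M &
      forall i j, `|partial i (partial j u) p| <= M].

Lemma jet_le_trans u (M N : R) p : M <= N -> jet_le u M p -> jet_le u N p.
Proof.
move=> MN [a b c]; split=> [|i|i j]; apply: le_trans MN => //.
Qed.

Lemma jet_le_ge0 u (M : R) p : jet_le u M p -> 0 <= M.
Proof. by case=> a _ _; apply: le_trans a. Qed.

Lemma near_partialD u v p i : smooth_at u p -> smooth_at v p ->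
  \forall q \near p, partial i (fun q => u q + v q) q = partial i u q + partial i v q.
Proof.
move=> su sv; have du := Ck_at_derivable i (su 1); have dv := Ck_at_derivable i (sv 1).
near=> q; rewrite /partial -deriveD//; [exact: (near du q)|exact: (near dv q)].
Unshelve. all: by end_near. Qed.

Lemma near_partialM u v p i : smooth_at u p -> smooth_at v p ->
  \forall q \near p, partial i (fun q => u q * v q) q =
    u q * partial i v q + v q * partial i u q.
Proof.
move=> su sv; have du := Ck_at_derivable i (su 1); have dv := Ck_at_derivable i (sv 1).
near=> q; rewrite /partial [LHS]deriveM//; [exact: (near du q)|exact: (near dv q)].
Unshelve. all: by end_near. Qed.

Lemma partial2D u v p i j : smooth_at u p -> smooth_at v p ->
  partial i (partial j (fun q => u q + v q)) p =
  partial i (partial j u) p + partial i (partial j v) p.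
Proof.
move=> su sv; rewrite (nbhs_singleton (near_eq_partial i (near_partialD j su sv))).
exact: partialD (smooth_at_partial j su) (smooth_at_partial j sv).
Qed.

Lemma partial2M u v p i j : smooth_at u p -> smooth_at v p ->
  partial i (partial j (fun q => u q * v q)) p =
  (u p * partial i (partial j v) p + partial j v p * partial i u p) +
  (v p * partial i (partial j u) p + partial j u p * partial i v p).
Proof.
move=> su sv; rewrite (nbhs_singleton (near_eq_partial i (near_partialM j su sv))).
have du := smooth_at_partial j su; have dv := smooth_at_partial j sv.
rewrite (@partialD _ (fun q => u q * partial j v q) (fun q => v q * partial j u q)
   p i (smoothM su dv) (smoothM sv du)).
by rewrite (partialM i su dv) (partialM i sv du).
Qed.

Lemma partial_const (c : R) p i : partial i (fun=> c) p = 0.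
Proof. exact: derive_cst. Qed.

Lemma partial2_const (c : R) p i j : partial i (partial j (fun=> c)) p = 0.
Proof.
rewrite (_ : partial j (fun=> c) = fun=> 0) ?partial_const//.
by apply/funext => q; exact: partial_const.
Qed.

Lemma jet_leD u v (M N : R) p : smooth_at u p -> smooth_at v p ->
  jet_le u M p -> jet_le v N p -> jet_le (fun q => u q + v q) (M + N) p.
Proof.
move=> su sv [u0 u1 u2] [v0 v1 v2].
have tri (a b : R) : `|a| <= M -> `|b| <= N -> `|a + b| <= M + N.
  by move=> aM bN; apply: le_trans (ler_normD _ _) (lerD aM bN).
split=> [|i|i j]; first exact: tri.
  by rewrite (partialD i su sv); exact: tri.
by rewrite (partial2D i j su sv); exact: tri.
Qed.

(** A second derivative of a product has four terms by the Leibniz rule. *)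
Lemma jet_leM u v (M N : R) p : smooth_at u p -> smooth_at v p ->
  jet_le u M p -> jet_le v N p -> jet_le (fun q => u q * v q) (4 * (M * N)) p.
Proof.
move=> su sv ju jv; have M0 := jet_le_ge0 ju; have N0 := jet_le_ge0 jv.
case: ju => u0 u1 u2; case: jv => v0 v1 v2.
have mul1 (a b : R) : `|a| <= M -> `|b| <= N -> `|a * b| <= M * N.
  by move=> aM bN; rewrite normrM ler_pM.
have mul2 (a b : R) : `|a| <= N -> `|b| <= M -> `|a * b| <= M * N.
  by move=> aM bN; rewrite mulrC; exact: mul1.
have MN0 : 0 <= M * N by exact: mulr_ge0.
have two (a b : R) : `|a| <= M * N -> `|b| <= M * N -> `|a + b| <= 2 * (M * N).
  by move=> aM bN; apply: le_trans (ler_normD _ _) _; lra.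
have four (a b : R) : `|a| <= 2 * (M * N) -> `|b| <= 2 * (M * N) ->
    `|a + b| <= 4 * (M * N).
  by move=> aM bN; apply: le_trans (ler_normD _ _) _; lra.
have w2 (a : R) : `|a| <= 2 * (M * N) -> `|a| <= 4 * (M * N) by move=> ?; lra.
split=> [|i|i j].
- by apply: (le_trans (mul1 _ _ u0 v0)); lra.
- by rewrite (partialM i su sv); apply: w2; apply: two; [exact: mul1|exact: mul2].
- rewrite (partial2M i j su sv); apply: four; apply: two;
    by [exact: mul1|exact: mul2].
Qed.

Lemma jet_leZ u (c M : R) p : smooth_at u p -> jet_le u M p ->
  jet_le (fun q => c * u q) (`|c| * M) p.
Proof.
move=> su [u0 u1 u2]; have sc := @smooth_cst R c p.
have sM (a : R) : `|a| <= M -> `|c * a| <= `|c| * M.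
  by move=> aM; rewrite normrM ler_wpM2l.
split=> [|i|i j]; first exact: sM.
  by rewrite (partialM i sc su) partial_const mulr0 addr0; exact: sM.
have -> : partial i (partial j (fun q => c * u q)) p = c * partial i (partial j u) p.
  rewrite (partial2M i j sc su) (partial_const c p i) (partial_const c p j).
  by rewrite (partial2_const c p i j) mulr0 mulr0 mul0r !addr0.
exact: sM.
Qed.

Lemma jet_le_eq u v (M : R) p : (\forall q \near p, u q = v q) ->
  jet_le u M p -> jet_le v M p.
Proof.
move=> uv [u0 u1 u2]; split=> [|i|i j].
- by rewrite -(nbhs_singleton uv).
- by rewrite -(nbhs_singleton (near_eq_partial i uv)).
- by rewrite -(nbhs_singleton (near_eq_partial i (near_eq_partial j uv))).
Qed.

Lemma compact_bound (K : set 'rV[R]_2) u : compact K ->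
  (forall p, K p -> {for p, continuous u}) ->
  exists2 M : R, 0 <= M & forall p, K p -> `|u p| <= M.
Proof.
move=> cK cu.
have [->|/set0P K0] := eqVneq K set0; first by exists 0.
have cn : {within K, continuous (fun p => `|u p|)}.
  apply: continuous_in_subspaceT => p /set_mem Kp.
  exact: (continuous_comp (cu p Kp) (@norm_continuous _ _ (u p))).
have [c Kc Hc] := compact_EVT_max K0 cK cn.
exists `|u c| => // p Kp; apply: Hc; exact: mem_set.
Qed.

(** The two-jet has seven entries, each bounded on K by continuity. *)
Lemma compact_jet_le (K : set 'rV[R]_2) u : compact K ->
  (forall p, K p -> smooth_at u p) ->
  exists2 M : R, 0 <= M & forall p, K p -> jet_le u M p.
Proof.
move=> cK su.
have B v : (forall p, K p -> smooth_at v p) ->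
    exists2 M : R, 0 <= M & forall p, K p -> `|v p| <= M.
  by move=> sv; apply: compact_bound => // p Kp; apply: smooth_continuous; exact: sv.
have [M0 M00 H0] := B _ su.
have s1 i p : K p -> smooth_at (partial i u) p by move=> Kp; apply/smooth_at_partial/su.
have s2 i j p : K p -> smooth_at (partial i (partial j u)) p.
  by move=> Kp; apply/smooth_at_partial/s1.
have [M1 M10 H1] := B _ (s1 0); have [M2 M20 H2] := B _ (s1 1).
have [M3 M30 H3] := B _ (s2 0 0); have [M4 M40 H4] := B _ (s2 0 1).
have [M5 M50 H5] := B _ (s2 1 0); have [M6 M60 H6] := B _ (s2 1 1).
exists (M0 + M1 + M2 + M3 + M4 + M5 + M6); first by rewrite !addr_ge0.
move=> p Kp; split=> [|i|i j].
- by have := H0 p Kp; lra.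
- case: (rV2_ord i) => ->; first by have := H1 p Kp; lra.
  by have := H2 p Kp; lra.
- case: (rV2_ord i) => ->; case: (rV2_ord j) => ->.
  + by have := H3 p Kp; lra.
  + by have := H4 p Kp; lra.
  + by have := H5 p Kp; lra.
  + by have := H6 p Kp; lra.
Qed.

End Jets.

(** * Affine normal form of a free germ *)

Section NormalForm.
Variable R : realType.
Implicit Types (u v : 'rV[R]_2 -> R) (p q : 'rV[R]_2) (i j : 'I_2).
Implicit Types (f g F : 'rV[R]_2 -> 'rV[R]_5) (l : 'rV[R]_5).

Notation e_ i := (delta_mx 0 i : 'rV[R]_2).
Notation i0 := (@o5 0 isT).
Notation i1 := (@o5 1 isT).
Notation i2 := (@o5 2 isT).
Notation i3 := (@o5 3 isT).
Notation i4 := (@o5 4 isT).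

Lemma vpartial_row5 i (a b c d e : 'rV[R]_2 -> R) p :
  vpartial i (fun q => row5 (a q) (b q) (c q) (d q) (e q)) p =
  row5 (partial i a p) (partial i b p) (partial i c p) (partial i d p)
    (partial i e p).
Proof.
apply/rowP => k; rewrite [LHS]mxE [RHS]mxE.
by elim/ord5_ind: k;
  apply: (congr1 (fun h => partial i h p)); apply/funext => q; rewrite mxE.
Qed.

Lemma partial_coord i j p : partial i (fun q : 'rV[R]_2 => q 0 j) p = (i == j)%:R.
Proof.
have [_] := is_derive_coord p j (e_ i); rewrite /partial => ->.
by rewrite mxE eqxx /= eq_sym.
Qed.

(** The model of a free germ: it parametrizes a Veronese surface. Its last three
    coordinates, |z|^2 and z^2 for z = x + iy, split the quadratic forms into
    rotation invariant parts, in the pattern C + R + C of the neck. *)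
Definition veronese q : 'rV[R]_5 :=
  row5 (q 0 0) (q 0 1) (q 0 0 * q 0 0 + q 0 1 * q 0 1)
       (q 0 0 * q 0 0 - q 0 1 * q 0 1) (2 * (q 0 0 * q 0 1)).

Lemma smooth_veronese p : smooth5_at veronese p.
Proof.
have s0 := @smooth_coord R p 0; have s1 := @smooth_coord R p 1.
apply: smooth_row5 => //.
- by apply: smoothD; exact: smoothM.
- by apply: smoothB; exact: smoothM.
- by apply: smoothM; [exact: smooth_cst|exact: smoothM].
Qed.

Lemma is_derive_quadratic i j k p :
  is_derive p (e_ i) (fun q : 'rV[R]_2 => q 0 j * q 0 k)
    (p 0 j * (i == k)%:R + p 0 k * (i == j)%:R).
Proof.
have dj := is_derive_coord p j (e_ i); have dk := is_derive_coord p k (e_ i).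
apply: (is_derive_eq (is_deriveM dj dk)).
by rewrite !mxE !eqxx /= ![k == _]eq_sym ![j == _]eq_sym.
Qed.

Lemma vpartial_veronese i p : vpartial i veronese p =
  row5 (i == 0)%:R (i == 1)%:R
    (2 * (p 0 0 * (i == 0)%:R + p 0 1 * (i == 1)%:R))
    (2 * (p 0 0 * (i == 0)%:R + p 0 1 * - (i == 1)%:R))
    (2 * (p 0 0 * (i == 1)%:R + p 0 1 * (i == 0)%:R)).
Proof.
rewrite vpartial_row5 !partial_coord /partial.
have d00 := is_derive_quadratic i 0 0 p; have d11 := is_derive_quadratic i 1 1 p.
have d01 := is_derive_quadratic i 0 1 p.
have [_ E2] := is_deriveD d00 d11; have [_ E3] := is_deriveB d00 d11.
have [_ E4] := @is_deriveZ _ _ _ _ 2 _ _ _ d01.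
congr row5.
- by rewrite [LHS]E2; ring.
- by rewrite [LHS]E3; ring.
- by rewrite [LHS]E4.
Qed.

Lemma vpartial2_veronese i j p : vpartial j (vpartial i veronese) p =
  row5 0 0
    (2 * ((j == 0)%:R * (i == 0)%:R + (j == 1)%:R * (i == 1)%:R))
    (2 * ((j == 0)%:R * (i == 0)%:R + (j == 1)%:R * - (i == 1)%:R))
    (2 * ((j == 0)%:R * (i == 1)%:R + (j == 1)%:R * (i == 0)%:R)).
Proof.
rewrite (funext (vpartial_veronese i)) vpartial_row5 !partial_const.
have lin (a b : R) : partial j (fun q => 2 * (q 0 0 * a + q 0 1 * b)) p =
    2 * ((j == 0)%:R * a + (j == 1)%:R * b).
  have d (k : 'I_2) (c : R) : is_derive p (e_ j) (fun q : 'rV[R]_2 => q 0 k * c)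
      ((j == k)%:R * c).
    have dk := is_derive_coord p k (e_ j).
    have dc := is_derive_cst c p (e_ j).
    apply: (is_derive_eq (is_deriveM dk dc)).
    by rewrite /GRing.scale/= mulr0 add0r !mxE eqxx /= [k == _]eq_sym mulrC.
  have [_ E] := @is_deriveZ _ _ _ _ 2 _ _ _ (is_deriveD (d 0 a) (d 1 b)).
  exact: E.
by rewrite !lin.
Qed.

Lemma flat2_sub u v (c : R) p : smooth_at u p -> smooth_at v p ->
  (forall i, partial i u p = partial i v p) ->
  (forall i j, partial i (partial j u) p = partial i (partial j v) p) ->
  flat2 (fun q => u q + (c + -1 * v q)) p.
Proof.
move=> su sv E1 E2.
have sc a := @smooth_cst R a p.
have sm : smooth_at (fun q => -1 * v q) p by exact: smoothM.
have sd : smooth_at (fun q => c + -1 * v q) p by exact: smoothD.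
split=> [i|i j].
- rewrite (partialD i su sd) (partialD i (sc c) sm) (partialM i (sc (-1)) sv).
  rewrite (partial_const c p i) (partial_const (-1) p i) E1.
  by rewrite mulr0 addr0 add0r mulN1r subrr.
- rewrite (partial2D i j su sd) (partial2D i j (sc c) sm) (partial2M i j (sc (-1)) sv).
  rewrite (partial2_const c p i j) (partial2_const (-1) p i j) E2.
  rewrite (partial_const (-1) p i) (partial_const (-1) p j).
  by rewrite !mulr0 mul0r !addr0 add0r mulN1r subrr.
Qed.

Lemma unitmx_of_left_kernel n (A : 'M[R]_n) :
  (forall v : 'rV[R]_n, v *m A = 0 -> v = 0) -> A \in unitmx.
Proof.
move=> H; rewrite -row_free_unit -kermx_eq0; apply/eqP/row_matrixP => k.
rewrite row0; apply: H.
by rewrite -row_mul mulmx_ker row0.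
Qed.

Lemma vpartialC i j f p : smooth5_at f p ->
  vpartial i (vpartial j f) p = vpartial j (vpartial i f) p.
Proof.
move=> sf; apply/rowP => k; rewrite [LHS]mxE [RHS]mxE.
have E (a : 'I_2) : (fun r => vpartial a f r 0 k) = partial a (fun q => f q 0 k).
  by apply/funext => q; rewrite mxE.
by rewrite !E; exact: (partialC i j (sf k)).
Qed.

(** Its rows are the Taylor coefficients of F at the origin with respect to the
    five coordinates of the model map: x^2 is half the sum of x^2 + y^2 and
    x^2 - y^2, whence the quarters. Thus F - F 0 is [veronese] times this matrix
    up to third order. *)
Definition jet_matrix F : 'M[R]_5 := \matrix_(a, b) nth 0
  [:: vpartial 0 F 0 0 b; vpartial 1 F 0 0 b;
      (vpartial 0 (vpartial 0 F) 0 0 b + vpartial 1 (vpartial 1 F) 0 0 b) / 4;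
      (vpartial 0 (vpartial 0 F) 0 0 b - vpartial 1 (vpartial 1 F) 0 0 b) / 4;
      vpartial 0 (vpartial 1 F) 0 0 b / 2] a.

Lemma jet_matrixE F (b : 'I_5) :
  [/\ jet_matrix F i0 b = vpartial 0 F 0 0 b, jet_matrix F i1 b = vpartial 1 F 0 0 b,
      2 * (jet_matrix F i2 b + jet_matrix F i3 b) = vpartial 0 (vpartial 0 F) 0 0 b,
      2 * (jet_matrix F i2 b - jet_matrix F i3 b) = vpartial 1 (vpartial 1 F) 0 0 b &
      2 * jet_matrix F i4 b = vpartial 0 (vpartial 1 F) 0 0 b].
Proof.
have E a : jet_matrix F a b = nth 0
  [:: vpartial 0 F 0 0 b; vpartial 1 F 0 0 b;
      (vpartial 0 (vpartial 0 F) 0 0 b + vpartial 1 (vpartial 1 F) 0 0 b) / 4;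
      (vpartial 0 (vpartial 0 F) 0 0 b - vpartial 1 (vpartial 1 F) 0 0 b) / 4;
      vpartial 0 (vpartial 1 F) 0 0 b / 2] a by rewrite mxE.
rewrite (E i0) (E i1) (E i2) (E i3) (E i4) {E}.
have h2 (x y : R) : 2 * ((x + y) / 4 + (x - y) / 4) = x by field.
have h3 (x y : R) : 2 * ((x + y) / 4 - (x - y) / 4) = y by field.
have h4 (x : R) : 2 * (x / 2) = x by field.
by split; [exact: erefl|exact: erefl|exact: h2|exact: h3|exact: h4].
Qed.

Lemma jet_matrix_unit F : smooth_free_at F 0 -> jet_matrix F \in unitmx.
Proof.
move=> [sF fF]; rewrite -unitmx_tr; apply: unitmx_of_left_kernel => l lL.
have L (a : 'I_5) : \sum_j l 0 j * jet_matrix F a j = 0.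
  transitivity ((l *m (jet_matrix F)^T) 0 a); last by rewrite lL mxE.
  by rewrite mxE; apply: eq_bigr => j _; rewrite [(_^T) _ _]mxE.
have alg0 (x y w : R) : y = w -> x * w = x * y by move=> ->.
have alg4 (x y w : R) : 2 * y = w -> x * w = 2 * (x * y) by move=> <-; ring.
have alg2 (x y z w : R) : 2 * (y + z) = w -> x * w = 2 * (x * y + x * z).
  by move=> <-; ring.
have alg3 (x y z w : R) : 2 * (y - z) = w -> x * w = 2 * (x * y - x * z).
  by move=> <-; ring.
have L0 : dotf l (vpartial 0 F) 0 = 0.
  rewrite -(L i0); apply: eq_bigr => j _; have [H _ _ _ _] := jet_matrixE F j.
  exact: alg0 H.
have L1 : dotf l (vpartial 1 F) 0 = 0.
  rewrite -(L i1); apply: eq_bigr => j _; have [_ H _ _ _] := jet_matrixE F j.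
  exact: alg0 H.
have L4 : dotf l (vpartial 0 (vpartial 1 F)) 0 = 0.
  transitivity (2 * \sum_j l 0 j * jet_matrix F i4 j); last by rewrite L mulr0.
  rewrite mulr_sumr; apply: eq_bigr => j _; have [_ _ _ _ H] := jet_matrixE F j.
  exact: alg4 H.
have L2 : dotf l (vpartial 0 (vpartial 0 F)) 0 = 0.
  transitivity (2 * (\sum_j l 0 j * jet_matrix F i2 j + \sum_j l 0 j * jet_matrix F i3 j)).
    rewrite -big_split mulr_sumr; apply: eq_bigr => j _.
    by have [_ _ H _ _] := jet_matrixE F j; exact: alg2 H.
  by rewrite !L addr0 mulr0.
have L3 : dotf l (vpartial 1 (vpartial 1 F)) 0 = 0.
  transitivity (2 * (\sum_j l 0 j * jet_matrix F i2 j - \sum_j l 0 j * jet_matrix F i3 j)).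
    rewrite -sumrB mulr_sumr; apply: eq_bigr => j _.
    by have [_ _ _ H _] := jet_matrixE F j; exact: alg3 H.
  by rewrite !L subr0 mulr0.
apply: fF; split=> [i|i j].
  by rewrite (partial_dotf l i sF); case: (rV2_ord i) => ->; [exact: L0|exact: L1].
rewrite (partial2_dotf l j i sF).
case: (rV2_ord i) => ->; case: (rV2_ord j) => ->.
- exact: L2.
- exact: L4.
- apply: etrans L4; apply: eq_bigr => k _.
  have C := vpartialC 1 0 sF.
  exact: (congr1 (fun v : 'rV[R]_5 => l 0 k * v 0 k) C).
- exact: L3.
Qed.

Lemma mulmx_dotf (A : 'M[R]_5) g q (j : 'I_5) :
  dotf (\row_k A k j) g q = (g q *m A) 0 j.
Proof. by rewrite mxE; apply: eq_bigr => k _; rewrite mxE mulrC. Qed.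

(** Multiplication by the inverse of the Taylor matrix, after a translation. *)
Lemma normal_form F : smooth_free_at F 0 ->
  exists (A : 'M[R]_5) (a : 'rV[R]_5), A \in unitmx /\
  forall j : 'I_5, (F 0 *m A + a) 0 j - veronese 0 0 j = 0 /\
    flat2 (fun q => (F q *m A + a) 0 j - veronese q 0 j) 0.
Proof.
move=> sfF; have uL := jet_matrix_unit sfF; have [sF _] := sfF.
set L := jet_matrix F in uL.
exists (invmx L), (- (F 0 *m invmx L)); split; first by rewrite unitmx_inv.
move=> j.
have V0 : veronese 0 = 0.
  by apply/rowP; elim/ord5_ind; rewrite !mxE /= ?mulr0 ?addr0 ?subr0.
split; first by rewrite V0 subrr !mxE subr0.
set c := (- (F 0 *m invmx L)) 0 j.
have E : (fun q => (F q *m invmx L - F 0 *m invmx L) 0 j - veronese q 0 j) =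
    (fun q => dotf (\row_k invmx L k j) F q + (c + -1 * veronese q 0 j)).
  by apply/funext => q; rewrite mulmx_dotf mulN1r addrA [in LHS]mxE.
have LA (a : 'I_5) : (row a L *m invmx L) 0 j = (a == j)%:R.
  by rewrite -row_mul mulmxV// !mxE.
have aE (v w : 'rV[R]_5) (b : 'I_5) : (2 *: (v + w)) 0 b = 2 * (v 0 b + w 0 b).
  by rewrite !mxE.
have bE (v w : 'rV[R]_5) (b : 'I_5) : (2 *: (v - w)) 0 b = 2 * (v 0 b - w 0 b).
  by rewrite !mxE.
have rowE0 (a b : 'I_5) : row a L 0 b = L a b by rewrite mxE.
have rL (a : 'I_5) (v : 'rV[R]_5) : (forall b, v 0 b = L a b) -> v = row a L.
  by move=> H; apply/rowP => b; apply: (etrans (H b)); rewrite rowE0.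
have R0 : vpartial 0 F 0 = row i0 L.
  by apply: rL => b; have [H _ _ _ _] := jet_matrixE F b; exact: esym H.
have R1 : vpartial 1 F 0 = row i1 L.
  by apply: rL => b; have [_ H _ _ _] := jet_matrixE F b; exact: esym H.
have R2 : vpartial 0 (vpartial 0 F) 0 = 2 *: (row i2 L + row i3 L).
  apply/rowP => b; have [_ _ H _ _] := jet_matrixE F b.
  by apply: (etrans (esym H)); rewrite aE !rowE0.
have R3 : vpartial 1 (vpartial 1 F) 0 = 2 *: (row i2 L - row i3 L).
  apply/rowP => b; have [_ _ _ H _] := jet_matrixE F b.
  by apply: (etrans (esym H)); rewrite bE !rowE0.
have R4 : vpartial 0 (vpartial 1 F) 0 = 2 *: row i4 L.
  apply/rowP => b; have [_ _ _ _ H] := jet_matrixE F b.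
  by apply: (etrans (esym H)); rewrite [RHS]mxE rowE0.
rewrite E; apply: flat2_sub.
- exact: smooth_dotf.
- exact: smooth_veronese.
- move=> i; rewrite (partial_dotf _ i sF) mulmx_dotf.
  transitivity (vpartial i veronese 0 0 j); last by rewrite mxE.
  rewrite vpartial_veronese.
  have z (k : 'I_2) : (0 : 'rV[R]_2) 0 k = 0 by rewrite mxE.
  rewrite !z.
  case: (rV2_ord i) => ->; rewrite ?R0 ?R1 LA [RHS]mxE;
    by elim/ord5_ind: j {c E LA} => /=; ring.
- move=> i k; rewrite (partial2_dotf _ k i sF) mulmx_dotf.
  transitivity (vpartial i (vpartial k veronese) 0 0 j); last first.
    rewrite [LHS]mxE; apply: (congr1 (fun h => partial i h 0)).
    by apply/funext => q; rewrite mxE.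
  rewrite vpartial2_veronese.
  have T : (vpartial i (vpartial k F) 0 *m invmx L) 0 j =
     2 * (((i == 0)%:R * (k == 0)%:R + (i == 1)%:R * (k == 1)%:R) * (i2 == j)%:R) +
     2 * (((i == 0)%:R * (k == 0)%:R - (i == 1)%:R * (k == 1)%:R) * (i3 == j)%:R) +
     2 * (((i == 0)%:R * (k == 1)%:R + (i == 1)%:R * (k == 0)%:R) * (i4 == j)%:R).
    have mulE (x y : R) (v w : 'rV[R]_5) :
        ((2 *: (x *: v + y *: w)) *m invmx L) 0 j =
        2 * (x * (v *m invmx L) 0 j + y * (w *m invmx L) 0 j).
      by rewrite -scalemxAl mulmxDl -!scalemxAl !mxE.
    case: (rV2_ord i) => ->; case: (rV2_ord k) => -> /=.
    + by rewrite R2 -[row i2 L]scale1r -[row i3 L]scale1r mulE !LA; ring.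
    + by rewrite R4 -scalemxAl mxE LA; ring.
    + by rewrite (vpartialC _ _ sF) R4 -scalemxAl mxE LA; ring.
    + by rewrite R3 -[row i2 L]scale1r -scaleN1r mulE !LA; ring.
  rewrite T mxE.
  by elim/ord5_ind: j {c E LA T} => /=; ring.
Qed.

End NormalForm.

(** * Rescaling the remainder of the normal form *)

Section SmallRemainder.
Variable R : realType.
Implicit Types (u v : 'rV[R]_2 -> R) (p q : 'rV[R]_2) (i j : 'I_2).
Implicit Types (f g F : 'rV[R]_2 -> 'rV[R]_5) (l : 'rV[R]_5).

Notation e_ i := (delta_mx 0 i : 'rV[R]_2).
Notation i0 := (@o5 0 isT).
Notation i1 := (@o5 1 isT).
Notation i2 := (@o5 2 isT).
Notation i3 := (@o5 3 isT).
Notation i4 := (@o5 4 isT).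

Lemma rV2_norm_le (v : 'rV[R]_2) (N : R) : `|v 0 0| <= N -> `|v 0 1| <= N ->
  `|v| <= N.
Proof.
move=> v0 v1; have N0 : 0 <= N by apply: le_trans v0.
apply/ler_addgt0Pr => e e0; apply: ltW.
by apply: rV2_norm_lt; [apply: le_lt_trans v0 _|apply: le_lt_trans v1 _];
  rewrite ltrDl.
Qed.

Lemma mean_value_bound u q (M : R) :
  (forall r, `|r| <= `|q| -> forall i, derivable u r (e_ i) /\ `|partial i u r| <= M) ->
  `|u q - u 0| <= 2 * (M * `|q|).
Proof.
move=> H.
have nle (s t : R) : `|s| <= `|q 0 0| -> `|t| <= `|q 0 1| ->
    `|s *: e_ 0 + t *: e_ 1| <= `|q|.
  move=> sq tq; apply: rV2_norm_le; rewrite !mxE /= ?mulr1 ?mulr0 ?addr0 ?add0r.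
    exact: le_trans (rV2_coord_le q 0).
  exact: le_trans (rV2_coord_le q 1).
have [s sh E0] : exists2 s : R, `|s| <= `|q 0 0| &
    u (0 + q 0 0 *: e_ 0) - u 0 = q 0 0 * partial 0 u (0 + s *: e_ 0).
  apply: MVT_dir => s sh.
  have [] := H (s *: e_ 0 + 0 *: e_ 1) (nle s 0 sh _) 0; first by rewrite normr0.
  by rewrite scale0r addr0 add0r.
have [t th E1] : exists2 t : R, `|t| <= `|q 0 1| &
    u (q 0 0 *: e_ 0 + q 0 1 *: e_ 1) - u (q 0 0 *: e_ 0) =
    q 0 1 * partial 1 u (q 0 0 *: e_ 0 + t *: e_ 1).
  by apply: MVT_dir => t th; have [] := H _ (nle _ t (lexx _) th) 1.
have B0 : `|partial 0 u (0 + s *: e_ 0)| <= M.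
  have [_] := H (s *: e_ 0 + 0 *: e_ 1) (nle s 0 sh ltac:(by rewrite normr0)) 0.
  by rewrite scale0r addr0 add0r.
have [_ B1] := H _ (nle _ t (lexx _) th) 1.
move: E0; rewrite !add0r in B0 * => E0.
rewrite -rV2E in E1.
have tri (a b c x y : R) : a - b = q 0 1 * x -> b - c = q 0 0 * y ->
    `|x| <= M -> `|y| <= M -> `|a - c| <= 2 * (M * `|q|).
  move=> Ea Eb xM yM; have -> : a - c = q 0 1 * x + q 0 0 * y by rewrite -Ea -Eb; ring.
  have M0 : 0 <= M by apply: le_trans xM.
  have h1 : `|q 0 1 * x| <= M * `|q|.
    by rewrite normrM mulrC ler_pM// rV2_coord_le.
  have h0 : `|q 0 0 * y| <= M * `|q|.
    by rewrite normrM mulrC ler_pM// rV2_coord_le.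
  by apply: le_trans (ler_normD _ _) _; lra.
exact: tri E1 E0 B1 B0.
Qed.

Lemma near0_ball (P : set 'rV[R]_2) : (\forall q \near (0 : 'rV[R]_2), P q) ->
  exists2 d : R, 0 < d & forall q, `|q| < d -> P q.
Proof.
move=> /nbhs_ballP[d /= d0 dP]; exists d => // q qd; apply: dP.
by rewrite -ball_normE /= sub0r normrN.
Qed.

(** The second derivatives are continuous and vanish at the origin, so they are
    at most eta nearby; the mean value theorem, used twice, then bounds the
    first derivatives and the values. *)
Lemma flat2_small u : smooth_at u 0 -> u 0 = 0 -> flat2 u 0 ->
  forall eta : R, 0 < eta -> exists2 d : R, 0 < d & forall q, `|q| < d ->
    [/\ `|u q| <= 4 * (eta * `|q| ^+ 2),
        forall i, `|partial i u q| <= 2 * (eta * `|q|) &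
        forall i j, `|partial i (partial j u) q| <= eta].
Proof.
move=> su u0 [F1 F2] eta eta0.
have c2 i j : \forall q \near (0 : 'rV[R]_2), `|partial i (partial j u) q| <= eta.
  have c := smooth_continuous (smooth_at_partial i (smooth_at_partial j su)).
  move/cvgrPdist_le: c => /(_ eta eta0).
  by apply: filterS => q; rewrite F2 sub0r normrN.
have c00 := c2 0 0; have c01 := c2 0 1; have c10 := c2 1 0; have c11 := c2 1 1.
have n1 := smooth_near_Ck 1 su.
have n20 := smooth_near_Ck 1 (smooth_at_partial 0 su).
have n21 := smooth_near_Ck 1 (smooth_at_partial 1 su).
have /near0_ball[d d0 dP] : \forall q \near (0 : 'rV[R]_2),
    (Ck_at 1 u q /\ (Ck_at 1 (partial 0 u) q /\ Ck_at 1 (partial 1 u) q)) /\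
    ((`|partial 0 (partial 0 u) q| <= eta /\ `|partial 0 (partial 1 u) q| <= eta) /\
     (`|partial 1 (partial 0 u) q| <= eta /\ `|partial 1 (partial 1 u) q| <= eta)).
  near=> q; split; split.
  - exact: (near n1 q).
  - split; [exact: (near n20 q)|exact: (near n21 q)].
  - split; [exact: (near c00 q)|exact: (near c01 q)].
  - split; [exact: (near c10 q)|exact: (near c11 q)].
exists d => // q qd.
have D2 r : `|r| <= `|q| -> forall i j,
    derivable (partial j u) r (e_ i) /\ `|partial i (partial j u) r| <= eta.
  move=> rq i j; have [[a [b c]] [[x00 x01] [x10 x11]]] := dP r (le_lt_trans rq qd).
  split.
    case: (rV2_ord j) => ->.
      exact: nbhs_singleton (Ck_at_derivable i b).
    exact: nbhs_singleton (Ck_at_derivable i c).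
  case: (rV2_ord i) => ->; case: (rV2_ord j) => ->.
  - exact: x00.
  - exact: x01.
  - exact: x10.
  - exact: x11.
have D1 r j : `|r| <= `|q| -> `|partial j u r| <= 2 * (eta * `|r|).
  move=> rq; have := @mean_value_bound (partial j u) r eta.
  by rewrite F1 subr0; apply=> w wr i; apply: D2; exact: le_trans rq.
split.
- have := @mean_value_bound u q (2 * (eta * `|q|)); rewrite u0 subr0 => H.
  rewrite (_ : 4 * _ = 2 * (2 * (eta * `|q|) * `|q|)); last by rewrite expr2; ring.
  apply: H => r rq i; split.
    have [[a _] _] := dP r (le_lt_trans rq qd).
    exact: nbhs_singleton (Ck_at_derivable i a).
  apply: le_trans (D1 r i rq) _.
  by rewrite ler_pM2l// ler_pM2l.
- by move=> i; exact: D1.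
- by move=> i j; have [] := D2 q (lexx _) i j.
Unshelve. all: by end_near. Qed.

Definition dilation (k : R) q : 'rV[R]_2 := k *: q.

Lemma dilationE k q j : dilation k q 0 j = k * q 0 j.
Proof. by rewrite mxE. Qed.

Lemma smooth_dilation k p : smooth_map_at (dilation k) p.
Proof.
move=> j; under [fun _ => _]eq_fun do rewrite dilationE.
by apply: smoothM; [exact: smooth_cst|exact: smooth_coord].
Qed.

Lemma partial_dilation k p i j :
  partial i (fun q => dilation k q 0 j) p = k * (i == j)%:R.
Proof.
have -> : (fun q => dilation k q 0 j) = fun q => k * q 0 j.
  by apply/funext => q; rewrite dilationE.
rewrite (partialM i (smooth_cst k p) (smooth_coord p j)) partial_coord.
by rewrite (partial_const k p i) mulr0 addr0.
Qed.

Lemma partial2_dilation k p i j a :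
  partial a (partial i (fun q => dilation k q 0 j)) p = 0.
Proof.
have -> : partial i (fun q => dilation k q 0 j) = fun=> k * (i == j)%:R.
  by apply/funext => q; exact: partial_dilation.
exact: partial_const.
Qed.

Lemma partial_comp_dilation u k p i : smooth_at u (dilation k p) ->
  partial i (u \o dilation k) p = k * partial i u (dilation k p).
Proof.
move=> su; rewrite (partial_comp i (smooth_dilation k p) su) !partial_dilation.
have alg (x y a b c : R) : a = 1 -> b = 0 -> c = x -> x * (k * a) + y * (k * b) = k * c.
  by move=> -> -> ->; ring.
have alg' (x y a b c : R) : a = 0 -> b = 1 -> c = y -> x * (k * a) + y * (k * b) = k * c.
  by move=> -> -> ->; ring.
by case: (rV2_ord i) => ->; [exact: alg|exact: alg'].
Qed.

Lemma partial2_comp_dilation u k p i j : smooth_at u (dilation k p) ->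
  partial j (partial i (u \o dilation k)) p =
  k * (k * partial j (partial i u) (dilation k p)).
Proof.
move=> su; rewrite (partial2_comp i j (smooth_dilation k p) su).
rewrite (partial_dilation k p i 0) (partial_dilation k p i 1).
rewrite (partial_dilation k p j 0) (partial_dilation k p j 1).
rewrite (partial2_dilation k p i 0 j) (partial2_dilation k p i 1 j).
move: (partial 0 u (dilation k p)) (partial 1 u (dilation k p)) => x y.
have alg (a b c d a1 a2 b1 b2 z : R) :
   k * (k * ((a * a1 + b * a2) * b1 + (c * a1 + d * a2) * b2)) = k * (k * z) ->
  (a * (k * a1) + b * (k * a2)) * (k * b1) + (c * (k * a1) + d * (k * a2)) * (k * b2) +
  (x * 0 + y * 0) = k * (k * z).
  by move=> <-; ring.
apply: alg; congr (_ * (_ * _)).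
have a00 (a b c d z : R) : z = a -> (a * 1 + b * 0) * 1 + (c * 1 + d * 0) * 0 = z.
  by move=> ->; ring.
have a10 (a b c d z : R) : z = b -> (a * 0 + b * 1) * 1 + (c * 0 + d * 1) * 0 = z.
  by move=> ->; ring.
have a01 (a b c d z : R) : z = c -> (a * 1 + b * 0) * 0 + (c * 1 + d * 0) * 1 = z.
  by move=> ->; ring.
have a11 (a b c d z : R) : z = d -> (a * 0 + b * 1) * 0 + (c * 0 + d * 1) * 1 = z.
  by move=> ->; ring.
by case: (rV2_ord i) => ->; case: (rV2_ord j) => ->;
  [exact: a00|exact: a10|exact: a01|exact: a11].
Qed.

(** Each derivative of the zoomed function brings a factor k, so that all entries
    of the two-jet are of order eta k^2. Later the weights, at most 1/k^2,
    remove k. *)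
Lemma jet_le_dilation u (eta d k : R) p :
  (forall q, `|q| < d ->
    [/\ `|u q| <= 4 * (eta * `|q| ^+ 2),
        forall i, `|partial i u q| <= 2 * (eta * `|q|) &
        forall i j, `|partial i (partial j u) q| <= eta]) ->
  0 <= eta -> 0 < k -> `|p| <= 2 -> 2 * k < d ->
  smooth_at u (dilation k p) ->
  jet_le (u \o dilation k) (16 * eta * k ^+ 2) p.
Proof.
move=> H eta0 k0 p2 kd su.
have nk : `|dilation k p| = k * `|p| by rewrite normrZ gtr0_norm.
have k2 : 0 <= eta * k ^+ 2 by rewrite mulr_ge0// sqr_ge0.
have [|h0 h1 h2] := H (dilation k p).
  rewrite nk; apply: le_lt_trans kd; rewrite mulrC.
  by rewrite ler_pM2r.
have p0 : 0 <= `|p| by exact: normr_ge0.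
have m1 : eta * k ^+ 2 * `|p| <= eta * k ^+ 2 * 2 by rewrite ler_wpM2l.
have m2 : eta * k ^+ 2 * `|p| ^+ 2 <= eta * k ^+ 2 * 4.
  rewrite ler_wpM2l// (_ : 4 = 2 * 2); last by ring.
  by rewrite expr2 ler_pM.
split=> [|i|i j].
- apply: (le_trans h0); rewrite nk exprMn.
  rewrite (_ : 4 * _ = 4 * (eta * k ^+ 2 * `|p| ^+ 2)); last by ring.
  by lra.
- rewrite (partial_comp_dilation i su) normrM (gtr0_norm k0).
  apply: (@le_trans _ _ (k * (2 * (eta * (k * `|p|))))).
    by rewrite ler_pM2l// -nk; exact: h1.
  rewrite (_ : k * _ = 2 * (eta * k ^+ 2 * `|p|)); last by ring.
  by lra.
- rewrite (partial2_comp_dilation j i su) !normrM (gtr0_norm k0).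
  apply: (@le_trans _ _ (k * (k * eta))).
    by rewrite ler_pM2l// ler_pM2l//; exact: h2.
  by rewrite (_ : k * (k * eta) = eta * k ^+ 2); [lra|ring].
Qed.

End SmallRemainder.

(** * Stability of the model map and closeness of the tube to it *)

Section VeronesePerturbation.
Variable R : realType.
Implicit Types (u v : 'rV[R]_2 -> R) (p q : 'rV[R]_2) (i : 'I_2) (k : R).
Implicit Types (f g F : 'rV[R]_2 -> 'rV[R]_5) (l : 'rV[R]_5).

Notation i0 := (@o5 0 isT).
Notation i1 := (@o5 1 isT).
Notation i2 := (@o5 2 isT).
Notation i3 := (@o5 3 isT).
Notation i4 := (@o5 4 isT).

(** Here s is the size of the error committed by a perturbation in each of the
    five derivatives of the linear form (l0, ..., l4) composed with
    [veronese] at (x, y). Solving the triangular system bounds l2, l3, l4 by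
    s / 2 and l0, l1 by 5 s, so that the sum of all is at most 23/2 s,
    less than 12 s unless s = 0. *)
Lemma near_veronese_eq0 (x y l0 l1 l2 l3 l4 s : R) : `|x| <= 2 -> `|y| <= 2 ->
  `|l0| + `|l1| + `|l2| + `|l3| + `|l4| = 12 * s ->
  `|l0 + 2 * x * (l2 + l3) + 2 * y * l4| <= s ->
  `|l1 + 2 * y * (l2 - l3) + 2 * x * l4| <= s ->
  `|2 * (l2 + l3)| <= s -> `|2 * (l2 - l3)| <= s -> `|2 * l4| <= s ->
  s = 0.
Proof.
move=> x2 y2 S E0 E1 E2 E3 E4.
have s0 : 0 <= s by apply: le_trans E4.
have pr (a b : R) : `|a| <= 2 -> `|2 * b| <= s -> `|2 * a * b| <= 2 * s.
  move=> a2 bs; rewrite (_ : 2 * a * b = a * (2 * b)); last by ring.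
  by rewrite normrM ler_pM.
have p1 := pr _ _ x2 E2; have p2 := pr _ _ y2 E4.
have p3 := pr _ _ y2 E3; have p4 := pr _ _ x2 E4.
move: (2 * x * (l2 + l3)) (2 * y * l4) (2 * y * (l2 - l3)) (2 * x * l4)
  p1 p2 p3 p4 E0 E1 => A B C D.
rewrite !ler_norml => /andP[? ?] /andP[? ?] /andP[? ?] /andP[? ?] /andP[? ?] /andP[? ?].
move: E2 E3 E4; rewrite !ler_norml => /andP[? ?] /andP[? ?] /andP[? ?].
have a0 : `|l0| <= 5 * s by rewrite ler_norml; apply/andP; split; lra.
have a1 : `|l1| <= 5 * s by rewrite ler_norml; apply/andP; split; lra.
have a2 : `|l2| <= s / 2 by rewrite ler_norml; apply/andP; split; lra.
have a3 : `|l3| <= s / 2 by rewrite ler_norml; apply/andP; split; lra.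
have a4 : `|l4| <= s / 2 by rewrite ler_norml; apply/andP; split; lra.
by lra.
Qed.

(** If a form l composed with the perturbed map is flat, then the derivatives of
    l o veronese are those of -l o Er, of size at most the l1 norm of l divided
    by 12, and [near_veronese_eq0] applies. *)
Lemma free_veronese_perturb (Er : 'rV[R]_2 -> 'rV[R]_5) p : smooth5_at Er p ->
  `|p| <= 2 -> (forall j : 'I_5, jet_le (fun q => Er q 0 j) (1 / 12) p) ->
  free_at (fun q => veronese q + Er q) p.
Proof.
move=> sE p2 jE l F.
have sV := smooth_veronese p.
have dE : dotf l (fun q => veronese q + Er q) =
    fun q => dotf l (@veronese R) q + dotf l Er q.
  apply/funext => q; rewrite /dotf -big_split; apply: eq_bigr => j _.
  by rewrite mxE mulrDr.
rewrite dE in F; have [F1 F2] := F.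
pose S := `|l 0 i0| + `|l 0 i1| + `|l 0 i2| + `|l 0 i3| + `|l 0 i4|.
pose s := S / 12.
have bnd (v : 'rV[R]_5) : (forall j, `|v 0 j| <= 1 / 12) ->
    `|\sum_(j < 5) l 0 j * v 0 j| <= s.
  move=> vb; rewrite /s /S mulrC -div1r.
  rewrite -(@big_ord5 _ (fun j => `|l 0 j|)) mulr_sumr.
  apply: le_trans (ler_norm_sum _ _ _) _; apply: ler_sum => j _.
  by rewrite normrM [leLHS]mulrC; apply: ler_wpM2r.
have opp (a b : R) : a + b = 0 -> `|b| <= s -> `|a| <= s.
  by move=> /eqP; rewrite addr_eq0 => /eqP ->; rewrite normrN.
have sum0 (x a b a' b' : R) : x = 0 -> x = a + b -> a = a' -> b = b' -> a' + b' = 0.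
  by move=> -> -> <- <-.
have B1 i : `|dotf l (vpartial i (@veronese R)) p| <= s.
  apply: opp (_ : _ + dotf l (vpartial i Er) p = 0) _.
    apply: sum0 (F1 i) _ (partial_dotf l i sV) (partial_dotf l i sE).
    by apply: partialD; exact: smooth_dotf.
  by apply: bnd => j; rewrite mxE; have [_ + _] := jE j; apply.
have B2 i (k : 'I_2) : `|dotf l (vpartial i (vpartial k (@veronese R))) p| <= s.
  apply: opp (_ : _ + dotf l (vpartial i (vpartial k Er)) p = 0) _.
    apply: sum0 (F2 i k) _ (partial2_dotf l k i sV) (partial2_dotf l k i sE).
    by apply: partial2D; exact: smooth_dotf.
  apply: bnd => j; rewrite mxE; have [_ _ H] := jE j.
  have -> : (fun r => vpartial k Er r 0 j) = partial k (fun q => Er q 0 j).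
    by apply/funext => r; rewrite mxE.
  exact: H.
have Ed g q : dotf l g q = l 0 i0 * g q 0 i0 + l 0 i1 * g q 0 i1 + l 0 i2 * g q 0 i2
   + l 0 i3 * g q 0 i3 + l 0 i4 * g q 0 i4 by rewrite /dotf big_ord5.
have s0 : s = 0.
  apply: (@near_veronese_eq0 (p 0 0) (p 0 1) (l 0 i0) (l 0 i1) (l 0 i2) (l 0 i3)
    (l 0 i4)).
  - exact: le_trans (rV2_coord_le p 0) p2.
  - exact: le_trans (rV2_coord_le p 1) p2.
  - by rewrite /s /S; field.
  - have := B1 0; rewrite Ed vpartial_veronese !mxE /=.
    by congr (`|_| <= _); ring.
  - have := B1 1; rewrite Ed vpartial_veronese !mxE /=.
    by congr (`|_| <= _); ring.
  - have := B2 0 0; rewrite Ed vpartial2_veronese !mxE /=.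
    by congr (`|_| <= _); ring.
  - have := B2 1 1; rewrite Ed vpartial2_veronese !mxE /=.
    by congr (`|_| <= _); ring.
  - have := B2 0 1; rewrite Ed vpartial2_veronese !mxE /=.
    by congr (`|_| <= _); ring.
have S0 : S = 0 by move: s0; rewrite /s; lra.
have := S0; rewrite /S.
have := normr_ge0 (l 0 i0); have := normr_ge0 (l 0 i1); have := normr_ge0 (l 0 i2).
have := normr_ge0 (l 0 i3); have := normr_ge0 (l 0 i4).
move=> n4 n3 n2 n1 n0 Sz.
have z j : `|l 0 j| = 0 by elim/ord5_ind: j; lra.
by apply/rowP => j; rewrite mxE; apply/eqP; rewrite -normr_eq0 z.
Qed.

Lemma enorm_continuous : continuous (@enorm R).
Proof.
move=> p; apply: (@continuous_comp _ _ _ (fun v : 'rV[R]_2 => \sum_(i < 2) v 0 i ^+ 2)).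
  have H : smooth_at (fun v : 'rV[R]_2 => \sum_(i < 2) v 0 i ^+ 2) p.
    apply: (@smooth_sum _ _ (fun i q => q 0 i ^+ 2)) => i.
    by apply: smoothX; exact: smooth_coord.
  exact: smooth_continuous H.
exact: sqrt_continuous.
Qed.

Lemma norm_le_enorm p : `|p| <= enorm p.
Proof.
apply: rV2_norm_le; rewrite -(@ler_pXn2r _ 2) ?nnegrE ?enorm_ge0//;
  by rewrite enorm_sqr real_normK ?num_real// ?lerDl ?lerDr sqr_ge0.
Qed.

Lemma compact_shell (a b : R) : compact [set p : 'rV[R]_2 | a <= enorm p <= b].
Proof.
apply: bounded_closed_compact.
  exists b; split; first exact: num_real.
  move=> M bM p /= /andP[_ pb]; apply: le_trans (norm_le_enorm p) _.
  exact: le_trans (ltW bM).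
have -> : [set p : 'rV[R]_2 | a <= enorm p <= b] =
    @enorm R @^-1` `[a, b]%classic.
  by apply/seteqP; split=> p /=; rewrite in_itv.
apply: preimage_closed; first by move=> p _; exact: enorm_continuous.
exact: interval_closed.
Qed.

(** Bounds for combinations of three fixed functions that are uniform in the
    coefficients, so that the factor k in front controls the whole jet. *)
Lemma jet_le_combination (K : set 'rV[R]_2) (g1 g2 g3 : 'rV[R]_2 -> R) :
  compact K -> (forall p, K p -> [/\ smooth_at g1 p, smooth_at g2 p & smooth_at g3 p]) ->
  exists2 M : R, 0 <= M & forall (k c1 c2 c3 : R) p, 0 < k -> K p ->
    `|c1| <= 5 -> `|c2| <= 5 -> `|c3| <= 5 ->
    jet_le (fun q => k * (c1 * g1 q + (c2 * g2 q + c3 * g3 q))) (k * M) p.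
Proof.
move=> cK sg.
have [M1 M10 H1] : exists2 M : R, 0 <= M & forall p, K p -> jet_le g1 M p.
  by apply: compact_jet_le => // p /sg[].
have [M2 M20 H2] : exists2 M : R, 0 <= M & forall p, K p -> jet_le g2 M p.
  by apply: compact_jet_le => // p /sg[].
have [M3 M30 H3] : exists2 M : R, 0 <= M & forall p, K p -> jet_le g3 M p.
  by apply: compact_jet_le => // p /sg[].
exists (5 * M1 + (5 * M2 + 5 * M3)); first by rewrite !addr_ge0// mulr_ge0.
move=> k c1 c2 c3 p k0 Kp C1 C2 C3; have [s1 s2 s3] := sg p Kp.
have sM (c : R) u : smooth_at u p -> smooth_at (fun q => c * u q) p.
  by move=> ?; apply: smoothM => //; exact: smooth_cst.
have jM (c M : R) u : `|c| <= 5 -> 0 <= M -> smooth_at u p -> jet_le u M p ->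
    jet_le (fun q => c * u q) (5 * M) p.
  move=> c5 M0 sg' jg; apply: jet_le_trans (jet_leZ c sg' jg).
  by rewrite ler_wpM2r.
have S2 := sM c2 _ s2; have S3 := sM c3 _ s3; have S1 := sM c1 _ s1.
have J := jet_leD S1 (smoothD S2 S3) (jM _ _ _ C1 M10 s1 (H1 p Kp))
  (jet_leD S2 S3 (jM _ _ _ C2 M20 s2 (H2 p Kp)) (jM _ _ _ C3 M30 s3 (H3 p Kp))).
have := jet_leZ k (smoothD S1 (smoothD S2 S3)) J.
by rewrite (gtr0_norm k0).
Qed.

Lemma near_enorm_neq0 p : p != 0 -> \forall q \near p, enorm q != 0.
Proof.
move=> p0; apply: (@cvgr_neq0 _ _ _ (nbhs p) _ (@enorm R) (enorm p)).
  exact: enorm_continuous.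
by rewrite gt_eqF// enorm_gt0.
Qed.

Definition shell := [set p : 'rV[R]_2 | 1 <= enorm p <= 2].

Lemma shell_neq0 p : shell p -> p != 0.
Proof. by rewrite /shell /= -enorm_gt0 => /andP[p1 _]; exact: lt_le_trans p1. Qed.

(** Each coordinate of the difference is k times a combination of fixed functions,
    smooth away from the origin, whose coefficients are polynomials in k; they
    are at most 5 in absolute value when k <= 1. *)
Lemma neck_near_veronese : exists2 M : R, 0 <= M & forall k p (j : 'I_5),
  0 < k -> k <= 1 -> shell p ->
  jet_le (fun q => neck k q 0 j - veronese q 0 j) (k * M) p.
Proof.
pose r1 q := (@enorm R q)^-1; pose r2 q := (enorm q ^+ 2)^-1 : R.
pose r4 q := (enorm q ^+ 4)^-1 : R.
have cS : compact shell by exact: compact_shell.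
have S p : shell p -> [/\ smooth_at (@enorm R) p, smooth_at r1 p, smooth_at r2 p &
    smooth_at r4 p].
  move=> /shell_neq0 p0; have sr := smooth_enorm p0.
  have e0 : enorm p != 0 by rewrite gt_eqF// enorm_gt0.
  split => //; apply: smoothV => //; rewrite ?expf_neq0//; exact: smoothX.
have C j p := @smooth_coord R p j.
have [M0 M00 H0] : exists2 M : R, 0 <= M & forall (k c1 c2 c3 : R) p, 0 < k -> shell p ->
    `|c1| <= 5 -> `|c2| <= 5 -> `|c3| <= 5 ->
    jet_le (fun q => k * (c1 * (q 0 0 * r2 q) + (c2 * (q 0 0 * r1 q) + c3 * r1 q))) (k * M) p.
  apply: (@jet_le_combination shell (fun q => q 0 0 * r2 q) (fun q => q 0 0 * r1 q) r1) => //.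
  by move=> p /S[? ? ? ?]; split => //; apply: smoothM => //; exact: C.
have [M1 M10 H1] : exists2 M : R, 0 <= M & forall (k c1 c2 c3 : R) p, 0 < k -> shell p ->
    `|c1| <= 5 -> `|c2| <= 5 -> `|c3| <= 5 ->
    jet_le (fun q => k * (c1 * (q 0 1 * r2 q) + (c2 * (q 0 1 * r1 q) + c3 * r1 q))) (k * M) p.
  apply: (@jet_le_combination shell (fun q => q 0 1 * r2 q) (fun q => q 0 1 * r1 q) r1) => //.
  by move=> p /S[? ? ? ?]; split => //; apply: smoothM => //; exact: C.
have [M2 M20 H2] : exists2 M : R, 0 <= M & forall (k c1 c2 c3 : R) p, 0 < k -> shell p ->
    `|c1| <= 5 -> `|c2| <= 5 -> `|c3| <= 5 ->
    jet_le (fun q => k * (c1 * r2 q + (c2 * enorm q + c3 * r1 q))) (k * M) p.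
  by apply: (@jet_le_combination shell r2 (@enorm R) r1) => // p /S[].
pose g3 q : R := (q 0 0 ^+ 2 - q 0 1 ^+ 2) * r4 q.
pose g4 q : R := (2 * q 0 0 * q 0 1) * r4 q.
have [M3 M30 H3] : exists2 M : R, 0 <= M & forall (k c1 c2 c3 : R) p, 0 < k -> shell p ->
    `|c1| <= 5 -> `|c2| <= 5 -> `|c3| <= 5 ->
    jet_le (fun q => k * (c1 * g3 q + (c2 * g4 q + c3 * r1 q))) (k * M) p.
  apply: (@jet_le_combination shell g3 g4 r1) => // p /S[? ? ? ?].
  have := C 0 p; have := C 1 p => ? ?.
  split => //; apply: smoothM => //; first by apply: smoothB; exact: smoothX.
  by do 2?[apply: smoothM => //]; exact: smooth_cst.
exists (M0 + M1 + M2 + M3); first by rewrite !addr_ge0.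
move=> k p j k0 k1 Kp.
have pos n : 0 <= k ^+ n <= 1 by rewrite exprn_ge0 ?exprn_ile1// ltW.
have b5 (c : R) : - 5 <= c -> c <= 5 -> `|c| <= 5 by move=> *; rewrite ler_norml; apply/andP.
have /andP[q20 q21] := pos 2; have /andP[q30 q31] := pos 3.
have ck : `|k| <= 5 by apply: b5; lra.
have c0 : `|0 : R| <= 5 by apply: b5; lra.
have cN1 : `|-1 : R| <= 5 by apply: b5; lra.
have cN5 : `|-5 : R| <= 5 by apply: b5; lra.
have ck3 : `|k ^+ 3| <= 5 by apply: b5; lra.
have ckN3 : `|- k ^+ 3| <= 5 by apply: b5; lra.
have ckN2 : `|-5 * k ^+ 2| <= 5 by apply: b5; lra.
have nz : \forall q \near p, enorm q != 0 := near_enorm_neq0 (shell_neq0 Kp).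
have kle (M : R) : M <= M0 + M1 + M2 + M3 -> k * M <= k * (M0 + M1 + M2 + M3).
  by move=> ?; rewrite ler_pM2l.
elim/ord5_ind: j.
- apply: jet_le_trans (jet_le_eq _ (H0 k k (-1) 0 p k0 Kp ck cN1 c0)); first by apply: kle; lra.
  apply: filterS nz => q q0; rewrite !mxE /= /neck_b /r1 /r2.
  by field.
- apply: jet_le_trans (jet_le_eq _ (H1 k k (-1) 0 p k0 Kp ck cN1 c0)); first by apply: kle; lra.
  apply: filterS nz => q q0; rewrite !mxE /= /neck_b /r1 /r2.
  by field.
- apply: jet_le_trans (jet_le_eq _ (H2 k _ _ _ p k0 Kp ck3 cN5 ckN2)); first by apply: kle; lra.
  apply: filterS nz => q q0; rewrite !mxE /= /neck_c /r1 /r2 -!expr2 -enorm_sqr.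
  by field.
- apply: jet_le_trans (jet_le_eq _ (H3 k _ _ _ p k0 Kp ckN3 c0 c0)); first by apply: kle; lra.
  apply: filterS nz => q q0; rewrite !mxE /= /neck_d /g3 /r4.
  by field.
- apply: jet_le_trans (jet_le_eq _ (H3 k _ _ _ p k0 Kp c0 ckN3 c0)); first by apply: kle; lra.
  apply: filterS nz => q q0; rewrite !mxE /= /neck_d /g4 /r4.
  by field.
Qed.

End VeronesePerturbation.

(** * From a free disc to the end of the tube *)

Section EndPiece.
Variable R : realType.
Implicit Types (p q : 'rV[R]_2) (k : R) (F : 'rV[R]_2 -> 'rV[R]_5).

(** A function of |q|^2 rather than |q|, which makes it smooth at the origin; it
    passes from 0 to 1 while |q| goes from 1 to 2. *)
Definition cutoff q : R := step ((q 0 0 * q 0 0 + q 0 1 * q 0 1 - 1) / 3).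

Lemma cutoffE q : cutoff q = step ((enorm q ^+ 2 - 1) / 3).
Proof. by rewrite /cutoff enorm_sqr !expr2. Qed.

Lemma cutoff_inner q : enorm q <= 1 -> cutoff q = 0.
Proof.
move=> q1; rewrite cutoffE step_le0//.
have : enorm q ^+ 2 <= 1 by rewrite exprn_ile1// enorm_ge0.
by lra.
Qed.

Lemma cutoff_outer q : 2 <= enorm q -> cutoff q = 1.
Proof.
move=> q2; rewrite cutoffE step_ge1//.
have : 2 ^+ 2 <= enorm q ^+ 2 by rewrite ler_pXn2r ?nnegrE ?enorm_ge0.
by rewrite expr2; lra.
Qed.

Lemma smooth_cutoff p : smooth_at cutoff p.
Proof.
have C j := @smooth_coord R p j.
apply: smooth_step; apply: smoothM; last exact: smooth_cst.
by apply: smoothB; [apply: smoothD; exact: smoothM|exact: smooth_cst].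
Qed.

(** The inverse of the effect on [veronese] of the dilation by k. *)
Definition weight k : 'rV[R]_5 := row5 k^-1 k^-1 (k ^- 2) (k ^- 2) (k ^- 2).

Lemma weight_veronese k q (j : 'I_5) : k != 0 ->
  weight k 0 j * veronese (dilation k q) 0 j = veronese q 0 j.
Proof.
by move=> k0; elim/ord5_ind: j; rewrite !mxE /= ?dilationE; field.
Qed.

Lemma weight_le k (j : 'I_5) : 0 < k -> k <= 1 -> `|weight k 0 j| <= k ^- 2.
Proof.
move=> k0 k1.
have P : 0 < k ^- 2 by rewrite invr_gt0 exprn_gt0.
have Q : 0 < k^-1 by rewrite invr_gt0.
have : k^-1 <= k ^- 2.
  rewrite -exprVn expr2 -[leLHS]mulr1 ler_pM2l//.
  by rewrite -[1]invr1 lef_pV2 ?posrE.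
by elim/ord5_ind: j => H; rewrite mxE /= gtr0_norm.
Qed.

Lemma weight_neq0 k (j : 'I_5) : 0 < k -> weight k 0 j != 0.
Proof.
move=> k0.
have P : 0 < k ^- 2 by rewrite invr_gt0 exprn_gt0.
have Q : 0 < k^-1 by rewrite invr_gt0.
by elim/ord5_ind: j; rewrite mxE /= gt_eqF.
Qed.

Lemma diag_unit (w : 'rV[R]_5) : (forall j, w 0 j != 0) -> diag_mx w \in unitmx.
Proof.
move=> w0; rewrite unitmxE det_diag unitfE.
by apply/prodf_neq0 => j _; exact: w0.
Qed.

Lemma rowB_E (v w : 'rV[R]_5) (j : 'I_5) : (v - w) 0 j = v 0 j - w 0 j.
Proof. by rewrite !mxE. Qed.

Definition blend k F (A : 'M[R]_5) (a : 'rV[R]_5) q : 'rV[R]_5 :=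
  \row_j (cutoff q * (weight k 0 j * (F (dilation k q) *m A + a) 0 j) +
          (1 - cutoff q) * neck k q 0 j).

(** C, C' and M bound the two-jets of the cutoff, of its complement, and of
    (neck - veronese) / k. The two terms bound the two parts of the error of the
    blend; they are at most 64/1600 and 4/96, which together is less than the
    tolerance 1/12 of the model map. *)
Lemma blend_tolerance (C C' M k : R) : 0 <= C -> 0 <= C' -> 0 <= M -> 0 < k ->
  k <= 1 / (96 * ((C' + 1) * (M + 1))) ->
  4 * (C * (16 * (1 / (40 * (40 * (C + 1)))))) + 4 * (C' * (k * M)) <= 1 / 12.
Proof.
move=> C0 C'0 M0 k0 kle.
have c1 : C * (1 / (40 * (40 * (C + 1)))) <= 1 / 40 / 40.
  have pC : 0 < C + 1 by lra.
  have -> : C * (1 / (40 * (40 * (C + 1)))) = C / (C + 1) * (1 / 40 / 40).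
    by field; rewrite gt_eqF.
  have : C / (C + 1) <= 1 by rewrite ler_pdivrMr// mul1r lerDl.
  by move: (C / (C + 1)) => x x1; lra.
have pos : 0 < 96 * ((C' + 1) * (M + 1)) by rewrite !mulr_gt0//; lra.
have c2 : k * (96 * ((C' + 1) * (M + 1))) <= 1 by rewrite -ler_pdivlMr.
have c3 : k * (C' * M) <= k * ((C' + 1) * (M + 1)).
  rewrite ler_pM2l//; apply: ler_pM => //; lra.
have -> : 4 * (C * (16 * (1 / (40 * (40 * (C + 1)))))) = 64 * (C * (1 / (40 * (40 * (C + 1))))).
  by ring.
have -> : 4 * (C' * (k * M)) = 4 * (k * (C' * M)) by ring.
have c4 : 96 * (k * ((C' + 1) * (M + 1))) <= 1 by rewrite mulrCA.
by move: c1 c3 c4; move: (C * _) (k * (C' * M)) (k * ((C' + 1) * _)) => x y z; lra.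
Qed.

Lemma blend_eta_gt0 (C : R) : 0 <= C -> 0 < 1 / (40 * (40 * (C + 1))).
Proof. by move=> C0; apply: divr_gt0 => //; lra. Qed.

Lemma blend_scale_gt0 (C' M : R) : 0 <= C' -> 0 <= M ->
  0 < 1 / (96 * ((C' + 1) * (M + 1))).
Proof.
move=> C0 M0; apply: divr_gt0 => //; apply: mulr_gt0; first by lra.
by apply: mulr_gt0; lra.
Qed.

Lemma min_of_five (P : 'I_5 -> R -> Prop) :
  (forall j d e, 0 < e -> e <= d -> P j d -> P j e) ->
  (forall j, exists2 d, 0 < d & P j d) -> exists2 d, 0 < d & forall j, P j d.
Proof.
move=> mono ex.
pose d j := sval (cid2 (ex j)).
have d0 j : 0 < d j by rewrite /d; case: cid2.
have dP j : P j (d j) by rewrite /d; case: cid2.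
pose m := \big[Num.min/1]_(j < 5) d j.
have m0 : 0 < m.
  by rewrite /m; elim/big_ind: _ => // x y x0 y0; rewrite lt_min x0 y0.
exists m => // j; apply: mono (dP j) => //.
by rewrite /m (bigD1 j)//= ge_min lexx.
Qed.

(** The blend of the zoomed map with the neck is free for three reasons. Inside
    the unit circle it is the neck, beyond radius 2 an affine image of F, and in
    the shell between them the model map plus an error, each part of which is a
    cutoff times a small jet. *)
Lemma end_piece F : (forall q, enorm q <= 1 -> smooth_free_at F q) ->
  exists2 k0 : R, 0 < k0 & forall k, 0 < k -> k < k0 ->
  exists (H : 'rV[R]_2 -> 'rV[R]_5) (A : 'M[R]_5) (a : 'rV[R]_5),
    [/\ A \in unitmx,
        forall q, enorm q <= 1 -> H q = neck k q,
        forall q, 2 <= enorm q -> H q = F (k *: q) *m A + a &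
        forall q, 0 < enorm q -> enorm q <= k^-1 -> smooth_free_at H q].
Proof.
move=> sfF.
have sfF0 : smooth_free_at F 0 by apply: sfF; rewrite enorm0.
have [A [a [uA nf]]] := normal_form sfF0.
pose E (j : 'I_5) q := (F q *m A + a) 0 j - veronese q 0 j.
have sFA (j : 'I_5) q : enorm q <= 1 -> smooth_at (fun r => (F r *m A + a) 0 j) q.
  by move=> q1; have [s _] := smooth_free_at_affine a uA (sfF q q1); exact: s.
have sE j q : enorm q <= 1 -> smooth_at (E j) q.
  by move=> q1; apply: smoothB; [exact: sFA|exact: smooth_veronese].
have cS : compact (@shell R) by exact: compact_shell.
have [C C0 HC] := compact_jet_le cS (fun p _ => smooth_cutoff p).
have s1c p : smooth_at (fun q => 1 - cutoff q) p.
  by apply: smoothB; [exact: smooth_cst|exact: smooth_cutoff].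
have [C' C'0 HC'] := compact_jet_le cS (fun p _ => s1c p).
have [M M0 HM] := neck_near_veronese R.
pose eta : R := 1 / (40 * (40 * (C + 1))).
have eta0 : 0 < eta := blend_eta_gt0 C0.
have [d d0 Hd] : exists2 d : R, 0 < d & forall (j : 'I_5) q, `|q| < d ->
    [/\ `|E j q| <= 4 * (eta * `|q| ^+ 2),
        forall i, `|partial i (E j) q| <= 2 * (eta * `|q|) &
        forall i i', `|partial i (partial i' (E j)) q| <= eta].
  apply: (min_of_five (P := fun j d => forall q, `|q| < d ->
    [/\ `|E j q| <= 4 * (eta * `|q| ^+ 2),
        forall i, `|partial i (E j) q| <= 2 * (eta * `|q|) &
        forall i i', `|partial i (partial i' (E j)) q| <= eta])).
    by move=> j x y y0 xy Hx q qy; apply: Hx; exact: lt_le_trans xy.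
  move=> j; have [E0 fE] := nf j.
  by apply: flat2_small => //; apply: sE; rewrite enorm0.
pose k0 := Num.min (1 / 2) (Num.min (d / 2) (1 / (96 * ((C' + 1) * (M + 1))))).
have k00 : 0 < k0.
  by rewrite !lt_min (blend_scale_gt0 C'0 M0) divr_gt0// divr_gt0.
exists k0 => // k kpos; rewrite !lt_min => /and3P[k12 kd kM].
have k1 : k <= 1 by lra.
have kn0 : k != 0 by rewrite gt_eqF.
exists (blend k F A a), (A *m diag_mx (weight k)), (a *m diag_mx (weight k)).
have wM (v : 'rV[R]_5) (j : 'I_5) : (v *m diag_mx (weight k)) 0 j = weight k 0 j * v 0 j.
  by rewrite mul_mx_diag mxE mulrC.
have inner q : enorm q <= 1 -> blend k F A a q = neck k q.
  by move=> q1; apply/rowP => j; rewrite mxE cutoff_inner// mul0r add0r subr0 mul1r.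
have outer q : 2 <= enorm q ->
    blend k F A a q = F (k *: q) *m (A *m diag_mx (weight k)) + a *m diag_mx (weight k).
  move=> q2; rewrite mulmxA -mulmxDl; apply/rowP => j.
  by rewrite wM mxE cutoff_outer// mul1r subrr mul0r addr0.
have uAw : A *m diag_mx (weight k) \in unitmx.
  by rewrite unitmx_mul uA diag_unit// => j; exact: weight_neq0.
split; [exact: uAw|exact: inner|exact: outer|move=> q q0 qk].
have qn0 : q != 0 by rewrite -enorm_gt0.
have ek r : enorm (dilation k r) = k * enorm r by rewrite enormZ gtr0_norm.
have kq1 : enorm (dilation k q) <= 1.
  by rewrite ek mulrC -ler_pdivlMr// div1r.
have [q1|q1] := ltP (enorm q) 1.
  apply: (smooth_free_at_eq _ (smooth_free_neck kpos qn0)).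
  have H : \forall r \near q, enorm r < 1.
    exact: (@cvgr_lt _ _ (nbhs q) _ (@enorm R) (enorm q) (@enorm_continuous R q) 1 q1).
  by near=> r; apply: esym; apply: inner; apply: ltW; exact: (near H r).
have [q2|q2] := ltP 2 (enorm q).
  have sfd : smooth_free_at (F \o dilation k) q.
    apply: (@smooth_free_at_comp _ _ (dilation k^-1)).
    - exact: smooth_dilation.
    - exact: smooth_dilation.
    - by rewrite /dilation scalerA mulVf// scale1r.
    - by near=> r; rewrite /dilation scalerA divff// scale1r.
    - exact: sfF kq1.
  apply: (smooth_free_at_eq _ (smooth_free_at_affine (a *m diag_mx (weight k)) uAw sfd)).
  have H : \forall r \near q, 2 < enorm r.
    exact: (@cvgr_gt _ _ (nbhs q) _ (@enorm R) (enorm q) (@enorm_continuous R q) 2 q2).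
  by near=> r; apply: esym; apply: outer; apply: ltW; exact: (near H r).
have Kq : shell q by rewrite /shell/= q1 q2.
have sFd (j : 'I_5) : smooth_at (fun r => (F (dilation k r) *m A + a) 0 j) q.
  exact: (smooth_comp (smooth_dilation k q) (sFA j _ kq1)).
have sB : smooth5_at (blend k F A a) q.
  move=> j; under [fun _ => _]eq_fun do rewrite mxE.
  apply: smoothD; apply: smoothM => //.
  - exact: smooth_cutoff.
  - by apply: smoothM => //; exact: smooth_cst.
  - exact: smooth_neck.
split => //.
pose Er r : 'rV[R]_5 := blend k F A a r - veronese r.
have -> : blend k F A a = fun r => veronese r + Er r.
  by apply/funext => r; rewrite /Er addrC subrK.
have ErE (j : 'I_5) r : Er r 0 j =
    cutoff r * (weight k 0 j * E j (dilation k r)) +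
    (1 - cutoff r) * (neck k r 0 j - veronese r 0 j).
  rewrite /Er rowB_E [blend _ _ _ _ _ _ _]mxE /E.
  rewrite -(weight_veronese r j kn0).
  move: (weight k 0 j) (cutoff r) (neck k r 0 j) (veronese _ 0 j).
  by move: ((_ *m A + a) 0 j) => x w c n v; ring.
apply: free_veronese_perturb.
- move=> j; under [fun _ => _]eq_fun do rewrite /Er rowB_E.
  by apply: smoothB; [exact: sB|exact: smooth_veronese].
- exact: le_trans (norm_le_enorm q) q2.
- move=> j.
  have sEd : smooth_at (E j \o dilation k) q.
    exact: (smooth_comp (smooth_dilation k q) (sE j _ kq1)).
  have jE : jet_le (E j \o dilation k) (16 * eta * k ^+ 2) q.
    apply: (jet_le_dilation (d := d)) => //.
    + exact: Hd.
    + exact: ltW.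
    + exact: le_trans (norm_le_enorm q) q2.
    + by rewrite mulrC -ltr_pdivlMr.
    + exact: sE.
  have jwE : jet_le (fun r => weight k 0 j * (E j \o dilation k) r) (16 * eta) q.
    apply: jet_le_trans (jet_leZ (weight k 0 j) sEd jE).
    apply: (@le_trans _ _ (k ^- 2 * (16 * eta * k ^+ 2))).
      apply: ler_wpM2r; last exact: weight_le.
      apply: mulr_ge0; last exact: sqr_ge0.
      by apply: mulr_ge0; [exact: ler0n|exact: ltW].
    by rewrite mulrCA mulVf ?mulr1// expf_neq0.
  have swE : smooth_at (fun r => weight k 0 j * (E j \o dilation k) r) q.
    by apply: smoothM => //; exact: smooth_cst.
  have sN : smooth_at (fun r => neck k r 0 j - veronese r 0 j) q.
    by apply: smoothB; [exact: smooth_neck|exact: smooth_veronese].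
  have J1 := jet_leM (smooth_cutoff q) swE (HC q Kq) jwE.
  have J2 := jet_leM (s1c q) sN (HC' q Kq) (HM k q j kpos k1 Kq).
  have J := jet_leD (smoothM (smooth_cutoff q) swE) (smoothM (s1c q) sN) J1 J2.
  have -> : (fun r => Er r 0 j) = (fun r => cutoff r * (weight k 0 j * (E j \o dilation k) r) +
    (1 - cutoff r) * (neck k r 0 j - veronese r 0 j)).
    by apply/funext => r; rewrite ErE.
  apply: jet_le_trans J.
  by apply: blend_tolerance => //; exact: ltW.
Unshelve. all: by end_near. Qed.

End EndPiece.

(** * Joining two ends of the tube *)

Section Bridge.
Variable R : realType.
Implicit Types (p q r v w : 'rV[R]_2) (k : R) (F G : 'rV[R]_2 -> 'rV[R]_5).

Notation e_ i := (delta_mx 0 i : 'rV[R]_2).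

Lemma partialV (u : 'rV[R]_2 -> R) p i : smooth_at u p -> u p != 0 ->
  partial i (fun q => (u q)^-1) p = - (u p ^- 2) * partial i u p.
Proof.
by move=> su u0; rewrite /partial deriveV//; exact: smooth_derivable.
Qed.

Lemma partial1B (u : 'rV[R]_2 -> R) p i : smooth_at u p ->
  partial i (fun q => 1 - u q) p = - partial i u p.
Proof.
move=> su; have d : derivable u p (e_ i) by exact: smooth_derivable.
have -> : (fun q => 1 - u q) = cst 1 - u by [].
rewrite /partial deriveB; [|exact: derivable_cst|exact: d].
by rewrite (derive_cst (1 : R)) sub0r.
Qed.

Lemma partial_enorm p i : p != 0 -> partial i (@enorm R) p = p 0 i / enorm p.
Proof.
move=> p0; have s := smooth_enorm p0.
have e0 : enorm p != 0 by rewrite gt_eqF// enorm_gt0.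
have E : partial i (fun q => enorm q * enorm q) p = 2 * p 0 i.
  have [_ H] := is_deriveD (is_derive_quadratic i 0 0 p) (is_derive_quadratic i 1 1 p).
  rewrite /partial (_ : (fun q => enorm q * enorm q) =
    (fun q : 'rV[R]_2 => q 0 0 * q 0 0) + (fun q : 'rV[R]_2 => q 0 1 * q 0 1)).
    by rewrite H; case: (rV2_ord i) => -> /=; ring.
  by apply/funext => q; rewrite -expr2 enorm_sqr !expr2.
have alg (x y z : R) : x != 0 -> x * y + x * y = 2 * z -> y = z / x.
  move=> x0 H; apply: (mulfI x0); rewrite mulrCA divff// mulr1.
  by move: H; move: (x * y) => w; lra.
by apply: alg e0 _; rewrite -E (partialM i s s).
Qed.

(** It passes from 0 to 1 while |q| goes from 1/4 to 3/4. *)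
Definition ramp q : R := step (2 * (q 0 0 * q 0 0 + q 0 1 * q 0 1) - 1 / 8).

Lemma rampE q : ramp q = step (2 * enorm q ^+ 2 - 1 / 8).
Proof. by rewrite /ramp enorm_sqr !expr2. Qed.

Lemma ramp_ge0 q : 0 <= ramp q. Proof. exact: step_ge0. Qed.

Lemma ramp_le1 q : ramp q <= 1. Proof. exact: step_le1. Qed.

Lemma ramp_inner q : enorm q <= 1 / 4 -> ramp q = 0.
Proof.
move=> q1; rewrite rampE step_le0//.
have := enorm_ge0 q; move: (enorm q) q1 => t t4 t0.
have : t * t <= 1 / 4 * (1 / 4) by apply: ler_pM.
by rewrite expr2; lra.
Qed.

Lemma ramp_outer q : 3 / 4 <= enorm q -> ramp q = 1.
Proof.
move=> q1; rewrite rampE step_ge1//.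
move: (enorm q) q1 => t t4.
have : 3 / 4 * (3 / 4) <= t * t by apply: ler_pM => //; lra.
by rewrite expr2; lra.
Qed.

Lemma smooth_ramp p : smooth_at ramp p.
Proof.
have C j := @smooth_coord R p j.
apply: smooth_step; apply: smoothB; last exact: smooth_cst.
by apply: smoothM; [exact: smooth_cst|apply: smoothD; exact: smoothM].
Qed.

Lemma partial_ramp p : exists c, [/\ 0 <= c,
  enorm p <= 1 / 4 \/ 3 / 4 <= enorm p -> c = 0 &
  forall i, partial i ramp p = c * (4 * p 0 i)].
Proof.
pose w := 2 * (p 0 0 * p 0 0 + p 0 1 * p 0 1) - 1 / 8 : R.
have [c [c0 cz dc]] := is_derive_step w.
have Ew : w = 2 * enorm p ^+ 2 - 1 / 8 by rewrite enorm_sqr !expr2.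
exists c; split => // [H|i].
  apply: cz; rewrite Ew; have := enorm_ge0 p; move: (enorm p) H => t.
  case=> H t0; [left|right]; rewrite expr2.
    have : t * t <= 1 / 4 * (1 / 4) by apply: ler_pM.
    by lra.
  have : 3 / 4 * (3 / 4) <= t * t by apply: ler_pM => //; lra.
  by lra.
have dq := is_deriveD (is_derive_quadratic i 0 0 p) (is_derive_quadratic i 1 1 p).
have dz := @is_deriveZ _ _ _ _ 2 _ _ _ dq.
have dw := is_deriveB dz (is_derive_cst (1 / 8 : R) p (e_ i)).
have [_ E] := @is_derive_comp1 _ _ (@step R)
  (fun q : 'rV[R]_2 => 2 * (q 0 0 * q 0 0 + q 0 1 * q 0 1) - 1 / 8) p (e_ i) _ _ dc dw.
rewrite /partial [LHS]E /GRing.scale/=; congr (_ * _).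
by case: (rV2_ord i) => -> /=; ring.
Qed.

(** The change of coordinates q |-> radial q * q maps the circle of radius t to
    that of radius k^3 / (1 - t) near the puncture and t / k near the unit
    circle. The second undoes the dilation in the end piece of F. The first
    becomes, after inversion in the circle of radius k, the radius (1 - t) / k,
    which undoes it in the end piece of G up to the swap t |-> 1 - t. *)
Definition radial k q : R :=
  ramp q * k^-1 + (1 - ramp q) * (k ^+ 3 * ((1 - enorm q) * enorm q)^-1).

Definition stretch k q : 'rV[R]_2 := radial k q *: q.

Lemma stretchE k q j : stretch k q 0 j = radial k q * q 0 j.
Proof. by rewrite mxE. Qed.

Section Fixed.
Variables (k : R).
Hypotheses (k0 : 0 < k) (k4 : k < 1 / 4).

Lemma smooth_radial p : 0 < enorm p -> enorm p < 1 -> smooth_at (radial k) p.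
Proof.
move=> p0 p1; have pn0 : p != 0 by rewrite -enorm_gt0.
have s := smooth_enorm pn0; have c a := @smooth_cst R a p.
apply: smoothD; first by apply: smoothM => //; exact: smooth_ramp.
apply: smoothM; first by apply: smoothB => //; exact: smooth_ramp.
apply: smoothM => //; apply: smoothV; last first.
  by rewrite mulf_neq0// gt_eqF// subr_gt0.
by apply: smoothM => //; exact: smoothB.
Qed.

Lemma smooth_stretch p : 0 < enorm p -> enorm p < 1 -> smooth_map_at (stretch k) p.
Proof.
move=> p0 p1 j; under [fun _ => _]eq_fun do rewrite stretchE.
by apply: smoothM; [exact: smooth_radial|exact: smooth_coord].
Qed.

Lemma k_lt1 : k < 1.
Proof. by have := k4; lra. Qed.

Lemma k_small : k ^+ 3 <= 1 / 64 /\ 4 <= k^-1.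
Proof.
split.
  rewrite (_ : 1 / 64 = (1 / 4) ^+ 3); last by rewrite !exprS expr0; field.
  by apply: lerXn2r; [rewrite nnegrE ltW|rewrite nnegrE|exact: ltW].
by rewrite -[4]invrK lef_pV2 ?posrE ?invr_gt0// -div1r ltW.
Qed.

(** This is the derivative of the radius of the image circle. Both of the
    interpolated radii increase with t, and where the ramp grows it favours the
    larger one, t / k, over k^3 / (1 - t). *)
Lemma radial_increasing p : 0 < enorm p -> enorm p < 1 ->
  0 < radial k p + (p 0 0 * partial 0 (radial k) p + p 0 1 * partial 1 (radial k) p).
Proof.
move=> p0 p1; have pn0 : p != 0 by rewrite -enorm_gt0.
have s := smooth_enorm pn0; have c a := @smooth_cst R a p.
have sr := smooth_ramp p.
have s1 : smooth_at (fun q => 1 - ramp q) p by exact: smoothB.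
have s2 : smooth_at (fun q => (1 - enorm q) * enorm q) p.
  by apply: smoothM => //; exact: smoothB.
have n2 : (1 - enorm p) * enorm p != 0 by rewrite mulf_neq0// gt_eqF// subr_gt0.
have s3 := smoothV s2 n2.
have s4 : smooth_at (fun q => k ^+ 3 * ((1 - enorm q) * enorm q)^-1) p.
  by apply: smoothM.
have [c' [c0 cz Ec]] := partial_ramp p.
have E i : partial i (radial k) p =
    c' * (4 * p 0 i) * (k^-1 - k ^+ 3 * ((1 - enorm p) * enorm p)^-1) +
    (1 - ramp p) * (k ^+ 3 * (- ((1 - enorm p) * enorm p) ^- 2 *
      (p 0 i / enorm p * (1 - 2 * enorm p)))).
  rewrite /radial (partialD i (smoothM sr (c _)) (smoothM s1 s4)).
  rewrite (partialM i sr (c _)) (partialM i s1 s4) (partialM i (c _) s3).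
  rewrite (partialV i s2 n2) (partialM i (smoothB (c 1) s) s).
  rewrite (partial1B i s) (partial1B i sr) (partial_enorm i pn0) Ec.
  rewrite (partial_const _ p i) (partial_const _ p i).
  move: (ramp p) (enorm p) (p 0 i) n2 (gt_eqF p0) => x t y n t0.
  move: (k^-1) (((1 - t) * t)^-1) (((1 - t) * t) ^- 2) (t^-1) => a b d e.
  by ring.
rewrite !E /radial.
have Er : p 0 0 ^+ 2 + p 0 1 ^+ 2 = enorm p ^+ 2 by rewrite enorm_sqr.
have -> : ramp p / k + (1 - ramp p) * (k ^+ 3 / ((1 - enorm p) * enorm p)) +
  (p 0 0 * (c' * (4 * p 0 0) * (k^-1 - k ^+ 3 / ((1 - enorm p) * enorm p)) +
     (1 - ramp p) * (k ^+ 3 * (- ((1 - enorm p) * enorm p) ^- 2 *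
        (p 0 0 / enorm p * (1 - 2 * enorm p))))) +
   p 0 1 * (c' * (4 * p 0 1) * (k^-1 - k ^+ 3 / ((1 - enorm p) * enorm p)) +
     (1 - ramp p) * (k ^+ 3 * (- ((1 - enorm p) * enorm p) ^- 2 *
        (p 0 1 / enorm p * (1 - 2 * enorm p)))))) =
  ramp p / k + (1 - ramp p) * (k ^+ 3 / (1 - enorm p) ^+ 2) +
  4 * enorm p ^+ 2 * (c' * (k^-1 - k ^+ 3 / ((1 - enorm p) * enorm p))).
  transitivity (ramp p / k + (1 - ramp p) * (k ^+ 3 / ((1 - enorm p) * enorm p)) +
   (4 * (p 0 0 ^+ 2 + p 0 1 ^+ 2) * (c' * (k^-1 - k ^+ 3 / ((1 - enorm p) * enorm p))) +
    (1 - ramp p) * (k ^+ 3 * (- ((1 - enorm p) * enorm p) ^- 2 *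
        ((p 0 0 ^+ 2 + p 0 1 ^+ 2) / enorm p * (1 - 2 * enorm p)))))).
    by ring.
  rewrite Er; have t0 : enorm p != 0 by rewrite gt_eqF.
  have t1 : 1 - enorm p != 0 by rewrite gt_eqF// subr_gt0.
  have kn0 : k != 0 by rewrite gt_eqF.
  by field; rewrite t0 t1 kn0.
have k3 : 0 < k ^+ 3 by rewrite exprn_gt0.
have last_ge0 : 0 <= c' * (k^-1 - k ^+ 3 / ((1 - enorm p) * enorm p)).
  have [q1|q1] := leP (enorm p) (1 / 4).
    by rewrite cz ?mul0r//; left.
  have [q2|q2] := leP (3 / 4) (enorm p).
    by rewrite cz ?mul0r//; right.
  apply: mulr_ge0 => //; rewrite subr_ge0.
  have [ks ki] := k_small.
  apply: (@le_trans _ _ 1); last by lra.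
  have : 3 / 16 <= (1 - enorm p) * enorm p by nra.
  move: ((1 - enorm p) * enorm p) => x x3.
  by rewrite ler_pdivrMr; lra.
have A1 : 0 <= ramp p / k by apply: divr_ge0; [exact: ramp_ge0|exact: ltW].
have A2 : 0 < k ^+ 3 / (1 - enorm p) ^+ 2.
  by rewrite divr_gt0// exprn_gt0// subr_gt0.
have A3 : 0 <= 4 * enorm p ^+ 2 * (c' * (k^-1 - k ^+ 3 / ((1 - enorm p) * enorm p))).
  by rewrite mulr_ge0// mulr_ge0// exprn_ge0// ltW.
have A4 : 0 < ramp p / k + (1 - ramp p) * (k ^+ 3 / (1 - enorm p) ^+ 2).
  have [->|r1] := eqVneq (ramp p) 1.
    by rewrite subrr mul0r addr0 divr_gt0.
  by rewrite ltr_wpDl// mulr_gt0// subr_gt0 lt_neqAle r1 ramp_le1.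
by rewrite ltr_pwDl.
Qed.

Lemma radial_gt0 p : 0 < enorm p -> enorm p < 1 -> 0 < radial k p.
Proof.
move=> p0 p1.
have A1 : 0 <= ramp p / k by apply: divr_ge0; [exact: ramp_ge0|exact: ltW].
rewrite /radial; have [->|r1] := eqVneq (ramp p) 1.
  by rewrite subrr mul0r addr0 mul1r invr_gt0.
rewrite ltr_wpDl// mulr_gt0//.
  by rewrite subr_gt0 lt_neqAle r1 ramp_le1.
by rewrite divr_gt0// ?exprn_gt0// mulr_gt0// subr_gt0.
Qed.

(** The Jacobian of a map q |-> g q * q is g (g + q . grad g). *)
Lemma stretch_jacobian p : 0 < enorm p -> enorm p < 1 ->
  partial 0 (fun q => stretch k q 0 0) p * partial 1 (fun q => stretch k q 0 1) p -
  partial 1 (fun q => stretch k q 0 0) p * partial 0 (fun q => stretch k q 0 1) p != 0.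
Proof.
move=> p0 p1; have s := smooth_radial p0 p1.
have E i j : partial i (fun q => stretch k q 0 j) p =
    radial k p * (i == j)%:R + p 0 j * partial i (radial k) p.
  rewrite (_ : (fun q => stretch k q 0 j) = fun q => radial k q * q 0 j); last first.
    by apply/funext => q; rewrite stretchE.
  by rewrite (partialM i s (smooth_coord p j)) partial_coord.
rewrite !E /=.
have P := mulr_gt0 (radial_gt0 p0 p1) (radial_increasing p0 p1).
have alg (g a b x y : R) : 0 < g * (g + (x * a + y * b)) ->
   (g * 1 + x * a) * (g * 1 + y * b) - (g * 0 + x * b) * (g * 0 + y * a) != 0.
  by move=> H; rewrite gt_eqF//; move: H; congr (0 < _); ring.
exact: alg P.
Qed.

Lemma enorm_stretch p : 0 < enorm p -> enorm p < 1 ->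
  enorm (stretch k p) = ramp p * (enorm p / k) + (1 - ramp p) * (k ^+ 3 / (1 - enorm p)).
Proof.
move=> p0 p1; rewrite enormZ gtr0_norm; last exact: radial_gt0.
have t0 : enorm p != 0 by rewrite gt_eqF.
have t1 : 1 - enorm p != 0 by rewrite gt_eqF// subr_gt0.
have kn0 : k != 0 by rewrite gt_eqF.
by rewrite /radial; field; rewrite t0 t1 kn0.
Qed.

(** The bounds are those under which both end pieces, the second one after
    inversion, are free. *)
Lemma enorm_stretch_bounds p : 0 < enorm p -> enorm p < 1 ->
  k ^+ 3 <= enorm (stretch k p) <= k^-1.
Proof.
move=> p0 p1; rewrite enorm_stretch//.
have [ks ki] := k_small.
have k3 : 0 < k ^+ 3 by rewrite exprn_gt0.
have r0 := ramp_ge0 p; have r1 := ramp_le1 p.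
have kV : 0 < k^-1 by rewrite invr_gt0.
have a_hi : enorm p / k <= k^-1 by rewrite ler_pdivrMr// mulVf ?gt_eqF// ltW.
have b_lo : k ^+ 3 <= k ^+ 3 / (1 - enorm p).
  by rewrite ler_pdivlMr ?subr_gt0// ler_piMr ?ltW//; lra.
have a_lo : 1 / 4 < enorm p -> k ^+ 3 <= enorm p / k.
  move=> t4; apply: (@le_trans _ _ 1); first by lra.
  by rewrite -[leLHS](_ : 1 / 4 * 4 = 1); [apply: ler_pM => //; lra|field].
have b_hi : enorm p < 3 / 4 -> k ^+ 3 / (1 - enorm p) <= k^-1.
  move=> t4; rewrite ler_pdivrMr ?subr_gt0//.
  apply: (@le_trans _ _ (4 * (1 / 4))); first by lra.
  by apply: ler_pM => //; lra.
have conv (a b x lo hi : R) : 0 <= x -> x <= 1 ->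
    lo <= a -> a <= hi -> lo <= b -> b <= hi -> lo <= x * a + (1 - x) * b <= hi.
  move=> x0 x1 la ha lb hb; rewrite -subr_ge0 -[X in _ && X]subr_ge0.
  rewrite (_ : _ - lo = x * (a - lo) + (1 - x) * (b - lo)); last by ring.
  rewrite (_ : hi - _ = x * (hi - a) + (1 - x) * (hi - b)); last by ring.
  by rewrite !addr_ge0// mulr_ge0// subr_ge0.
have [t4|t4] := leP (enorm p) (1 / 4).
  rewrite ramp_inner// mul0r add0r subr0 mul1r b_lo b_hi//.
  by apply: le_lt_trans t4 _; lra.
have [t34|t34] := leP (3 / 4) (enorm p).
  by rewrite ramp_outer// subrr mul0r addr0 mul1r a_hi a_lo.
by apply: conv => //; [exact: a_lo|exact: b_hi].
Qed.

Lemma inversionE v j : inversion k v 0 j = k ^+ 2 * (enorm v ^+ 2)^-1 * v 0 j.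
Proof. by rewrite mxE. Qed.

Lemma smooth_inversion v : v != 0 -> smooth_map_at (inversion k) v.
Proof.
move=> v0 j; under [fun _ => _]eq_fun do rewrite inversionE.
apply: smoothM; last exact: smooth_coord.
apply: smoothM; first exact: smooth_cst.
apply: smoothV; first by apply: smoothX; exact: smooth_enorm.
by rewrite expf_neq0// gt_eqF// enorm_gt0.
Qed.

Lemma enorm_inversion v : v != 0 -> enorm (inversion k v) = k ^+ 2 / enorm v.
Proof.
rewrite -enorm_gt0 => v0; rewrite enormZ ger0_norm; last first.
  by rewrite divr_ge0// exprn_ge0 ?enorm_ge0// ltW.
by field; rewrite gt_eqF.
Qed.

Lemma inversionK v : v != 0 -> inversion k (inversion k v) = v.
Proof.
move=> v0; rewrite {1}/inversion enorm_inversion// /inversion scalerA.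
move: v0; rewrite -enorm_gt0 => v0.
rewrite (_ : _ / _ * _ = 1) ?scale1r//.
by field; rewrite !gt_eqF.
Qed.

Lemma inversion_neq0 v : v != 0 -> inversion k v != 0.
Proof.
move=> v0; rewrite -enorm_gt0 enorm_inversion// divr_gt0 ?exprn_gt0//.
by rewrite enorm_gt0.
Qed.

Lemma near_neq0 v : v != 0 -> \forall w \near v, w != 0.
Proof.
move=> /near_enorm_neq0 H; near=> w.
have : enorm w != 0 by exact: (near H w).
by rewrite -enorm_gt0 lt_def enorm_ge0 andbT.
Unshelve. all: by end_near. Qed.

Lemma smooth_free_inversion G v : v != 0 -> smooth_free_at G (inversion k v) ->
  smooth_free_at (G \o inversion k) v.
Proof.
move=> v0 sG; apply: (@smooth_free_at_comp _ _ (inversion k)).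
- exact: smooth_inversion.
- by apply: smooth_inversion; exact: inversion_neq0.
- exact: inversionK.
- have H := near_neq0 (inversion_neq0 v0); near=> w.
  by apply: inversionK; exact: (near H w).
- exact: sG.
Unshelve. all: by end_near. Qed.

Lemma neck_flipK : neck_flip R *m neck_flip R = 1%:M.
Proof.
rewrite /neck_flip -diag_const_mx mulmx_diag; congr diag_mx.
by apply/rowP; elim/ord5_ind; rewrite !mxE /= ?mulr1 ?mulrNN ?mulr1.
Qed.

(** The formula switches at |stretch q| = k, the waist of the tube. When HF and
    HG coincide with the neck on the unit disc, both branches agree for
    k^2 < |stretch q| < 1 by the symmetry of the neck, so that the switch leaves
    no trace ([bridge_mapF], [bridge_mapG]). *)
Definition bridge_map (HF HG : 'rV[R]_2 -> 'rV[R]_5) q : 'rV[R]_5 :=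
  if k <= enorm (stretch k q) then HF (stretch k q)
  else HG (inversion k (stretch k q)) *m neck_flip R.

Section BridgeMap.
Variables (HF HG : 'rV[R]_2 -> 'rV[R]_5).
Hypothesis neckF : forall q, enorm q <= 1 -> HF q = neck k q.
Hypothesis neckG : forall q, enorm q <= 1 -> HG q = neck k q.

Lemma bridge_mapF q : stretch k q != 0 -> k ^+ 2 < enorm (stretch k q) ->
  bridge_map HF HG q = HF (stretch k q).
Proof.
rewrite /bridge_map; move: (stretch k q) => v v0 kv.
case: ifPn => //; rewrite -ltNge => vk.
rewrite neckG; last first.
  by rewrite enorm_inversion// ler_pdivrMr ?enorm_gt0// mul1r ltW.
rewrite neck_inversion// -mulmxA neck_flipK mulmx1 neckF// ltW//.
exact: lt_trans vk k_lt1.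
Qed.

Lemma bridge_mapG q : stretch k q != 0 -> enorm (stretch k q) < 1 ->
  bridge_map HF HG q = HG (inversion k (stretch k q)) *m neck_flip R.
Proof.
rewrite /bridge_map; move: (stretch k q) => v v0 v1.
case: ifPn => // kv.
have vp : 0 < enorm v by rewrite enorm_gt0.
have kk : k ^+ 2 / enorm v <= 1.
  rewrite ler_pdivrMr// mul1r; apply: le_trans kv.
  by rewrite expr2 ler_piMr// ltW// k_lt1.
rewrite neckG; last by rewrite enorm_inversion.
by rewrite neck_inversion// -mulmxA neck_flipK mulmx1 neckF// ltW.
Qed.

Hypothesis sfF : forall q, 0 < enorm q -> enorm q <= k^-1 -> smooth_free_at HF q.
Hypothesis sfG : forall q, 0 < enorm q -> enorm q <= k^-1 -> smooth_free_at HG q.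

Lemma smooth_free_bridge q : 0 < enorm q -> enorm q < 1 ->
  smooth_free_at (bridge_map HF HG) q.
Proof.
move=> q0 q1; have /andP[lo hi] := enorm_stretch_bounds q0 q1.
have k3 : 0 < k ^+ 3 by rewrite exprn_gt0.
have y0 : 0 < enorm (stretch k q) by exact: lt_le_trans lo.
have yn0 : stretch k q != 0 by rewrite -enorm_gt0.
have sS := smooth_stretch q0 q1; have J := stretch_jacobian q0 q1.
have cS : {for q, continuous (stretch k)}.
  by apply: smooth_map_continuous => j; exact: sS.
have cN : {for q, continuous (fun r => enorm (stretch k r))}.
  exact: (continuous_comp cS (@enorm_continuous R _)).
have H0 : \forall r \near q, stretch k r != 0 := cS _ (near_neq0 yn0).
have [y2|y2] := ltP (k ^+ 2) (enorm (stretch k q)).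
  have H : \forall r \near q, k ^+ 2 < enorm (stretch k r).
    exact: (@cvgr_gt _ _ (nbhs q) _ _ (enorm (stretch k q)) cN _ y2).
  have sf := smooth_free_at_comp_jacobian sS J (sfF y0 hi).
  apply: (smooth_free_at_eq _ sf); near=> r; apply: esym; apply: bridge_mapF.
    exact: (near H0 r).
  exact: (near H r).
have y1 : enorm (stretch k q) < 1.
  apply: le_lt_trans y2 _; rewrite expr2.
  by apply: (@lt_trans _ _ (k * 1)); [rewrite ltr_pM2l// k_lt1|rewrite mulr1 k_lt1].
have H : \forall r \near q, enorm (stretch k r) < 1.
  exact: (@cvgr_lt _ _ (nbhs q) _ _ (enorm (stretch k q)) cN _ y1).
have sI : smooth_free_at (HG \o inversion k) (stretch k q).
  apply: smooth_free_inversion => //; apply: sfG.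
    by rewrite enorm_gt0; exact: inversion_neq0.
  rewrite enorm_inversion// ler_pdivrMr//.
  rewrite (_ : k ^+ 2 = k^-1 * k ^+ 3); last by field; rewrite gt_eqF.
  by rewrite ler_pM2l// invr_gt0.
have sf := smooth_free_at_comp_jacobian sS J sI.
have uf : neck_flip R \in unitmx by have [] := mulmx1_unit neck_flipK.
apply: (smooth_free_at_eq _ (smooth_free_at_affine 0 uf sf)).
near=> r; rewrite addr0; apply: esym; apply: bridge_mapG.
  exact: (near H0 r).
exact: (near H r).
Unshelve. all: by end_near. Qed.

End BridgeMap.

Lemma bridge_outer HF HG q : 3 / 4 <= enorm q -> enorm q < 1 ->
  bridge_map HF HG q = HF (k^-1 *: q) /\ 2 <= enorm (k^-1 *: q).
Proof.
move=> q3 q1; have [ks ki] := k_small.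
have E : stretch k q = k^-1 *: q.
  by rewrite /stretch /radial ramp_outer// subrr mul0r addr0 mul1r.
have kV : 0 < k^-1 by rewrite invr_gt0.
have n : 3 <= enorm (k^-1 *: q).
  rewrite enormZ gtr0_norm// [leLHS](_ : 3 = 4 * (3 / 4)); last by field.
  by apply: ler_pM => //; lra.
have k1 := k_lt1; rewrite /bridge_map E ifT; last by lra.
by split => //; lra.
Qed.

Lemma bridge_inner HF HG q : 0 < enorm q -> enorm q <= 1 / 4 ->
  let v := ((1 - enorm q) / (k * enorm q)) *: q in
  bridge_map HF HG q = HG v *m neck_flip R /\ 2 <= enorm v.
Proof.
move=> q0 q4 v; have [ks ki] := k_small.
have q1 : enorm q < 1 by lra.
have k3 : 0 < k ^+ 3 by rewrite exprn_gt0.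
have E : enorm (stretch k q) = k ^+ 3 / (1 - enorm q).
  by rewrite enorm_stretch// ramp_inner// mul0r add0r subr0 mul1r.
have n0 : enorm q != 0 by rewrite gt_eqF.
have n1 : 1 - enorm q != 0 by rewrite gt_eqF// subr_gt0.
have kn0 : k != 0 by rewrite gt_eqF.
have Ev : inversion k (stretch k q) = v.
  rewrite /inversion E /stretch scalerA /radial ramp_inner// /v; congr (_ *: _).
  by field; rewrite n0 n1 kn0.
have nv : enorm v = (1 - enorm q) * k^-1.
  rewrite enormZ ger0_norm; first by field; rewrite n0 kn0.
  by rewrite divr_ge0// ?mulr_ge0// ?subr_ge0// ltW.
have kV : 0 < k^-1 by rewrite invr_gt0.
have n2 : 2 <= enorm v.
  rewrite nv; apply: (@le_trans _ _ (3 / 4 * 4)); first by lra.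
  by apply: ler_pM => //; lra.
split => //; rewrite /bridge_map Ev ifN// -ltNge E ltr_pdivrMr ?subr_gt0//.
rewrite exprS ltr_pM2l//.
have : k ^+ 2 <= 1 / 4 * (1 / 4).
  by rewrite expr2; apply: ler_pM; exact: ltW.
by lra.
Qed.

End Fixed.

(** t u |-> (1 - t) u for unit vectors u and 0 < t < 1: the identification of the
    punctured discs in a connected sum. *)
Definition disc_swap q : 'rV[R]_2 := ((1 - enorm q) / enorm q) *: q.

(** One k serves both end pieces. The map near the puncture is composed with the
    flip of the neck, which only changes the affine map in front of G. *)
Lemma bridge F G :
  (forall q, enorm q <= 1 -> smooth_free_at F q) ->
  (forall q, enorm q <= 1 -> smooth_free_at G q) ->
  exists (H : 'rV[R]_2 -> 'rV[R]_5) (A B : 'M[R]_5) (a b : 'rV[R]_5),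
    [/\ A \in unitmx /\ B \in unitmx,
        forall q, 0 < enorm q -> enorm q < 1 -> smooth_free_at H q,
        forall q, 3 / 4 <= enorm q -> enorm q < 1 -> H q = F q *m A + a &
        forall q, 0 < enorm q -> enorm q <= 1 / 4 -> H q = G (disc_swap q) *m B + b].
Proof.
move=> /end_piece[kF kF0 PF] /end_piece[kG kG0 PG].
pose k := Num.min (1 / 8) (Num.min (kF / 2) (kG / 2)).
have k0 : 0 < k by rewrite !lt_min !divr_gt0.
have k8 : k <= 1 / 8 by rewrite ge_min lexx.
have kkF : k < kF.
  by apply: (@le_lt_trans _ _ (kF / 2)); [rewrite !ge_min lexx orbT|lra].
have kkG : k < kG.
  by apply: (@le_lt_trans _ _ (kG / 2)); [rewrite !ge_min lexx !orbT|lra].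
have k4 : k < 1 / 4 by lra.
have kn0 : k != 0 by rewrite gt_eqF.
have [HF [A [a [uA F1 F2 F3]]]] := PF k k0 kkF.
have [HG [B [b [uB G1 G2 G3]]]] := PG k k0 kkG.
have uf : neck_flip R \in unitmx by have [] := mulmx1_unit neck_flipK.
exists (bridge_map k HF HG), A, (B *m neck_flip R), a, (b *m neck_flip R).
split.
- by split => //; rewrite unitmx_mul uB.
- by move=> q q0 q1; exact: smooth_free_bridge.
- move=> q q3 q1; have [-> n2] := bridge_outer k0 k4 HF HG q3 q1.
  by rewrite F2// scalerA divff// scale1r.
- move=> q q0 q4; have [-> n2] := bridge_inner k0 k4 HF HG q0 q4.
  rewrite G2// mulmxDl -mulmxA scalerA /disc_swap; congr (G (_ *: _) *m _ + _).
  by field; rewrite kn0 gt_eqF.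
Qed.

End Bridge.

(** * Comparison of open-set and germ notions *)

Section CkOn.
Variable R : realType.
Implicit Types (p q : 'rV[R]_2) (k : nat) (U : set 'rV[R]_2).

Notation e_ i := (delta_mx 0 i : 'rV[R]_2).

Lemma Ck_on_at n k U (f : 'rV[R]_2 -> 'rV[R]_n) p :
  (\forall q \near p, U q) -> Ck_on k U f ->
  forall j, Ck_at k (fun q => f q 0 j) p.
Proof.
move=> nU; elim: k f => [|k IH] f fU j.
  apply: (@filterS _ (nbhs p) (nbhs_filter p) _ _ _ nU) => q Uq.
  have cf : {for q, continuous f} by apply: fU; exact: mem_set.
  by move/row_continuousP : cf; apply.
move=> i; have [d /IH s] := fU i; split.
  apply: (@filterS _ (nbhs p) (nbhs_filter p) _ _ _ nU) => q /d.
  by move/derivable_mxP; apply.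
apply: Ck_at_eq (s j).
apply: (@filterS _ (nbhs p) (nbhs_filter p) _ _ _ nU) => q /d dq.
by rewrite /partial derive_mx// mxE.
Qed.

Lemma near_partial_rowE n (f : 'rV[R]_2 -> 'rV[R]_n) p i :
  (forall j, Ck_at 1 (fun q => f q 0 j) p) ->
  \forall q \near p, derivable f q (e_ i) /\
    forall j, partial i f q 0 j = partial i (fun q => f q 0 j) q.
Proof.
move=> sf.
have d : \forall q \near p, forall j, derivable (fun q => f q 0 j) q (e_ i).
  apply: (@filter_forall _ 'I_n (fun j q => derivable (fun q => f q 0 j) q (e_ i))
    (nbhs p)) => j.
  exact: Ck_at_derivable (sf j).
apply: (@filterS _ (nbhs p) (nbhs_filter p) _ _ _ d) => q dq.
have dfq : derivable f q (e_ i).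
  by apply/derivable_mxP => a j; rewrite (ord1 a); exact: dq.
by split=> // j; rewrite /partial derive_mx// mxE.
Qed.

Lemma Ck_at_on n k U (f : 'rV[R]_2 -> 'rV[R]_n) :
  (forall p, U p -> forall j, Ck_at k (fun q => f q 0 j) p) -> Ck_on k U f.
Proof.
elim: k f => [|k IH] f sf.
  move=> p /set_mem Up; apply/row_continuousP => j.
  exact: Ck_at_continuous (sf p Up j).
have s1 p : U p -> forall j, Ck_at 1 (fun q => f q 0 j) p.
  by move=> Up j; exact: Ck_at_le (sf p Up j).
move=> i; split.
  by move=> p /s1 /(near_partial_rowE i) /nbhs_singleton[].
apply: IH => p Up j.
have s : Ck_at k (partial i (fun q => f q 0 j)) p by exact: Ck_at_partial (sf p Up j).
apply: Ck_at_eq s.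
apply: (@filterS _ (nbhs p) (nbhs_filter p) _ _ _ (near_partial_rowE i (s1 p Up))).
by move=> q [_ E]; rewrite E.
Qed.

Lemma smooth_on_at n U (f : 'rV[R]_2 -> 'rV[R]_n) p :
  (\forall q \near p, U q) -> smooth_on U f ->
  forall j, smooth_at (fun q => f q 0 j) p.
Proof. by move=> nU s j k; exact: Ck_on_at nU (s k) j. Qed.

Lemma free_unitmx n (v : 'I_n -> 'rV[R]_n) :
  free [seq v i | i <- enum 'I_n] = (\matrix_i v i \in unitmx).
Proof.
set X := [seq v i | i <- enum 'I_n].
have sX : size X = n by rewrite size_map size_enum_ord.
have EX (i : 'I_n) : X`_i = v i.
  by rewrite (nth_map i) ?size_enum_ord// nth_ord_enum.
have E (k : 'I_n -> R) : \sum_(i < n) k i *: X`_i = (\row_i k i) *m \matrix_i v i.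
  rewrite mulmx_sum_row; apply: eq_bigr => i _.
  by rewrite EX rowK mxE.
have -> : free X = free (tcast sX (in_tuple X)) by rewrite val_tcast.
apply/freeP/idP => [H|uM k].
  apply: unitmx_of_left_kernel => w w0.
  have := H (fun i => w 0 i); rewrite val_tcast /= E.
  rewrite (_ : \row_i w 0 i = w); last by apply/rowP => i; rewrite mxE.
  by move=> /(_ w0) z; apply/rowP => i; rewrite z mxE.
rewrite val_tcast /= E => k0 i.
have := congr1 (mulmx^~ (invmx (\matrix_i v i))) k0.
rewrite mulmxK// mul0mx => /(congr1 (fun w : 'rV[R]_n => w 0 i)).
by rewrite !mxE.
Qed.

Lemma vpartial_partial (f : 'rV[R]_2 -> 'rV[R]_5) p i : smooth5_at f p ->
  \forall q \near p, partial i f q = vpartial i f q.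
Proof.
move=> sf; have H := near_partial_rowE i (fun j => sf j 1).
apply: (@filterS _ (nbhs p) (nbhs_filter p) _ _ _ H) => q [_ E].
by apply/rowP => j; rewrite mxE E.
Qed.

Lemma vpartial_partial2 (f : 'rV[R]_2 -> 'rV[R]_5) p i j : smooth5_at f p ->
  partial i (partial j f) p = vpartial i (vpartial j f) p.
Proof.
move=> sf; rewrite /partial (near_eq_derive _ (vpartial_partial j sf)).
exact: nbhs_singleton (vpartial_partial i (smooth5_vpartial j sf)).
Qed.

(** Five vectors in R^5 are independent exactly if the matrix of their
    coordinates is invertible, that is, if it annihilates no nonzero
    linear form. *)
Lemma free_jetP (g : 'rV[R]_2 -> 'rV[R]_5) p : smooth5_at g p ->
  let dx := @partial R 'rV[R]_5 0 in
  let dy := @partial R 'rV[R]_5 1 in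
  free [:: dx g p; dy g p; dx (dx g) p; dx (dy g) p; dy (dy g) p] <-> free_at g p.
Proof.
move=> sg dx dy.
pose v := [:: vpartial 0 g p; vpartial 1 g p; vpartial 0 (vpartial 0 g) p;
   vpartial 0 (vpartial 1 g) p; vpartial 1 (vpartial 1 g) p].
have -> : [:: dx g p; dy g p; dx (dx g) p; dx (dy g) p; dy (dy g) p] = v.
  rewrite /dx /dy (vpartial_partial2 0 0 sg) (vpartial_partial2 0 1 sg).
  rewrite (vpartial_partial2 1 1 sg).
  rewrite (nbhs_singleton (vpartial_partial 0 sg)).
  by rewrite (nbhs_singleton (vpartial_partial 1 sg)).
have -> : v = [seq v`_i | i : 'I_5 <- enum 'I_5].
  transitivity (map (nth 0 v) (iota 0 5)); first by [].
  by rewrite -val_enum_ord -map_comp.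
rewrite free_unitmx.
have D (l w : 'rV[R]_5) : l *m w^T = (\sum_(j < 5) l 0 j * w 0 j)%:M.
  apply/matrixP => a b; rewrite !mxE (ord1 a) (ord1 b) mulr1n.
  by apply: eq_bigr => j _; rewrite mxE.
set M := \matrix_i _.
have LM (l : 'rV[R]_5) (i : 'I_5) : (l *m M^T) 0 i = \sum_(j < 5) l 0 j * v`_i 0 j.
  by rewrite mxE; apply: eq_bigr => j _; rewrite !mxE.
have dE (l : 'rV[R]_5) g' : dotf l g' p = \sum_(j < 5) l 0 j * g' p 0 j by [].
split=> [uM l F|fg].
  have Mz : l *m M^T = 0.
    apply/rowP => i; rewrite LM mxE; have [F1 F2] := F.
    elim/ord5_ind: i => /=; rewrite -dE.
    - by rewrite -(partial_dotf l 0 sg).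
    - by rewrite -(partial_dotf l 1 sg).
    - by rewrite -(partial2_dotf l 0 0 sg).
    - by rewrite -(partial2_dotf l 1 0 sg).
    - by rewrite -(partial2_dotf l 1 1 sg).
  by rewrite -(mulmxK (_ : M^T \in unitmx) l) ?unitmx_tr// Mz mul0mx.
rewrite -unitmx_tr; apply: unitmx_of_left_kernel => l lM.
have Z (i : 'I_5) : \sum_(j < 5) l 0 j * v`_i 0 j = 0 by rewrite -LM lM mxE.
have Z0 := Z (@o5 0 isT); have Z1 := Z (@o5 1 isT); have Z2 := Z (@o5 2 isT).
have Z3 := Z (@o5 3 isT); have Z4 := Z (@o5 4 isT).
apply: fg; split=> [i|i j].
  by rewrite (partial_dotf l i sg); case: (rV2_ord i) => ->; [exact: Z0|exact: Z1].
rewrite (partial2_dotf l j i sg).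
case: (rV2_ord i) => ->; case: (rV2_ord j) => ->.
- exact: Z2.
- exact: Z3.
- apply: etrans Z3; apply: eq_bigr => k _.
  have C := vpartialC 1 0 sg.
  exact: (congr1 (fun w : 'rV[R]_5 => l 0 k * w 0 k) C).
- exact: Z4.
Qed.

End CkOn.

(** * Free maps on surfaces *)

Section Surfaces.
Variable R : realType.
Implicit Types (M N P : surface R) (p q v w : 'rV[R]_2).

Lemma mem_ccod (T : topologicalType) (c : chart R T) x : cdom c x ->
  ccod c (cmap c x).
Proof. by move=> cx; exists x. Qed.

Lemma paramK (T : topologicalType) (c : chart R T) x : cdom c x ->
  param c (cmap c x) = x.
Proof. by move=> cx; apply: cmapK; exact: mem_set. Qed.

Lemma ccod_param (T : topologicalType) (c : chart R T) v : ccod c v ->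
  cdom c (param c v) /\ cmap c (param c v) = v.
Proof. by case=> x cx <-; rewrite paramK. Qed.

Lemma param_cvg (T : topologicalType) (c : chart R T) v : ccod c v ->
  {for v, continuous (param c)}.
Proof. by move=> cv; apply: param_continuous; exact: mem_set. Qed.

Lemma near_param (T : topologicalType) (c : chart R T) x (A : T -> Prop) :
  cdom c x -> (\forall y \near x, A y) ->
  \forall v \near cmap c x, [/\ cdom c (param c v), cmap c (param c v) = v &
    A (param c v)].
Proof.
move=> cx nA.
have n1 : \forall v \near cmap c x, ccod c v.
  by apply: open_nbhs_nbhs; split; [exact: ccod_open|exact: mem_ccod].
have n2 : \forall v \near cmap c x, A (param c v).
  by apply: (param_cvg (mem_ccod cx)); rewrite paramK.
near=> v.
have /ccod_param[a b] : ccod c v by exact: (near n1 v).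
by split => //; exact: (near n2 v).
Unshelve. all: by end_near. Qed.

Definition smooth_free_map_at M (f : M -> 'rV[R]_5) (x : M) : Prop :=
  forall c, atlas c -> cdom c x -> smooth_free_at (f \o param c) (cmap c x).

Lemma Free_inftyP M (f : M -> 'rV[R]_5) :
  Free_infty M f <-> forall x, smooth_free_map_at f x.
Proof.
split=> [[Cf [_ ff]] x c ac cx|sf].
  have s : smooth5_at (f \o param c) (cmap c x).
    move=> j k; apply: Ck_on_at (Cf k c ac) j.
    by apply: open_nbhs_nbhs; split; [exact: ccod_open|exact: mem_ccod].
  split => //; apply/(free_jetP s).
  exact: ff ac (mem_ccod cx).
have C k : Ck_map k f.
  move=> c ac; apply: Ck_at_on => p [x cx <-] j.
  by have [s _] := sf x c ac cx; exact: s.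
split => //; split => // c p ac [x cx <-].
have [s fx] := sf x c ac cx.
by apply/(free_jetP s).
Qed.

Lemma smooth_free_map_at_eq M (f g : M -> 'rV[R]_5) x :
  (\forall y \near x, f y = g y) -> smooth_free_map_at f x ->
  smooth_free_map_at g x.
Proof.
move=> fg sf c ac cx; apply: smooth_free_at_eq (sf c ac cx).
have H := near_param cx fg.
by apply: (@filterS _ (nbhs (cmap c x)) (nbhs_filter _) _ _ _ H) => v [].
Qed.

Lemma transition_smooth_at (T : topologicalType) (c d : chart R T) x :
  compatible c d -> cdom c x -> cdom d x ->
  smooth_map_at (cmap d \o param c) (cmap c x).
Proof.
move=> [cd _] cx dx; apply: smooth_on_at cd.
have nd : \forall y \near x, cdom d y.
  by apply: open_nbhs_nbhs; split => //; exact: cdom_open.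
have H := near_param cx nd.
apply: (@filterS _ (nbhs (cmap c x)) (nbhs_filter _) _ _ _ H) => v [a b e].
by exists (param c v).
Qed.

(** The transition map between two charts has a smooth inverse, so
    [smooth_free_at_comp] transfers freeness from one chart to the other. *)
Lemma smooth_free_map_at_chart M (f : M -> 'rV[R]_5) x (c : chart R M) :
  atlas c -> cdom c x -> smooth_free_at (f \o param c) (cmap c x) ->
  smooth_free_map_at f x.
Proof.
move=> ac cx sf d ad dx.
have cd := atlas_compatible ac ad; have dc := atlas_compatible ad ac.
pose T := cmap c \o param d; pose S := cmap d \o param c.
have Tp : T (cmap d x) = cmap c x by rewrite /T /= paramK.
have nc : \forall y \near x, cdom c y.
  by apply: open_nbhs_nbhs; split => //; exact: cdom_open.
have nd : \forall y \near x, cdom d y.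
  by apply: open_nbhs_nbhs; split => //; exact: cdom_open.
have sT : smooth_map_at T (cmap d x) by exact: transition_smooth_at dc dx cx.
have sS : smooth_map_at S (T (cmap d x)).
  by rewrite Tp; exact: transition_smooth_at cd cx dx.
have sfT : smooth_free_at ((f \o param c) \o T) (cmap d x).
  apply: (smooth_free_at_comp sT sS); last by rewrite Tp.
    by rewrite Tp /S /= paramK.
  rewrite Tp; have H := near_param cx nd.
  apply: (@filterS _ (nbhs (cmap c x)) (nbhs_filter _) _ _ _ H) => v [a b e].
  by rewrite /T /S /= paramK.
apply: smooth_free_at_eq sfT.
have H := near_param dx nc.
apply: (@filterS _ (nbhs (cmap d x)) (nbhs_filter _) _ _ _ H) => v [a b e].
by rewrite /T /= paramK.
Qed.

Lemma smooth_free_map_at_affine M (f : M -> 'rV[R]_5) (A : 'M[R]_5)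
    (a : 'rV[R]_5) x : A \in unitmx -> smooth_free_map_at f x ->
  smooth_free_map_at (fun y => f y *m A + a) x.
Proof.
move=> uA sf c ac cx.
exact: (@smooth_free_at_affine _ (f \o param c) A a _ uA (sf c ac cx)).
Qed.

(** In charts, h near i x is f composed with the inverse of i, which is smooth
    with smooth inverse. *)
Lemma smooth_free_map_at_embedding M P (U : set M) (i : M -> P)
    (f : M -> 'rV[R]_5) (h : P -> 'rV[R]_5) x :
  open_embedding_on U i -> U x -> (forall y, U y -> h (i y) = f y) ->
  smooth_free_map_at f x -> smooth_free_map_at h (i x).
Proof.
move=> oe Ux hf sf e ae ex.
have [oU oiU [ci si] [g gK [cg sg]]] := oe.
have [c ac cx] := atlas_cover x.
have gKx y : U y -> g (i y) = y by move=> Uy; apply: gK; exact: mem_set.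
have iUx : (i @` U) (i x) by exists x.
have ix : {for x, continuous i} by apply: ci; exact: mem_set.
have gx : {for i x, continuous g} by apply: cg; exact: mem_set.
pose T := cmap c \o g \o param e; pose S := cmap e \o i \o param c.
have Tp : T (cmap e (i x)) = cmap c x by rewrite /T /= paramK// gKx.
have nP : \forall z \near i x, (i @` U) z /\ cdom c (g z).
  have n1 : \forall z \near i x, (i @` U) z by apply: open_nbhs_nbhs.
  have n2 : \forall z \near i x, cdom c (g z).
    apply: gx; rewrite gKx//.
    by apply: open_nbhs_nbhs; split => //; exact: cdom_open.
  by near=> z; split; [exact: (near n1 z)|exact: (near n2 z)].
have nM : \forall y \near x, U y /\ cdom e (i y).
  have n1 : \forall y \near x, U y by apply: open_nbhs_nbhs.
  have n2 : \forall y \near x, cdom e (i y).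
    by apply: ix; apply: open_nbhs_nbhs; split => //; exact: cdom_open.
  by near=> y; split; [exact: (near n1 y)|exact: (near n2 y)].
have HP := near_param ex nP; have HM := near_param cx nM.
have sT : smooth_map_at T (cmap e (i x)).
  apply: smooth_on_at (sg e c ae ac).
  apply: (@filterS _ (nbhs (cmap e (i x))) (nbhs_filter _) _ _ _ HP).
  by move=> v [a b [a' b']]; exists (param e v).
have sS : smooth_map_at S (T (cmap e (i x))).
  rewrite Tp; apply: smooth_on_at (si c e ac ae).
  apply: (@filterS _ (nbhs (cmap c x)) (nbhs_filter _) _ _ _ HM).
  by move=> v [a b [a' b']]; exists (param c v).
have sfT : smooth_free_at ((f \o param c) \o T) (cmap e (i x)).
  apply: (smooth_free_at_comp sT sS); last by rewrite Tp; exact: sf.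
    by rewrite Tp /S /= paramK.
  rewrite Tp.
  apply: (@filterS _ (nbhs (cmap c x)) (nbhs_filter _) _ _ _ HM).
  by move=> v [a b [a' b']]; rewrite /T /S /= paramK// gKx.
apply: smooth_free_at_eq sfT.
apply: (@filterS _ (nbhs (cmap e (i x))) (nbhs_filter _) _ _ _ HP).
move=> v [a b [[y Uy Ey] gy]].
by move: gy; rewrite /T /= -Ey gKx// => cy; rewrite paramK// hf.
Unshelve. all: by end_near. Qed.

(** The value at the centre of the disc, [H 0], is junk: the patched map is only
    used away from that point. *)
Definition patch M (c : chart R M) (H : 'rV[R]_2 -> 'rV[R]_5)
    (f : M -> 'rV[R]_5) (x : M) : 'rV[R]_5 :=
  if `[< cdom c x /\ enorm (cmap c x) < 1 >] then H (cmap c x) else f x.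

Lemma patch_in M (c : chart R M) H (f : M -> 'rV[R]_5) x :
  cdom c x -> enorm (cmap c x) < 1 -> patch c H f x = H (cmap c x).
Proof. by move=> cx x1; rewrite /patch asboolT. Qed.

Lemma patch_param M (c : chart R M) H (f : M -> 'rV[R]_5) v :
  ccod c v -> enorm v < 1 -> patch c H f (param c v) = H v.
Proof. by move=> /ccod_param[cv Ev] v1; rewrite patch_in ?Ev. Qed.

(** Inside the open disc the patched map is H in the chart; elsewhere it equals f
    off the closed disc of radius 3/4. That disc is compact, hence closed in the
    Hausdorff space M, so its complement is a neighbourhood of all the other
    points. *)
Lemma smooth_free_patch M (c : chart R M) H (f : M -> 'rV[R]_5) :
  disc_chart c -> (forall x, smooth_free_map_at f x) ->
  (forall q, 0 < enorm q -> enorm q < 1 -> smooth_free_at H q) ->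
  (forall q, 3 / 4 <= enorm q -> enorm q < 1 -> H q = f (param c q)) ->
  forall x, x <> param c 0 -> smooth_free_map_at (patch c H f) x.
Proof.
move=> [ac dc] sf sH EH x xn0.
have [[cx x1]|out] := pselect (cdom c x /\ enorm (cmap c x) < 1).
  apply: (smooth_free_map_at_chart ac cx).
  have x0 : 0 < enorm (cmap c x).
    rewrite enorm_gt0; apply/eqP => E; apply: xn0.
    by rewrite -E paramK.
  apply: smooth_free_at_eq (sH _ x0 x1).
  have H1 : \forall v \near cmap c x, enorm v < 1.
    exact: (@cvgr_lt _ _ (nbhs (cmap c x)) _ _ _ (@enorm_continuous R _) _ x1).
  have H2 : \forall v \near cmap c x, [/\ cdom c (param c v),
      cmap c (param c v) = v & True].
    by apply: (near_param (A := fun=> True) cx); exact: filterT.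
  near=> v.
  have [a b _] : [/\ cdom c (param c v), cmap c (param c v) = v & True].
    exact: (near H2 v).
  by rewrite /= patch_in// b//; exact: (near H1 v).
pose K := param c @` [set v : 'rV[R]_2 | 0 <= enorm v <= 3 / 4].
have sub (v : 'rV[R]_2) : enorm v <= 3 / 4 -> ccod c v.
  by move=> v34; apply: dc => /=; lra.
have cK : closed K.
  apply: (compact_closed (@points_hausdorff R M)).
  apply: continuous_compact; last exact: compact_shell.
  apply: continuous_in_subspaceT => v /set_mem /= /andP[_ v34].
  by apply: param_cvg; exact: sub.
have Kx : ~ K x.
  move=> [v /= /andP[_ v34] E]; apply: out.
  have [a b] := ccod_param (sub v v34).
  by rewrite -E b; split => //; lra.
have nK : \forall y \near x, ~ K y.
  by apply: open_nbhs_nbhs; split => //; exact: closed_openC.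
apply: smooth_free_map_at_eq (sf x).
apply: filterS nK => y Ky; rewrite /patch.
case: asboolP => // -[cy y1]; rewrite EH//; first by rewrite paramK.
rewrite leNgt; apply/negP => y34; apply: Ky; exists (cmap c y) => /=.
  by rewrite enorm_ge0 ltW.
by rewrite paramK.
Unshelve. all: by end_near. Qed.

Lemma enorm_disc_swap q : 0 < enorm q -> enorm q <= 1 ->
  enorm (disc_swap q) = 1 - enorm q.
Proof.
move=> q0 q1; rewrite enormZ ger0_norm; last by rewrite divr_ge0 ?subr_ge0// ltW.
by rewrite divfK// gt_eqF.
Qed.

Lemma disc_swapK q : 0 < enorm q -> enorm q < 1 -> disc_swap (disc_swap q) = q.
Proof.
move=> q0 q1; rewrite {1}/disc_swap (enorm_disc_swap q0 (ltW q1)).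
rewrite /disc_swap scalerA (_ : _ * _ = 1) ?scale1r//.
by field; rewrite !gt_eqF// subr_gt0.
Qed.

Lemma smooth_disc_swap q : 0 < enorm q -> smooth_map_at (@disc_swap R) q.
Proof.
move=> q0 j; have qn0 : q != 0 by rewrite -enorm_gt0.
have s := smooth_enorm qn0.
rewrite (_ : (fun r => disc_swap r 0 j) =
  fun r => (1 - enorm r) * (enorm r)^-1 * r 0 j); last first.
  by apply/funext => r; rewrite mxE.
apply: smoothM; last exact: smooth_coord.
apply: smoothM; first by apply: smoothB => //; exact: smooth_cst.
by apply: smoothV => //; rewrite gt_eqF.
Qed.

Lemma smooth_free_disc_swap H q : 0 < enorm q -> enorm q < 1 ->
  (forall r, 0 < enorm r -> enorm r < 1 -> smooth_free_at H r) ->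
  smooth_free_at (H \o @disc_swap R) q.
Proof.
move=> q0 q1 sH.
have E := enorm_disc_swap q0 (ltW q1).
have s0 : 0 < enorm (disc_swap q) by rewrite E subr_gt0.
have s1 : enorm (disc_swap q) < 1 by rewrite E; lra.
apply: (@smooth_free_at_comp _ _ (@disc_swap R)).
- exact: smooth_disc_swap.
- exact: smooth_disc_swap.
- exact: disc_swapK.
- have H0 : \forall v \near disc_swap q, 0 < enorm v.
    exact: (@cvgr_gt _ _ (nbhs (disc_swap q)) _ _ _ (@enorm_continuous R _) _ s0).
  have H1 : \forall v \near disc_swap q, enorm v < 1.
    exact: (@cvgr_lt _ _ (nbhs (disc_swap q)) _ _ _ (@enorm_continuous R _) _ s1).
  by near=> v; apply: disc_swapK; [exact: (near H0 v)|exact: (near H1 v)].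
- exact: sH.
Unshelve. all: by end_near. Qed.

Lemma glue_maps (T1 T2 T V : Type) (U1 : set T1) (U2 : set T2) (i : T1 -> T)
    (j : T2 -> T) (f1 : T1 -> V) (f2 : T2 -> V) (v0 : V) :
  {in U1 &, injective i} -> {in U2 &, injective j} ->
  (forall x y, U1 x -> U2 y -> i x = j y -> f1 x = f2 y) ->
  exists h : T -> V, (forall x, U1 x -> h (i x) = f1 x) /\
    (forall y, U2 y -> h (j y) = f2 y).
Proof.
move=> ii ij f12.
pose h z := if pselect (exists2 x, U1 x & i x = z) is left e
  then f1 (sval (cid2 e))
  else if pselect (exists2 y, U2 y & j y = z) is left e then f2 (sval (cid2 e))
  else v0.
exists h; split=> [x Ux|y Uy]; rewrite /h.
  case: pselect => [e|[]]; last by exists x.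
  case: cid2 => x' /= Ux' E; congr f1.
  by apply: ii => //; exact: mem_set.
case: pselect => [e|_].
  by case: cid2 => x' /= Ux' E; exact: f12 E.
case: pselect => [e|[]]; last by exists y.
case: cid2 => y' /= Uy' E; congr f2.
by apply: ij => //; exact: mem_set.
Qed.

Lemma open_embedding_injective M P (U : set M) (i : M -> P) :
  open_embedding_on U i -> {in U &, injective i}.
Proof.
move=> [_ _ _ [g gK _]] x y Ux Uy E.
by rewrite -(gK x Ux) E gK.
Qed.

End Surfaces.

Theorem theorem1 (R : realType) (M N P : surface R) :
  compact [set: M] -> connected [set: M] ->
  compact [set: N] -> connected [set: N] ->
  connected_sum M N P ->
  Free_infty M !=set0 -> Free_infty N !=set0 ->
  Free_infty P !=set0.
Proof.
move=> _ _ _ _ [c [d [i [j [[Dc Dd] oi oj cover glue]]]]].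
move=> [f /Free_inftyP sf] [g /Free_inftyP sg].
have [ac dc] := Dc; have [ad dd] := Dd.
have sF q : enorm q <= 1 -> smooth_free_at (f \o param c) q.
  by move=> /dc /ccod_param[cq Eq]; rewrite -Eq; exact: sf.
have sG q : enorm q <= 1 -> smooth_free_at (g \o param d) q.
  by move=> /dd /ccod_param[dq Eq]; rewrite -Eq; exact: sg.
have [H [A [B [a [b [[uA uB] sH HF HG]]]]]] := bridge sF sG.
pose f' x := f x *m A + a; pose g' y := g y *m B + b.
have sf' x : smooth_free_map_at f' x by exact: smooth_free_map_at_affine.
have sg' y : smooth_free_map_at g' y by exact: smooth_free_map_at_affine.
have sM := smooth_free_patch Dc sf' sH HF.
have sN : forall y, y <> param d 0 ->
    smooth_free_map_at (patch d (H \o @disc_swap R) g') y.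
  apply: (smooth_free_patch Dd sg') => q q0 q1.
    exact: smooth_free_disc_swap.
  have qp : 0 < enorm q by lra.
  have E := enorm_disc_swap qp (ltW q1).
  by rewrite /= HG ?E ?disc_swapK//; lra.
(* The swap exchanges t u and (1 - t) u, so the two patched maps take the same
   value at identified points. *)
have agree x y : (~` [set param c 0]) x -> (~` [set param d 0]) y -> i x = j y ->
    patch c H f' x = patch d (H \o @disc_swap R) g' y.
  move=> Mx Ny /(glue x y Mx Ny).1[t [u [/andP[t0 t1] u1 -> ->]]].
  have n1 : enorm (t *: u) = t by rewrite enormZ u1 mulr1 gtr0_norm.
  have n2 : enorm ((1 - t) *: u) = 1 - t.
    by rewrite enormZ u1 mulr1 gtr0_norm// subr_gt0.
  rewrite patch_param ?n1//; last by apply: dc; rewrite /= n1 ltW.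
  rewrite patch_param ?n2//; first last.
  - by lra.
  - by apply: dd; rewrite /= n2; lra.
  rewrite /= /disc_swap n2 scalerA; congr (H (_ *: _)).
  by field; rewrite gt_eqF// subr_gt0.
have [h [hi hj]] := glue_maps (0 : 'rV[R]_5) (open_embedding_injective oi)
  (open_embedding_injective oj) agree.
exists h; apply/Free_inftyP => z.
have : [set: P] z by []; rewrite -cover => -[[x Mx <-]|[y Ny <-]].
  by apply: (smooth_free_map_at_embedding oi Mx hi); exact: sM.
by apply: (smooth_free_map_at_embedding oj Ny hj); exact: sN.
Qed.
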